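(* Let $\nabla$ be a $C^\infty$ affine connection in a neighborhood of the origin of $\mathbf{R}^2$. Suppose that there are two Killing vector fields of $\nabla$ that are linearly independent at $0$ and that $\nabla$ is not torsion-free and flat (i.e., its torsion and curvature do not both vanish identically). Then the Lie algebra of Killing vector fields of $\nabla$ has dimension at most four and is either: (1) two-dimensional; (2) isomorphic to $\mathfrak{o}(3,\mathbf{R})$; (3) isomorphic to $\mathfrak{sl}(2,\mathbf{R})$; or (4) in suitable coordinates $(x,y)$, generated by the vector fields $x\,\partial/\partial x$, $\partial/\partial y$ and those of the form $h(y)\,\partial/\partial x$, where $h$ ranges over the solutions of a second-order linear differential equation with constant coefficients $h''+\alpha h'+\beta h=0$, for some $\alpha,\beta\in\mathbf{R}$.
   Context: An affine connection $\nabla$ on a manifold is a map $(X,Y)\mapsto\nabla_XY$ on (local) $C^\infty$ vector fields, biadditive and such that $\nabla_{fX}(gY)=fg\nabla_XY+f(X\cdot g)Y$ for functions $f,g$; it is not assumed to be torsion-free. Its torsion is $T(X,Y)=\nabla_XY-\nabla_YX-[X,Y]$ and its curvature is $R(X,Y)=\nabla_X\nabla_Y-\nabla_Y\nabla_X-\nabla_{[X,Y]}$; the connection is torsion-free if $T\equiv0$ and flat if $R\equiv0$. A (local) vector field $X$ is a Killing vector field of $\nabla$ if its local flow preserves $\nabla$, equivalently, if $[X,\nabla_YZ]-\nabla_Y[X,Z]=\nabla_{[X,Y]}Z$ for all local vector fields $Y,Z$. The Lie algebra of Killing vector fields is that of Killing vector fields of $\nabla$ defined in a neighborhood of the origin (germs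 at the origin). ''Suitable coordinates'' are local $C^\infty$ coordinates around the origin. *)

(* Defs.v *)
From HB Require Import structures.
From mathcomp Require Import all_boot all_order all_algebra.
From mathcomp Require Import all_classical all_reals all_analysis.

Set Implicit Arguments.
Unset Strict Implicit.
Unset Printing Implicit Defensive.

Import Order.TTheory GRing.Theory Num.Theory numFieldNormedType.Exports.

Local Open Scope classical_set_scope.
Local Open Scope ring_scope.

Notation plane R := 'rV[R]_2.
Notation vfield R := ('rV[R]_2 -> 'rV[R]_2).

(* Vector fields and functions are total; those that are only locally defined
   on an open set V are represented by any extension, and every condition below
   is relative to an open set on which its arguments are smooth. *)

Section Smooth.
Context {R : realType} {W : normedModType R}.
Implicit Type f : plane R -> W.

Definition partial (i : 'I_2) f : plane R -> W :=
  fun p => 'D_('e_i) f p.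

Fixpoint Ck (k : nat) (V : set (plane R)) f : Prop :=
  (forall p, V p -> {for p, continuous f}) /\
  if k is k'.+1 then
    forall i : 'I_2, (forall p, V p -> derivable f p 'e_i) /\
                     Ck k' V (partial i f)
  else True.

Definition smooth (V : set (plane R)) f : Prop := forall k, Ck k V f.

End Smooth.

Section Connections.
Context {R : realType}.
Implicit Types (U V W : set (plane R)) (X Y Z : vfield R).
Implicit Type nabla : vfield R -> vfield R -> vfield R.

Definition fscale (f : plane R -> R) X : vfield R := fun p => f p *: X p.

Definition deriv_along X (g : plane R -> R) : plane R -> R :=
  fun p => 'D_(X p) g p.

Definition lie_bracket X Y : vfield R :=
  fun p => 'D_(X p) Y p - 'D_(Y p) X p.

(* [conn_local] makes the value on V depend only on the local fields on V, so
   that nabla is a family of operators, one for each open subset of U,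
   compatible with restrictions. *)
Record affine_connection U nabla : Prop := {
  conn_local : forall V X X' Y Y', open V -> V `<=` U ->
    smooth V X -> smooth V Y -> {in V, X =1 X'} -> {in V, Y =1 Y'} ->
    {in V, nabla X Y =1 nabla X' Y'};
  conn_smooth : forall V X Y, open V -> V `<=` U ->
    smooth V X -> smooth V Y -> smooth V (nabla X Y);
  conn_addl : forall V X X' Y, open V -> V `<=` U ->
    smooth V X -> smooth V X' -> smooth V Y ->
    {in V, nabla (X + X') Y =1 nabla X Y + nabla X' Y};
  conn_addr : forall V X Y Y', open V -> V `<=` U ->
    smooth V X -> smooth V Y -> smooth V Y' ->
    {in V, nabla X (Y + Y') =1 nabla X Y + nabla X Y'};
  conn_leibniz : forall V (f g : plane R -> R) X Y, open V -> V `<=` U ->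
    smooth V f -> smooth V g -> smooth V X -> smooth V Y ->
    {in V, nabla (fscale f X) (fscale g Y) =1
           fscale (f * g) (nabla X Y) + fscale (f * deriv_along X g) Y} }.

Definition torsion nabla X Y : vfield R :=
  nabla X Y - nabla Y X - lie_bracket X Y.

Definition curvature nabla X Y Z : vfield R :=
  nabla X (nabla Y Z) - nabla Y (nabla X Z) - nabla (lie_bracket X Y) Z.

Definition torsion_free V nabla : Prop :=
  forall W X Y, open W -> W `<=` V -> smooth W X -> smooth W Y ->
    {in W, torsion nabla X Y =1 0}.

Definition flat V nabla : Prop :=
  forall W X Y Z, open W -> W `<=` V ->
    smooth W X -> smooth W Y -> smooth W Z ->
    {in W, curvature nabla X Y Z =1 0}.

Definition killing V nabla X : Prop :=
  smooth V X /\
  forall W Y Z, open W -> W `<=` V -> smooth W Y -> smooth W Z ->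
    {in W, lie_bracket X (nabla Y Z) - nabla Y (lie_bracket X Z) =1
           nabla (lie_bracket X Y) Z}.

Definition killing_germ U nabla : set (vfield R) :=
  [set X | exists V, [/\ open V, V 0, V `<=` U & killing V nabla X]].

End Connections.

(* Vector spaces and Lie algebras of germs at the origin are represented by
   sets of representatives, and equality of germs by [germ_eq]. *)
Section Germs.
Context {R : realType}.
Implicit Types (X Y : vfield R) (K S : set (vfield R)).

Definition germ_eq X Y : Prop := \forall p \near (0 : plane R), X p = Y p.

Definition germ_span S : set (vfield R) :=
  [set X | exists (m : nat) (c : 'I_m -> R) (F : 'I_m -> vfield R),
     (forall i, S (F i)) /\ germ_eq X (\sum_i c i *: F i)].

Definition germ_free (m : nat) (b : 'I_m -> vfield R) : Prop :=
  forall c : 'I_m -> R, germ_eq (\sum_i c i *: b i) 0 -> forall i, c i = 0.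

Definition germ_dim K (m : nat) : Prop :=
  exists b : 'I_m -> vfield R, germ_free b /\ K = germ_span (range b).

(* theta chooses representatives of the images under a linear isomorphism from
   the matrix Lie algebra g, with the commutator, onto the germs of K. *)
Definition germ_lie_iso K (n : nat) (g : set 'M[R]_n) : Prop :=
  exists theta : 'M[R]_n -> vfield R,
    [/\ forall A, g A -> K (theta A),
        forall (a : R) A B, g A -> g B ->
          germ_eq (theta (a *: A + B)) (a *: theta A + theta B),
        forall A B, g A -> g B ->
          germ_eq (theta (A *m B - B *m A)) (lie_bracket (theta A) (theta B)),
        forall A, g A -> germ_eq (theta A) 0 -> A = 0
      & forall X, K X -> exists2 A, g A & germ_eq X (theta A)].

End Germs.

Definition o3 (R : realType) : set 'M[R]_3 := [set A | A^T = - A].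
Definition sl2 (R : realType) : set 'M[R]_2 := [set A | \tr A = 0].
Arguments o3 R : clear implicits.
Arguments sl2 R : clear implicits.

Section Coordinates.
Context {R : realType}.

(* phi : V -> V' is a chart around the origin, with inverse psi. *)
Definition local_coordinates (V V' : set (plane R)) (phi psi : vfield R) : Prop :=
  [/\ open V /\ V 0, open V',
      smooth V phi /\ smooth V' psi,
      phi @` V `<=` V' /\ psi @` V' `<=` V
    & {in V, cancel phi psi} /\ {in V', cancel psi phi}].

(* The vector field d/dx_i on the source of the chart phi = (x_0, x_1): the image
   of the i-th basis vector under the differential of the inverse chart psi. *)
Definition coord_field (phi psi : vfield R) (i : 'I_2) : vfield R :=
  fun p => partial i psi (phi p).

Definition ode_solution (alpha beta : R) (h : R -> R) : Prop :=
  forall t : R, [/\ derivable h t 1, derivable h^`()%classic t 1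
    & h^`(2)%classic t + alpha * h^`()%classic t + beta * h t = 0].

Definition model_generators (phi psi : vfield R) (alpha beta : R) :
    set (vfield R) :=
  let x p := phi p 0 0 in
  let y p := phi p 0 1 in
  let dx := coord_field phi psi 0 in
  let dy := coord_field phi psi 1 in
  [set X | [\/ X = fscale x dx, X = dy
             | exists2 h, ode_solution alpha beta h & X = fscale (h \o y) dx]].

End Coordinates.

(* Main.v *)
(** Germs of functions at the origin form a ring with two commuting derivations
    on which a Killing field acts algebraically; any frame of commuting vector
    fields provides another such pair of derivations, which replaces a change of
    coordinates. A Killing field is determined by its 1-jet at the origin, so the
    Killing algebra is spanned by two transverse fields and the isotropy algebra,
    whose linear parts are 2 x 2 matrices preserving the torsion and the curvature
    at 0. These are not both zero, for otherwise they would vanish identically.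

    Hence an isotropy matrix with nonzero trace is singular. An invertible
    isotropy matrix is traceless and spans the isotropy; two transverse Killing
    fields cannot then commute, for the Christoffel symbols would be constant,
    hence zero, and the algebra is simple of dimension 3. If the isotropy is
    nonzero and nilpotent, then it is a line spanned by N with [N, Y] = X, and by
    Jacobi's identity the algebra is either sl(2) or that of a connection having
    the Killing fields f(y) d/dx, f'' + p f' = r f, in coordinates where X and N are
    of this form and Y = d/dy; but this connection always has one more Killing
    field, of the form (x + phi(y)) d/dx. Finally, an isotropy field W with linear
    part diag(1, 0) comes with a nilpotent one for the same reason, and then
    W = x d/dx in the preceding coordinates, which is the fourth case. *)
Require Import Defs.
From HB Require Import structures.
From mathcomp Require Import all_boot all_order all_algebra.
From mathcomp Require Import all_classical all_reals all_analysis.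
From mathcomp Require Import ring_quotient generic_quotient.
From mathcomp Require Import ring lra.

Set Implicit Arguments.
Unset Strict Implicit.
Unset Printing Implicit Defensive.

Import Order.TTheory GRing.Theory Num.Theory numFieldNormedType.Exports.

Local Open Scope classical_set_scope.
Local Open Scope ring_scope.

(** * Smooth functions of two variables *)

(** All uniqueness statements (Killing fields from their 1-jets, zeros of torsion and curvature, the
    Cauchy problem) are instances of one: finitely many germs that vanish at the origin and whose
    derivatives lie in the ideal they generate are zero. Torsion and curvature are 2-forms, so in a
    frame they become a vector t and an endomorphism r, and the linear part L of an isotropy field
    satisfies L t = tr(L) t and [L, r] = tr(L) r at the origin. If L has eigenvalues l and m, a
    nonzero t or r makes l + m equal to l, m, 0 or +-(l - m): the trace or an eigenvalue is zero. If
    L is traceless and invertible, then t = 0 and r commutes with L. That r is traceless is not an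
    algebraic fact: tr(r) is the curvature of the line bundle of bivectors, and its covariant
    derivative is a covector killed by the transpose of L, hence zero at the origin and then
    everywhere; a curvature that is parallel for its own connection vanishes. *)

Section PartialDerivatives.
Context {R : realType}.
Implicit Types (V W : set (plane R)) (p q : plane R) (i : 'I_2).

Lemma open_near V p : open V -> V p -> \forall q \near p, V q.
Proof. by move=> oV Vp; apply: open_nbhs_nbhs. Qed.

Section Normed.
Context {E : normedModType R}.
Implicit Types f g : plane R -> E.

Lemma Ck_continuous k V f p : Ck k V f -> V p -> {for p, continuous f}.
Proof. by case: k => [|k] [] cf _ Vp; exact: cf. Qed.

Lemma Ck_derivable k V f p i : Ck k.+1 V f -> V p -> derivable f p 'e_i.
Proof. by move=> [_ /(_ i)[df _]]; exact: df. Qed.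

Lemma Ck_partial k V f i : Ck k.+1 V f -> Ck k V (partial i f).
Proof. by move=> [_ /(_ i)[]]. Qed.

Lemma CkS k V f : Ck k.+1 V f -> Ck k V f.
Proof.
elim: k f => [f [cf _]//|k IH f [cf df]]; split=> // i.
by have [dfi Hf] := df i; split=> //; exact: IH.
Qed.

Lemma Ck_le k m V f : (m <= k)%N -> Ck k V f -> Ck m V f.
Proof.
move=> /subnK <-; elim: (k - m)%N => // n IH; rewrite addSn => /CkS; exact: IH.
Qed.

Lemma Ck_sub k V W f : W `<=` V -> Ck k V f -> Ck k W f.
Proof.
move=> WV; elim: k f => [f [cf _]|k IH f [cf df]]; split=> //.
- by move=> p /WV; exact: cf.
- by move=> p /WV; exact: cf.
- move=> i; have [dfi Hf] := df i; split; last exact: IH.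
  by move=> p /WV; exact: dfi.
Qed.

Lemma near_partial f g p i : (\forall q \near p, f q = g q) ->
  \forall q \near p, partial i f q = partial i g q.
Proof.
move=> /near_join fg; near=> q; rewrite /partial; apply: near_eq_derive.
by near: q.
Unshelve. all: by end_near. Qed.

Lemma near_eq_continuous f g p : (\forall q \near p, f q = g q) ->
  {for p, continuous f} -> {for p, continuous g}.
Proof.
move=> fg; rewrite /prop_for/continuous_at -(nbhs_singleton fg) => cf.
by apply: cvg_trans cf; exact: near_eq_cvg fg.
Qed.

(** [V] is open so that derivatives at its points do not see the values outside [V]. *)
Lemma Ck_eq k V f g : open V -> (forall p, V p -> f p = g p) ->
  Ck k V f -> Ck k V g.
Proof.
move=> oV; elim: k f g => [f g fg [cf _]|k IH f g fg [cf df]].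
  split=> // p Vp; apply: near_eq_continuous (cf _ Vp).
  by near=> q; apply: fg; near: q; exact: open_near.
have nfg p : V p -> \forall q \near p, f q = g q.
  by move=> Vp; near=> q; apply: fg; near: q; exact: open_near.
split=> [p Vp|i]; first by apply: near_eq_continuous (cf _ Vp); exact: nfg.
have [dfi Hf] := df i; split.
  by move=> p Vp; apply: near_eq_derivable (dfi _ Vp); exact: nfg.
apply: IH Hf => p Vp; rewrite /partial; apply: near_eq_derive; exact: nfg.
Unshelve. all: by end_near. Qed.

Lemma Ck_cst k V (c : E) : Ck k V (fun=> c).
Proof.
elim: k c => [c|k IH c]; split=> //; try by move=> p _; exact: cst_continuous.
move=> i; split; first by move=> p _; exact: derivable_cst.
rewrite (_ : partial i _ = fun=> 0); first exact: IH.
by apply/funext => p; rewrite /partial derive_cst.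
Qed.

Lemma CkD k V f g : open V -> Ck k V f -> Ck k V g -> Ck k V (f + g).
Proof.
move=> oV; elim: k f g => [f g [cf _] [cg _]|k IH f g [cf df] [cg dg]].
  by split=> // p Vp; apply: continuousD; [exact: cf|exact: cg].
split=> [p Vp|i]; first by apply: continuousD; [exact: cf|exact: cg].
have [dfi Hf] := df i; have [dgi Hg] := dg i; split.
  by move=> p Vp; apply: derivableD; [exact: dfi|exact: dgi].
apply: (@Ck_eq _ _ (partial i f + partial i g)) => //; last exact: IH.
by move=> p Vp; rewrite /partial deriveD//; [exact: dfi|exact: dgi].
Qed.

End Normed.

Implicit Types f g : plane R -> R.

Lemma CkM k V f g : open V -> Ck k V f -> Ck k V g -> Ck k V (f * g).
Proof.
move=> oV; elim: k f g => [f g [cf _] [cg _]|k IH f g Cf Cg].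
  by split=> // p Vp; apply: continuousM; [exact: cf|exact: cg].
have [[cf df] [cg dg]] := (Cf, Cg).
split=> [p Vp|i]; first by apply: continuousM; [exact: cf|exact: cg].
have [dfi Hf] := df i; have [dgi Hg] := dg i; split.
  by move=> p Vp; apply: derivableM; [exact: dfi|exact: dgi].
apply: (@Ck_eq _ _ _ (f * partial i g + g * partial i f)) => //.
  by move=> p Vp; rewrite /partial deriveM//; [exact: dfi|exact: dgi].
by apply: CkD => //; apply: IH => //; exact: CkS.
Qed.

Lemma CkN k V f : open V -> Ck k V f -> Ck k V (- f).
Proof.
move=> oV Cf; rewrite (_ : - f = (fun=> -1) * f); last first.
  by apply/funext => p; rewrite /= !fctE mulN1r.
by apply: CkM => //; exact: Ck_cst.
Qed.

Lemma CkV k V f : open V -> (forall p, V p -> f p != 0) -> Ck k V f ->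
  Ck k V (fun p => (f p)^-1).
Proof.
move=> oV f0; elim: k => [[cf _]|k IH Cf].
  by split=> // p Vp; apply: continuousV; [exact: f0|exact: cf].
have [cf df] := Cf.
split=> [p Vp|i]; first by apply: continuousV; [exact: f0|exact: cf].
have [dfi Hf] := df i; split.
  by move=> p Vp; apply: derivableV; [exact: f0|exact: dfi].
pose g := fun p => (f p)^-1.
apply: (@Ck_eq _ _ _ (- (g * g * partial i f))) => //.
  move=> p Vp; rewrite /partial deriveV//; [|exact: f0|exact: dfi].
  by rewrite !fctE /g /GRing.scale/= expr2 invfM mulNr.
by apply: CkN => //; apply: CkM => //; apply: CkM => //; apply: IH; exact: CkS.
Qed.

Lemma continuous_coord i : continuous (fun p : plane R => p 0 i).
Proof. exact: coord_continuous. Qed.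

Lemma is_derive_coord i p (v : plane R) :
  is_derive p v (fun p : plane R => p 0 i) (v 0 i).
Proof.
have d := differentiable_coord p 0 i; split; first exact: diff_derivable.
rewrite deriveE//; have l : linear (fun q : plane R => q 0 i : R).
  by move=> a u w; rewrite !mxE.
pose L := GRing.isLinear.Build _ _ _ _ _ l.
pose f : {linear plane R -> R} := HB.pack (fun q : plane R => q 0 i : R) L.
by rewrite [LHS](_ : _ = 'd f p v)// diff_lin//; exact: coord_continuous.
Qed.

Lemma partial_coord i (j : 'I_2) : partial i (fun p => p 0 j) = fun=> (i == j)%:R.
Proof.
by apply/funext => p; rewrite /partial (@derive_val _ _ _ _ _ _ _ (is_derive_coord _ _ _)) mxE eqxx eq_sym.
Qed.

End PartialDerivatives.

(** * Strict differentiability of C1 functions *)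

Section FirstOrder.
Context {R : realType}.
Implicit Types (V W : set (plane R)) (p q : plane R) (i : 'I_2).

Definition ix0 : 'I_2 := 0.
Definition ix1 : 'I_2 := 1.

Lemma ix0E : ix0 = 0. Proof. by []. Qed.
Lemma ix1E : ix1 = 1. Proof. by []. Qed.
Lemma ix0_neq1 : (ix0 == ix1) = false. Proof. by []. Qed.
Lemma ix1_neq0 : (ix1 == ix0) = false. Proof. by []. Qed.

Lemma ord2 i : i = ix0 \/ i = ix1.
Proof. by case: i => [[|[|//]] ?]; [left|right]; exact: val_inj. Qed.

(* The numerals 0 and 1 of ['I_2] unfold to ring operations during unification. *)
#[global] Opaque ix0 ix1.

Lemma planeP p q : p 0 ix0 = q 0 ix0 -> p 0 ix1 = q 0 ix1 -> p = q.
Proof.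
by move=> e0 e1; apply/rowP => i; have [->|->] := ord2 i.
Qed.

(** The norm of row vectors is the sup norm: balls are squares with sides along the axes, so the
    corner of a path that follows the axes stays in any ball containing its ends. *)
Lemma plane_norm_lt p (r : R) : 0 < r ->
  (`|p| < r) = (`|p 0 ix0| < r) && (`|p 0 ix1| < r).
Proof.
move=> r0; apply/idP/idP => [pr|/andP[p0 p1]].
  by apply/andP; split; apply: le_lt_trans pr;
    rewrite [leRHS]/Num.norm/= mx_normrE; exact: (le_bigmax _ _ (0, _)).
rewrite [ltLHS]/Num.norm/= mx_normrE bigmax_lt// => -[a b] _ /=.
by rewrite ord1; have [->|->] := ord2 b.
Qed.

Lemma plane_norm_coord p i : `|p 0 i| <= `|p|.
Proof.
by rewrite [leRHS]/Num.norm/= mx_normrE; exact: (le_bigmax _ _ (0, i)).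
Qed.

Lemma open_ball_sub V p : open V -> V p ->
  exists2 r : R, 0 < r & forall q, `|q - p| < r -> V q.
Proof.
move=> oV Vp; have /nbhs_ballP[r /= r0 rV] := open_nbhs_nbhs (conj oV Vp).
by exists r => // q qr; apply: rV; rewrite -ball_normE /= distrC.
Qed.

Lemma is_derive_line {E : normedModType R} (f : plane R -> E) q v s :
  derivable f (q + s *: v) v ->
  is_derive s (1 : R) (fun t => f (q + t *: v)) ('D_v f (q + s *: v)).
Proof.
have D : (fun h : R => h^-1 *: ((f \o shift (q + s *: v)) (h *: v) -
             f (q + s *: v))) =
  (fun h : R => h^-1 *: (((fun t => f (q + t *: v)) \o shift s) (h *: (1 : R)) -
             f (q + s *: v))).
  apply/funext => h /=; congr (_ *: (f _ - _)).
  by rewrite [h *: (1 : R)]mulr1 scalerDl addrCA.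
by move=> df; split; rewrite /derivable /derive -D.
Qed.

(** The intermediate point lies a fraction [k] of the way, with [k] in [0, 1], so that [t] may have
    either sign. *)
Lemma mvt_line (f : plane R -> R) q v (t : R) :
  (forall k : R, 0 <= k <= 1 -> derivable f (q + (k * t) *: v) v) ->
  exists2 k : R, 0 <= k <= 1 & f (q + t *: v) - f q = t * 'D_v f (q + (k * t) *: v).
Proof.
move=> df; pose g k := f (q + (k * t) *: v).
have dg (k : R) : 0 <= k <= 1 -> is_derive k (1 : R) g (t * 'D_v f (q + (k * t) *: v)).
  move=> k01; have dl := is_derive_line (df _ k01).
  have dm : is_derive k (1 : R) (fun k : R => k * t) t.
    by apply: is_derive_eq; rewrite scaler0 add0r [LHS]mulr1.
  by have := @is_derive1_comp R (fun t => f (q + t *: v)) ( *%R^~ t) k _ _ dl dm; rewrite mulrC.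
have cg : {within `[0, 1], continuous g}.
  apply: derivable_within_continuous => k /=; rewrite in_itv/= => k01.
  by have [] := dg _ k01.
have [k kI gE] := MVT_segment ler01 (fun k kI => dg k (subset_itv_oo_cc kI)) cg.
by exists k => //; move: gE; rewrite /g mul1r mul0r scale0r addr0 subr0 mulr1.
Qed.

Lemma ball_segment p q i (t r k : R) : 0 < r -> 0 <= k <= 1 ->
  `|q - p| < r -> `|q + t *: 'e_i - p| < r -> `|q + (k * t) *: 'e_i - p| < r.
Proof.
move=> r0 /andP[k0 k1].
have E (s : R) j : (q + s *: 'e_i - p) 0 j = (q - p) 0 j + s * ('e_i : plane R) 0 j.
  by rewrite !(mxE _ (fun=> _)) addrAC.
rewrite !plane_norm_lt// !E.
have conv (a b : R) : `|a| < r -> `|a + t * b| < r -> `|a + k * t * b| < r.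
  rewrite !ltr_norml => /andP[a0 a1] /andP[b0 b1].
  have -> : a + k * t * b = (1 - k) * a + k * (a + t * b) by ring.
  have [->|kn1] := eqVneq k 1; first by apply/andP; split; lra.
  have k'0 : 0 < 1 - k by rewrite subr_gt0 lt_neqAle kn1.
  by apply/andP; split; nra.
move=> /andP[q0 q1] /andP[t0 t1].
by rewrite (conv _ _ q0 t0) (conv _ _ q1 t1).
Qed.

(** The path from [x] to [y] has one side along each axis, and the mean value theorem on each side
    costs at most [e / 2] times the norm. Both [x] and [y] vary, as the inverse function theorem
    requires; [partial_continuous] derives continuity of [f] from the estimate. *)
Lemma strict_differentiability_partial V (f : plane R -> R) p (e : R) :
  open V -> (forall i q, V q -> derivable f q 'e_i) ->
  (forall i, {for p, continuous (partial i f)}) -> V p -> 0 < e ->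
  exists2 r, 0 < r & forall x y, `|x - p| < r -> `|y - p| < r ->
    `|f y - f x - ((y - x) 0 ix0 * partial ix0 f p + (y - x) 0 ix1 * partial ix1 f p)|
      <= e * `|y - x|.
Proof.
move=> oV df cf Vp e0; have e20 : 0 < e / 2 by rewrite divr_gt0.
have near_p i : exists2 r, 0 < r & forall q, `|q - p| < r ->
    `|partial i f q - partial i f p| <= e / 2.
  have /cvgrPdist_le/(_ _ e20) := cf i.
  move=> /nbhs_ballP[r /= r0 rf]; exists r => // q qr.
  by rewrite distrC; apply: rf; rewrite -ball_normE /= distrC.
have [r0 r00 f0] := near_p ix0; have [r1 r10 f1] := near_p ix1.
have [r2 r20 rV] := open_ball_sub oV Vp.
pose r := Num.min r0 (Num.min r1 r2).
have rgt0 : 0 < r by rewrite !lt_min r00 r10.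
exists r => // x y xr yr; set h := y - x.
pose z := x + h 0 ix0 *: 'e_ix0.
have zy : y = z + h 0 ix1 *: 'e_ix1.
  by apply: planeP; rewrite !mxE/= ?ix0_neq1 ?ix1_neq0 ?eqxx/= ?mulr0 ?mulr1 ?addr0; ring.
have zr : `|z - p| < r.
  move: xr yr; rewrite !plane_norm_lt// !mxE/= ix1_neq0 eqxx/= mulr1 mulr0 addr0.
  by move=> /andP[x0 x1] /andP[y0 y1]; rewrite (addrC (x 0 ix0)) subrK y0.
have ballV q : `|q - p| < r -> V q by rewrite !lt_min => /and3P[_ _]; exact: rV.
have step q i t : `|q - p| < r -> `|q + t *: 'e_i - p| < r ->
    `|f (q + t *: 'e_i) - f q - t * partial i f p| <= e / 2 * `|t|.
  move=> qr qtr; have seg (k : R) : 0 <= k <= 1 -> `|q + (k * t) *: 'e_i - p| < r.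
    by move=> k01; exact: ball_segment.
  have [k k01 ->] := @mvt_line f q 'e_i t (fun k k01 =>
    df i _ (ballV _ (seg _ k01))).
  rewrite -mulrBr normrM mulrC ler_wpM2r//; have := seg _ k01.
  rewrite !lt_min => /and3P[+ + _].
  case: (ord2 i) => -> s0 s1.
  - exact: f0.
  - exact: f1.
have st0 := step x ix0 (h 0 ix0) xr zr.
have st1 := step z ix1 (h 0 ix1) zr; rewrite -zy in st1; have {}st1 := st1 yr.
have split_sum (a b c u w : R) : a - c - (u + w) = (b - c - u) + (a - b - w) by ring.
rewrite (split_sum _ (f z)).
apply: le_trans (ler_normD _ _) _; apply: le_trans (lerD st0 st1) _.
by rewrite [in leRHS](splitr e) mulrDl lerD// ler_wpM2l// ?(ltW e20)//
  plane_norm_coord.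
Qed.

Lemma strict_differentiability V (f : plane R -> R) p (e : R) :
  open V -> Ck 1 V f -> V p -> 0 < e ->
  exists2 r, 0 < r & forall x y, `|x - p| < r -> `|y - p| < r ->
    `|f y - f x - ((y - x) 0 ix0 * partial ix0 f p + (y - x) 0 ix1 * partial ix1 f p)|
      <= e * `|y - x|.
Proof.
move=> oV Cf Vp; apply: (strict_differentiability_partial oV) => // [i q Vq|i].
  exact: Ck_derivable Cf Vq.
exact: Ck_continuous (Ck_partial i Cf) Vp.
Qed.

(** For the primitive of a closed 1-form only the partial derivatives are known at first; its
    continuity has to come from them. *)
Lemma partial_continuous V (f : plane R -> R) p :
  open V -> (forall i q, V q -> derivable f q 'e_i) ->
  (forall i, {for p, continuous (partial i f)}) -> V p -> {for p, continuous f}.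
Proof.
move=> oV df cf Vp; have Fp : Filter (nbhs p) := nbhs_filter p.
have [r r0 fr] := strict_differentiability_partial oV df cf Vp ltr01.
pose M : R := 1 + `|partial ix0 f p| + `|partial ix1 f p|.
have M0 : 0 < M by rewrite /M -addrA ltr_pwDl// addr_ge0.
apply/(@cvgrPdist_le _ _ _ (nbhs p) Fp) => e e0; near=> q.
have qr : `|q - p| < Num.min r (e / M).
  near: q; apply/nbhs_ballP; exists (Num.min r (e / M)).
    by rewrite /= lt_min r0 divr_gt0.
  by move=> x; rewrite -ball_normE /= distrC.
move: qr; rewrite lt_min => /andP[qr]; rewrite ltr_pdivlMr// => qM.
have := fr p q; rewrite subrr normr0 => /(_ r0 qr).
have := plane_norm_coord (q - p) ix0; have := plane_norm_coord (q - p) ix1.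
move: ((q - p) 0 ix0) ((q - p) 0 ix1) => u w; move: `|q - p| qM => H HM wH uH.
rewrite mul1r (distrC (f p)); move: (f q - f p) => d dH; apply: le_trans (ltW HM).
rewrite -(subrK (u * partial ix0 f p + w * partial ix1 f p) d).
apply: le_trans (ler_normD _ _) _; rewrite /M -addrA mulrDr mulr1.
apply: lerD => //; apply: le_trans (ler_normD _ _) _; rewrite !normrM mulrDr.
by apply: lerD; apply: ler_wpM2r.
Unshelve. all: by end_near. Qed.

Lemma Ck_differentiable V (f : plane R -> R) p : open V -> Ck 1 V f -> V p ->
  is_diff p f (fun h : plane R => h 0 ix0 * partial ix0 f p + h 0 ix1 * partial ix1 f p).
Proof.
move=> oV Cf Vp; set L := fun h : plane R => _.
have lin (a u1 u2 w1 w2 c d : R) : (a * u1 + w1) * c + (a * u2 + w2) * d =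
  a * (u1 * c + u2 * d) + (w1 * c + w2 * d) by ring.
have lL : linear L by move=> a u w; rewrite /L !mxE; exact: lin.
pose df : {linear plane R -> R} := HB.pack L (GRing.isLinear.Build _ _ _ _ _ lL).
have cL : continuous L.
  move=> h; apply: (@continuousD _ _ _ (fun h : plane R => h 0 ix0 * _)
    (fun h : plane R => h 0 ix1 * _)); apply: continuousM;
    by [exact: continuous_coord|exact: cst_continuous].
have fE : f \o shift p = cst (f p) + (df : plane R -> R) +o_ (0 : plane R) id.
  apply/(@eqaddoP _ _ _ _ (nbhs_filter_on (0 : plane R))) => e e0.
  have [r r0 fr] := strict_differentiability oV Cf Vp e0.
  near=> h => /=; have := fr p (h + p).
  rewrite subrr normr0 addrK => /(_ r0) H; rewrite !fctE.
  rewrite opprD addrA; apply: H; near: h.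
  exact: (@nbhs0_lt R 'rV[R]_2 r r0).
have dfE : 'd f p = df :> (plane R -> R) := @diff_unique R _ _ f df p cL fE.
by apply: DiffDef => //; apply/diff_locallyP; split; rewrite dfE.
Unshelve. all: by end_near. Qed.

Lemma deriveE_partial V (f : plane R -> R) p (v : plane R) :
  open V -> Ck 1 V f -> V p ->
  is_derive p v f (v 0 ix0 * partial ix0 f p + v 0 ix1 * partial ix1 f p).
Proof.
move=> oV Cf Vp; have [df dfE] := Ck_differentiable oV Cf Vp.
by split; [exact: diff_derivable|rewrite deriveE// dfE].
Qed.

End FirstOrder.

(** * Symmetry of mixed derivatives *)

Section Schwarz.
Context {R : realType}.
Implicit Types (V W : set (plane R)) (p q : plane R) (i j : 'I_2).

Lemma is_derive_translate (f : plane R -> R) q v w df :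
  is_derive (q + w) v f df -> is_derive q v (fun x => f (x + w)) df.
Proof.
have D : (fun h : R => h^-1 *: ((f \o shift (q + w)) (h *: v) - f (q + w))) =
  (fun h : R => h^-1 *: (((fun x => f (x + w)) \o shift q) (h *: v) - f (q + w))).
  by apply/funext => h /=; rewrite addrA.
by move=> [df1 df2]; split; move: df1 df2; rewrite /derivable /derive D.
Qed.

Lemma norm_delta i : `|'e_i : plane R| <= 1.
Proof.
rewrite [leLHS]/Num.norm/= mx_normrE bigmax_le// => -[a b] _ /=.
by rewrite mxE; case: (_ && _); rewrite ?normr1 ?normr0.
Qed.

Lemma norm_scale_delta i (t : R) : `|t *: 'e_i : plane R| <= `|t|.
Proof. by rewrite normrZ ler_piMr// norm_delta. Qed.

Lemma partialE (f : plane R -> R) i q : partial i f q = 'D_('e_i) f q.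
Proof. by []. Qed.

#[local] Opaque partial derive.

(** Mean value theorem in direction [i] for the difference [g] in direction [j], then in direction
    [j] for [partial i f]. *)
Lemma second_difference V (f : plane R -> R) p i j (t r : R) : open V -> Ck 2 V f ->
  (forall q, `|q - p| < r -> V q) -> `|t| + `|t| < r ->
  exists2 q, `|q - p| < r &
    f (p + t *: 'e_i + t *: 'e_j) - f (p + t *: 'e_i) - (f (p + t *: 'e_j) - f p)
    = t * (t * partial j (partial i f) q).
Proof.
move=> oV Cf rV tr.
have kt (k : R) : 0 <= k <= 1 -> `|k * t| <= `|t|.
  by move=> /andP[k0 k1]; rewrite normrM ger0_norm// ler_piMl.
have in_r (a b : R) : `|a| <= `|t| -> `|b| <= `|t| ->
    `|p + a *: 'e_i + b *: 'e_j - p| < r.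
  move=> ab bt; rewrite addrC -addrA addKr.
  apply: le_lt_trans tr; apply: le_trans (ler_normD _ _) _.
  by apply: lerD; apply: le_trans (norm_scale_delta _ _) _.
have in_r0 (a : R) : `|a| <= `|t| -> `|p + a *: 'e_i - p| < r.
  move=> at_; have := in_r a 0 at_; rewrite normr0 scale0r addr0; exact.
have Di q : V q -> is_derive q 'e_i f (partial i f q).
  by move=> Vq; rewrite partialE; apply/derivableP; exact: Ck_derivable Cf Vq.
pose g q := f (q + t *: 'e_j) - f q.
have Dg (k : R) : 0 <= k <= 1 -> is_derive (p + (k * t) *: 'e_i) 'e_i g
    (partial i f (p + (k * t) *: 'e_i + t *: 'e_j) -
     partial i f (p + (k * t) *: 'e_i)).
  move=> k01; have D1 := is_derive_translate (Di _ (rV _ (in_r _ _ (kt _ k01) (lexx _)))).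
  have D2 := Di _ (rV _ (in_r0 _ (kt _ k01))).
  exact: is_deriveB D1 D2.
have [k k01 gE] := @mvt_line _ g p 'e_i t (fun k k01 => @ex_derive _ _ _ _ _ _ _ (Dg k k01)).
have C1 : Ck 1 V (partial i f) := Ck_partial i Cf.
have [k' k'01 hE] := @mvt_line _ (partial i f) (p + (k * t) *: 'e_i) 'e_j t
  (fun k' k'01 => Ck_derivable C1 (rV _ (in_r _ _ (kt _ k01) (kt _ k'01)))).
exists (p + (k * t) *: 'e_i + (k' * t) *: 'e_j); first by apply: in_r; exact: kt.
by rewrite [LHS]gE (@derive_val _ _ _ _ _ _ _ (Dg k k01)) -?partialE hE.
Qed.

(** The second difference over a small square is symmetric in [i] and [j], so the two mixed
    derivatives agree at two points [q] and [q'] close to [p]; continuity brings both to [p]. *)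
Lemma Ck_schwarz V (f : plane R -> R) p i j : open V -> Ck 2 V f -> V p ->
  partial i (partial j f) p = partial j (partial i f) p.
Proof.
move=> oV Cf Vp; apply/eqP; rewrite -subr_eq0 -normr_le0; apply/ler_addgt0Pl => e e0.
have e20 : 0 < e / 2 by rewrite divr_gt0.
have near_p k l : exists2 r, 0 < r & forall q, `|q - p| < r ->
    `|partial k (partial l f) p - partial k (partial l f) q| <= e / 2.
  have /cvgrPdist_le/(_ _ e20) := Ck_continuous (Ck_partial k (Ck_partial l Cf)) Vp.
  move=> /nbhs_ballP[r /= r0 rf]; exists r => // q qr.
  by apply: rf; rewrite -ball_normE /= distrC.
have [r0 r00 f0] := near_p i j; have [r1 r10 f1] := near_p j i.
have [r2 r20 rV] := open_ball_sub oV Vp.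
pose r := Num.min r0 (Num.min r1 r2).
have rgt0 : 0 < r by rewrite !lt_min r00 r10.
have rV' q : `|q - p| < r -> V q by rewrite !lt_min => /and3P[_ _]; exact: rV.
have [t t0 tr] : exists2 t : R, 0 < t & `|t| + `|t| < r.
  by exists (r / 4); rewrite ?divr_gt0// gtr0_norm ?divr_gt0//; lra.
have [q qr qE] := second_difference i j oV Cf rV' tr.
have [q' q'r q'E] := second_difference j i oV Cf rV' tr.
have E : partial j (partial i f) q = partial i (partial j f) q'.
  have tn0 : t != 0 by rewrite gt_eqF.
  have swap (a b c d : R) : a - b - (c - d) = a - c - (b - d) by ring.
  apply: (mulfI tn0); apply: (mulfI tn0); apply: etrans (esym qE) (etrans _ q'E).
  by rewrite (addrAC p (t *: 'e_j)); exact: swap.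
have b0 : `|q' - p| < r0 by move: q'r; rewrite lt_min => /andP[].
have b1 : `|q - p| < r1 by move: qr; rewrite !lt_min => /and3P[].
have key (A B C D : R) : C = D -> `|A - D| <= e / 2 -> `|B - C| <= e / 2 ->
    `|A - B| <= e + 0.
  move=> -> AD; rewrite distrC => DB; rewrite addr0 (splitr e).
  by apply: le_trans (ler_distD D _ _) _; exact: lerD.
exact: key E (f0 _ b0) (f1 _ b1).
Qed.

End Schwarz.

(** * Uniqueness for linear total differential systems *)

Section Uniqueness.
Context {R : realType}.
Implicit Types (V W : set (plane R)) (p q : plane R) (i j : 'I_2).

Lemma compact_plane_ball p (r : R) : compact [set q : plane R | `|q - p| <= r].
Proof.
apply: bounded_closed_compact.
  exists (`|p| + r); split; first exact: num_real.
  move=> M Mr q /= qr; rewrite -(subrK p q); apply: le_trans (ler_normD _ _) _.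
  by apply: ltW; apply: le_lt_trans Mr; rewrite addrC lerD2l.
rewrite (_ : [set q | _] = (fun q : plane R => `|q - p|) @^-1` [set x | x <= r]).
  2: by [].
apply: closed_comp; last exact: closed_le.
move=> q _; apply: continuous_comp; last exact: norm_continuous.
by apply: continuousB; [exact: cvg_id|exact: cst_continuous].
Qed.

#[local] Opaque partial derive.

(** A contraction argument in place of Gronwall's inequality: let [S], the sum of the absolute
    values of the [u a], have its maximum at [m] on a small closed ball around the common zero [p];
    the mean value theorem along rays from [p] gives [S m <= S m / 2]. *)
Lemma linear_system_unique n (u : 'I_n -> plane R -> R)
    (c : 'I_2 -> 'I_n -> 'I_n -> plane R -> R) V p :
  open V -> V p -> (forall a, Ck 1 V (u a)) -> (forall i a b, Ck 0 V (c i a b)) ->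
  (forall i a q, V q -> partial i (u a) q = \sum_b c i a b q * u b q) ->
  (forall a, u a p = 0) -> \forall q \near p, forall a, u a q = 0.
Proof.
move=> oV Vp Cu Cc du u0.
have [r1 r10 r1V] := open_ball_sub oV Vp.
have [C C0 [r2 r20 r2C]] : exists2 C : R, 0 < C & exists2 r2, 0 < r2 &
    forall q, `|q - p| < r2 -> forall i a b, `|c i a b q| <= C.
  (* A bound for all coefficients at [p], with room 1 for their variation near [p]; the last [+ 1]
     keeps it positive when [n = 0]. *)
  pose C := \sum_i \sum_a \sum_b (`|c i a b p| + 1) + 1.
  have C_ge0 i a b : 0 <= `|c i a b p| + 1 by rewrite addr_ge0.
  exists C; first by rewrite ltr_wpDl// !sumr_ge0// => *; rewrite !sumr_ge0// => *; rewrite sumr_ge0.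
  have : \forall q \near p, forall i a b, `|c i a b p - c i a b q| < 1.
    have Fp := @nbhs_filter _ p.
    apply: (@filter_forall _ _ (fun i q => forall a b, _) _ Fp) => i.
    apply: (@filter_forall _ _ (fun a q => forall b, _) _ Fp) => a.
    apply: (@filter_forall _ _ (fun b q => _) _ Fp) => b.
    by have /cvgrPdist_lt := Ck_continuous (Cc i a b) Vp; apply.
  move=> /nbhs_ballP[r2 /= r20 rc]; exists r2 => // q qr i a b.
  have := rc q; rewrite -ball_normE /= distrC => /(_ qr i a b) /ltW h.
  rewrite -(subrK (c i a b p) (c i a b q)) (le_trans (ler_normD _ _))//.
  rewrite addrC distrC (le_trans (lerD (lexx _) h))//.
  apply: (@le_trans _ _ (\sum_i \sum_a \sum_b (`|c i a b p| + 1))).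
    rewrite (bigD1 i)//= (bigD1 a)//= (bigD1 b)//= -!addrA lerD2l lerDl.
    by rewrite !addr_ge0// !sumr_ge0// => *; rewrite ?sumr_ge0// => *; rewrite sumr_ge0.
  by rewrite lerDl.
pose N : R := n%:R + 1.
have N0 : 0 < N by rewrite ltr_wpDl.
(* For this radius, the sum over the [n] components of the bounds [r * (2 * (C * S m))] is at most
   half of [S m]. *)
have [r r0 [rr1 rr2 rK]] : exists2 r : R, 0 < r & [/\ r < r1, r < r2 & r * (4 * (N * C)) <= 1].
  pose k := (4 * (N * C))^-1; have k0 : 0 < k by rewrite invr_gt0 !mulr_gt0.
  exists (Num.min k (Num.min r1 r2 / 2)); first by rewrite lt_min k0 divr_gt0// lt_min r10.
  have m0 : 0 < Num.min r1 r2 by rewrite lt_min r10.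
  have m2 : Num.min r1 r2 / 2 < Num.min r1 r2 by lra.
  split.
  - by rewrite gt_min; apply/orP; right; apply: lt_le_trans m2 _; rewrite ge_min lexx.
  - by rewrite gt_min; apply/orP; right; apply: lt_le_trans m2 _; rewrite ge_min lexx orbT.
  - by rewrite -ler_pdivlMr ?mulr_gt0// mul1r ge_min lexx.
pose S q := \sum_a `|u a q|.
have S0 q : 0 <= S q by rewrite sumr_ge0.
pose B := [set q : plane R | `|q - p| <= r].
have BV q : B q -> V q by move=> Bq; apply: r1V; exact: le_lt_trans rr1.
have cS : {within B, continuous S}.
  apply: continuous_in_subspaceT => x /set_mem Bx.
  rewrite (_ : S = \sum_a (fun q => `|u a q|)); last first.
    by apply/funext => q; rewrite /S fct_sumE.
  apply: (big_ind (fun f : plane R -> R => {for x, continuous f})) => [||a _].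
  - exact: cst_continuous.
  - by move=> f g cf cg; exact: continuousD.
  - by apply: (@continuous_comp _ _ _ (u a)); [exact: Ck_continuous (Cu a) (BV _ Bx)|exact: norm_continuous].
have [m /set_mem Bm maxm] : exists2 m, m \in B & forall q, q \in B -> S q <= S m.
  apply: EVT_max_rV cS; last exact: compact_plane_ball.
  by exists p; rewrite /B/= subrr normr0 ltW.
have bound a q : B q -> `|u a q| <= r * (2 * (C * S m)).
  move=> Bq; pose v := q - p; have pv : p + v = q by rewrite /v addrC subrK.
  have Bk (k : R) : 0 <= k <= 1 -> B (p + (k * 1) *: v).
    move=> /andP[k0 k1]; rewrite /B/= mulr1 addrC addKr normrZ ger0_norm//.
    by apply: le_trans Bq; rewrite ler_piMl.
  have Dv (k : R) (k01 : 0 <= k <= 1) := deriveE_partial v oV (Cu a) (BV _ (Bk k k01)).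
  have [k k01] := @mvt_line _ (u a) p v 1 (fun k k01 => @ex_derive _ _ _ _ _ _ _ (Dv k k01)).
  rewrite u0 subr0 scale1r mul1r (@derive_val _ _ _ _ _ _ _ (Dv k k01)) pv => ->.
  have pb i : `|partial i (u a) (p + (k * 1) *: v)| <= C * S m.
    rewrite du; last exact/BV/Bk.
    apply: le_trans (ler_norm_sum _ _ _) _.
    apply: le_trans (_ : C * S (p + (k * 1) *: v) <= _).
      rewrite /S mulr_sumr ler_sum// => b _; rewrite normrM ler_wpM2r// r2C//.
      exact: le_lt_trans (Bk _ k01) rr2.
    by rewrite ler_wpM2l ?(ltW C0)// maxm//; apply/mem_set; exact: Bk.
  apply: le_trans (ler_normD _ _) _; rewrite !normrM.
  have vr i : `|v 0 i| <= r by apply: le_trans (plane_norm_coord _ _) _.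
  have CS0 : 0 <= C * S m by rewrite mulr_ge0// ltW.
  rewrite [leRHS](_ : _ = r * (C * S m) + r * (C * S m)); last by move: (C * _) => w; ring.
  by apply: lerD; apply: ler_pM.
have Sm : S m <= 0.
  have : S m <= \sum_(a < n) (r * (2 * (C * S m))) by rewrite ler_sum// => a _; exact: bound.
  rewrite sumr_const card_ord -mulr_natl => h.
  have : S m <= 2^-1 * S m.
    apply: le_trans h _; rewrite -[leLHS](_ : n%:R * C * r * 2 * S m = _); last by ring.
    rewrite ler_wpM2r//.
    have : n%:R * C <= N * C by rewrite ler_wpM2r ?(ltW C0)// lerDl.
    move: rK; move: (N * C) (n%:R * C) => x y rK yx.
    have : y * r <= x * r by rewrite ler_wpM2r// ltW.
    by lra.
  by have := S0 m; lra.
near=> q => a; apply/eqP; rewrite -normr_le0.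
have Bq : B q by near: q; apply/nbhs_ballP; exists r => // x; rewrite -ball_normE /= distrC; exact: ltW.
apply: le_trans Sm; apply: le_trans (maxm q (mem_set Bq)).
by rewrite /S (bigD1 a)//= lerDl sumr_ge0.
Unshelve. all: by end_near. Qed.

End Uniqueness.

(** * Chain rules *)

Section Composition.
Context {R : realType}.
Implicit Types (V W : set (plane R)) (p q : plane R) (i j : 'I_2).

Lemma line_quotient {E : normedModType R} (f : plane R -> E) q v :
  (fun h : R => h^-1 *: ((f \o shift q) (h *: v) - f q)) =
  (fun h : R => h^-1 *: (((fun t => f (q + t *: v)) \o shift 0) (h *: (1 : R)) -
             f (q + 0 *: v))).
Proof.
apply/funext => h /=; congr (_ *: (f _ - f _)); last by rewrite scale0r addr0.
by rewrite addr0 [h *: (1 : R)]mulr1 addrC.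
Qed.

Lemma derivable_lineP {E : normedModType R} (f : plane R -> E) q v :
  derivable f q v <-> derivable (fun t : R => f (q + t *: v)) 0 (1 : R).
Proof. by rewrite /derivable line_quotient. Qed.

Lemma derive_line {E : normedModType R} (f : plane R -> E) q v :
  'D_v f q = 'D_1 (fun t : R => f (q + t *: v)) 0.
Proof. by rewrite /derive line_quotient. Qed.

(** Restriction to the line through [q] makes the inner function one of a real variable, so
    directional derivability is enough for it. *)
Lemma is_derive_comp {E F : normedModType R} (f : plane R -> E) (g : E -> F) q v :
  derivable f q v -> differentiable g (f q) ->
  is_derive q v (g \o f) ('d g (f q) ('D_v f q)).
Proof.
move=> df dg; have /derivable_lineP/derivable1_diffP dl := df.
have dg0 : differentiable g (f (q + (0 : R) *: v)) by rewrite scale0r addr0.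
have dc := differentiable_comp dl dg0.
split; first by apply/derivable_lineP/derivable1_diffP.
rewrite derive_line; apply: etrans (deriveE _ dc) _; rewrite diff_comp//=.
by rewrite scale0r addr0 -(deriveE _ dl) -derive_line.
Qed.

Lemma partial_coordE (X : vfield R) q i j : derivable X q 'e_i ->
  partial i X q 0 j = partial i (fun p => X p 0 j) q.
Proof. by move=> dX; rewrite /partial derive_mx// mxE. Qed.

Lemma Ck_coordP k V (X : vfield R) : open V ->
  Ck k V X <-> forall j, Ck k V (fun p => X p 0 j).
Proof.
move=> oV; have cX (Y : vfield R) p : {for p, continuous Y} <->
    forall j, {for p, continuous (fun p => Y p 0 j)}.
  split=> [cY j|cY].
    by apply: (@continuous_comp _ _ _ Y (fun q => q 0 j)) => //; exact: continuous_coord.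
  have Fp : Filter (nbhs p) := nbhs_filter p.
  apply/(@cvgrPdist_lt _ _ _ (nbhs p) Fp) => e e0; near=> q.
  rewrite plane_norm_lt// !mxE; apply/andP; split.
    near: q; have /cvgrPdist_lt := cY ix0; exact.
  near: q; have /cvgrPdist_lt := cY ix1; exact.
elim: k X => [X|k IH X]; split.
- by move=> [c _] j; split=> // p Vp; exact: ((cX _ _).1 (c p Vp)).
- by move=> Cj; split=> // p Vp; apply/cX => j; exact: Ck_continuous (Cj j) Vp.
- move=> CX j; split=> [p Vp|i]; first exact: ((cX _ _).1 (Ck_continuous CX Vp)).
  split=> [p Vp|]; first exact: (derivable_mxP _ _ _).1 (Ck_derivable CX Vp) 0 j.
  have /(IH _).1/(_ j) := Ck_partial i CX; apply: Ck_eq => // p Vp.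
  by rewrite partial_coordE//; exact: Ck_derivable CX Vp.
- move=> Cj; split=> [p Vp|i].
    by apply/cX => j; exact: Ck_continuous (Cj j) Vp.
  have dX p : V p -> derivable X p 'e_i.
    move=> Vp; apply/derivable_mxP => a j; rewrite ord1.
    exact: Ck_derivable (Cj j) Vp.
  split; first exact: dX.
  apply/IH => j; apply: Ck_eq (Ck_partial i (Cj j)) => // p Vp.
  by rewrite partial_coordE//; exact: dX.
Unshelve. all: by end_near. Qed.

Lemma chain_rule V (g : plane R -> R) (X : vfield R) q v : open V -> Ck 1 V g ->
  V (X q) -> derivable X q v ->
  is_derive q v (g \o X) ('D_v X q 0 ix0 * partial ix0 g (X q) +
                          'D_v X q 0 ix1 * partial ix1 g (X q)).
Proof.
move=> oV Cg VX dX; have [dg dgE] := Ck_differentiable oV Cg VX.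
by have := is_derive_comp dX dg; rewrite dgE.
Qed.

Lemma Ck_comp k V W (g : plane R -> R) (X : vfield R) : open V -> open W ->
  Ck k V g -> Ck k W X -> (forall q, W q -> V (X q)) -> Ck k W (g \o X).
Proof.
move=> oV oW + + WV; elim: k g => [g [cg _] [cX _]|k IH g Cg CX].
  by split=> // p Wp; apply: continuous_comp; [exact: cX|exact/cg/WV].
have cr i q : W q -> is_derive q 'e_i (g \o X)
    (partial i X q 0 ix0 * partial ix0 g (X q) + partial i X q 0 ix1 * partial ix1 g (X q)).
  move=> Wq; apply: (@chain_rule V) => //; [exact: Ck_le Cg|exact: WV|].
  exact: Ck_derivable CX Wq.
split=> [p Wp|i].
  by apply: continuous_comp; [exact: Ck_continuous CX Wp|exact: Ck_continuous Cg (WV _ Wp)].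
split=> [p Wp|]; first by have [] := cr i p Wp.
have cj j : Ck k W (fun q => partial i X q 0 j).
  by have /(Ck_coordP _ _ oW) := Ck_partial i CX; exact.
apply: (@Ck_eq _ _ _ _ ((fun q => partial i X q 0 ix0) * (partial ix0 g \o X) +
  (fun q => partial i X q 0 ix1) * (partial ix1 g \o X))) => //.
  by move=> p Wp; rewrite [RHS](@derive_val _ _ _ _ _ _ _ (cr i p Wp)).
apply: CkD => //; apply: CkM => //; apply: IH; by [exact: Ck_partial|exact: CkS].
Qed.

Lemma partial_comp_real V (h : R -> R) (f : plane R -> R) i q : Ck 1 V f -> V q ->
  derivable h (f q) 1 -> is_derive q 'e_i (h \o f) (h^`()%classic (f q) * partial i f q).
Proof.
move=> Cf Vq dh; have dh' : differentiable h (f q) by apply/derivable1_diffP.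
have := is_derive_comp (@Ck_derivable _ _ _ _ _ _ i Cf Vq) dh'.
rewrite (deriv1E dh) => H; exact: (is_derive_eq H (mulrC _ _)).
Qed.

Lemma is_derive_derive1 {E : normedModType R} (f : R -> E) t :
  derivable f t 1 -> is_derive t (1 : R) f (f^`()%classic t).
Proof. by move=> df; rewrite derive1E; apply/derivableP. Qed.

(** The equation expresses the second derivative through differentiable functions; hence solutions
    are infinitely differentiable and their derivatives solve the same equation. *)
Lemma ode_solution_derive alpha beta (h : R -> R) : ode_solution alpha beta h ->
  ode_solution alpha beta h^`()%classic.
Proof.
move=> hs; pose h1 := h^`()%classic; pose h2 := h1^`()%classic.
have h2E : h2 = (fun t => - alpha * h1 t - beta * h t).
  apply/funext => t; have [_ _ e] := hs t.
  have {}e : h2 t + alpha * h1 t + beta * h t = 0 := e.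
  rewrite /=; move: e; move: (h2 t) (h1 t) (h t) => x y z e.
  have : x - (- alpha * y - beta * z) = 0 by rewrite -e; ring.
  by move/subr0_eq.
have dh2 t : is_derive t (1 : R) h2 (- alpha * h2 t - beta * h1 t).
  have [d0 d1 _] := hs t; rewrite {1}h2E.
  have D1 : is_derive t (1 : R) h1 (h2 t) := is_derive_derive1 d1.
  have D0 : is_derive t (1 : R) h (h1 t) := is_derive_derive1 d0.
  by apply: is_derive_eq.
move=> t; have [d0 d1 eq0] := hs t; split; first exact: d1.
  exact: (@ex_derive _ _ _ _ _ _ _ (dh2 t)).
have e3 : h2^`()%classic t = - alpha * h2 t - beta * h1 t.
  by rewrite derive1E; exact: (@derive_val _ _ _ _ _ _ _ (dh2 t)).
suff : h2^`()%classic t + alpha * h2 t + beta * h1 t = 0 by exact.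
by rewrite e3; move: (h2 t) (h1 t) => x y; ring.
Qed.

Lemma Ck_ode_solution k V alpha beta (h : R -> R) (f : plane R -> R) : open V ->
  ode_solution alpha beta h -> Ck k V f -> Ck k V (h \o f).
Proof.
move=> oV; elim: k h => [|k IH] h hs Cf.
  split=> // p Vp; apply: continuous_comp; first exact: Ck_continuous Cf Vp.
  by have [/derivable1_diffP/differentiable_continuous] := hs (f p).
have cr i q : V q -> is_derive q 'e_i (h \o f) (h^`()%classic (f q) * partial i f q).
  move=> Vq; apply: (@partial_comp_real V) => //; first exact: Ck_le Cf.
  by have [] := hs (f q).
split=> [p Vp|i].
  apply: continuous_comp; first exact: Ck_continuous Cf Vp.
  by have [/derivable1_diffP/differentiable_continuous] := hs (f p).
split=> [p Vp|]; first by have [] := cr i p Vp.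
apply: (@Ck_eq _ _ _ _ ((h^`()%classic \o f) * partial i f)) => //.
  by move=> p Vp; rewrite [RHS](@derive_val _ _ _ _ _ _ _ (cr i p Vp)).
apply: CkM => //; last exact: Ck_partial.
by apply: IH (ode_solution_derive hs) (CkS Cf).
Qed.

End Composition.

(** * Inverse functions and closed 1-forms *)

Lemma linear_system2 (F : idomainType) (u w a1 a2 a3 a4 : F) : a1 * a4 - a3 * a2 != 0 ->
  u * a1 + w * a2 = 0 -> u * a3 + w * a4 = 0 -> u = 0 /\ w = 0.
Proof.
move=> D e1 e2; split; apply: (mulIf D); rewrite mul0r.
  by transitivity ((u * a1 + w * a2) * a4 - (u * a3 + w * a4) * a2); [ring|rewrite e1 e2; ring].
by transitivity ((u * a3 + w * a4) * a1 - (u * a1 + w * a2) * a3); [ring|rewrite e1 e2; ring].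
Qed.

Section InverseFunction.
Context {R : realType}.
Implicit Types (p q x y : plane R) (i j : 'I_2).

#[local] Opaque partial derive.

(** By Cramer's rule [D * u] and [D * w] are combinations of [s] and [t] with coefficients bounded
    by [M]. *)
Lemma injective_linear_bound (a b c d : R) : a * d - b * c != 0 ->
  exists2 m : R, 0 < m &
    forall u w : R, m * `|u| <= `|u * a + w * b| + `|u * c + w * d| /\
                    m * `|w| <= `|u * a + w * b| + `|u * c + w * d|.
Proof.
move=> D0; set D := a * d - b * c in D0.
pose M := `|a| + `|b| + `|c| + `|d| + 1.
have M0 : 0 < M by rewrite ltr_wpDl// !addr_ge0.
have [aM bM cM dM] : [/\ `|a| <= M, `|b| <= M, `|c| <= M & `|d| <= M].
  by rewrite /M; split; have := normr_ge0 a; have := normr_ge0 b;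
    have := normr_ge0 c; have := normr_ge0 d; lra.
exists (`|D| / M); first by rewrite divr_gt0// normr_gt0.
move=> u w; set s := u * a + w * b; set t := u * c + w * d.
have bound (v e f : R) : `|e| <= M -> `|f| <= M -> D * v = e * s + f * t ->
    `|D| / M * `|v| <= `|s| + `|t|.
  move=> eM fM Dv; rewrite mulrAC ler_pdivrMr// -normrM Dv.
  apply: le_trans (ler_normD _ _) _; rewrite !normrM mulrDl.
  by apply: lerD; rewrite mulrC ler_wpM2l.
split; first by apply: (bound _ d (- b)); rewrite ?normrN// /D /s /t; ring.
by apply: (bound _ (- c) a); rewrite ?normrN// /D /s /t; ring.
Qed.

Lemma is_derive_bound (g : plane R -> R) q v (l : R) :
  (forall e, 0 < e -> exists2 d, 0 < d & forall h : R, `|h| < d ->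
    `|g (q + h *: v) - g q - h * l| <= e * `|h|) -> is_derive q v g l.
Proof.
move=> gl; suff c : (fun h : R => h^-1 *: ((g \o shift q) (h *: v) - g q)) h @[h --> 0^'] --> l.
  by split; [apply/cvg_ex; exists l|exact: cvg_lim].
apply/cvgrPdist_le => e e0; have [d d0 gd] := gl _ e0.
near=> h; have hd : `|h| < d by near: h; exact: dnbhs0_lt.
have h0 : h != 0 by near: h; exact: nbhs_dnbhs_neq.
have hp : 0 < `|h| by rewrite normr_gt0.
have := gd _ hd; rewrite -ler_pdivrMr// -normf_div distrC.
rewrite /= (addrC _ q) /GRing.scale/=; set X := g _ - g q.
by rewrite (_ : (X - h * l) / h = h^-1 * X - l)// mulrBl mulrC (mulrAC h) mulfV// mul1r.
Unshelve. all: by end_near. Qed.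

Variables (V : set (plane R)) (f : 'I_2 -> plane R -> R) (p : plane R).
Hypotheses (oV : open V) (Cf : forall k j, Ck k V (f j)) (Vp : V p).

Let J i j x := partial i (f j) x.
Let detJ x := J ix0 ix0 x * J ix1 ix1 x - J ix1 ix0 x * J ix0 ix1 x.
Let phi : vfield R := fun x => \row_j f j x.

Hypothesis detJp : detJ p != 0.

Lemma phi_coord x j : phi x 0 j = f j x. Proof. by rewrite mxE. Qed.

(** The differential at [p] expands by [m]. With [e = m / 4] the linearization errors of the two
    components absorb half of that, and bounding two components by one sup norm costs another factor
    2. *)
Lemma locally_expanding : exists2 m, 0 < m & exists2 r, 0 < r &
  [/\ forall x, `|x - p| < r -> V x, forall x, `|x - p| < r -> detJ x != 0
    & forall x y, `|x - p| < r -> `|y - p| < r -> m * `|y - x| <= `|phi y - phi x|].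
Proof.
have [m m0 mP] := injective_linear_bound detJp.
pose e := m / 4; have e0 : 0 < e by rewrite divr_gt0.
have [r0 r00 r0f] := strict_differentiability oV (Cf 1 ix0) Vp e0.
have [r1 r10 r1f] := strict_differentiability oV (Cf 1 ix1) Vp e0.
have [r2 r20 r2V] := open_ball_sub oV Vp.
have [r3 r30 r3J] : exists2 r, 0 < r & forall x, `|x - p| < r -> detJ x != 0.
  have CJ i j : Ck 0 V (J i j) by apply: Ck_partial; exact: Cf.
  have CD : Ck 0 V detJ := CkD oV (CkM oV (CJ ix0 ix0) (CJ ix1 ix1))
    (CkN oV (CkM oV (CJ ix1 ix0) (CJ ix0 ix1))).
  have /cvgrPdist_lt := Ck_continuous CD Vp.
  move=> /(_ `|detJ p|); rewrite normr_gt0 => /(_ detJp)/nbhs_ballP[r /= r0' rP].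
  exists r => // x xr; have := rP x; rewrite -ball_normE /= distrC => /(_ xr).
  by apply: contraTneq => ->; rewrite subr0 ltxx.
exists (m / 4); first by [].
exists (Num.min (Num.min r0 r1) (Num.min r2 r3)); first by rewrite !lt_min r00 r10 r20.
split=> [x|x|x y].
- by rewrite !lt_min => /andP[_ /andP[xr _]]; exact: r2V.
- by rewrite !lt_min => /andP[_ /andP[_ xr]]; exact: r3J.
rewrite !lt_min => /andP[/andP[x0 x1] _] /andP[/andP[y0 y1] _].
have f0 := r0f x y x0 y0; have f1 := r1f x y x1 y1.
have n0 : `|f ix0 y - f ix0 x| <= `|phi y - phi x|.
  by have := plane_norm_coord (phi y - phi x) ix0; rewrite !mxE.
have n1 : `|f ix1 y - f ix1 x| <= `|phi y - phi x|.
  by have := plane_norm_coord (phi y - phi x) ix1; rewrite !mxE.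
have hN : `|y - x| <= Num.max `|(y - x) 0 ix0| `|(y - x) 0 ix1|.
  rewrite [leLHS]/Num.norm/= mx_normrE bigmax_le ?le_max ?normr_ge0// => -[a b] _ /=.
  by rewrite ord1; case: (ord2 b) => ->; rewrite le_max lexx ?orbT.
have [m1 m2] := mP ((y - x) 0 ix0) ((y - x) 0 ix1).
have tri (F s N : R) : `|F - s| <= e * `|y - x| -> `|F| <= N -> `|s| <= N + e * `|y - x|.
  move=> Fs FN; rewrite (_ : s = F - (F - s)); last by ring.
  by apply: le_trans (ler_normB _ _) _; exact: lerD.
have := lerD (tri _ _ _ f0 n0) (tri _ _ _ f1 n1).
move: m1 m2 hN; rewrite /J; move: (`|_| + `|_|) `|(y - x) 0 ix0| `|(y - x) 0 ix1|.
move: `|y - x| `|phi y - phi x| => H N s u w m1 m2 hN sN.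
have mH : m * H <= s.
  apply: le_trans (_ : m * Num.max u w <= _); first by rewrite ler_wpM2l// ltW.
  by case: (leP u w).
move: mH sN; rewrite /e (mulrAC m); move: (m * H) => z; lra.
Qed.

(** Injectivity and the Lipschitz bound of the inverse come from the expansion. For surjectivity,
    [g], the squared Euclidean distance from [phi x] to [q], is minimized on a closed ball: at an
    interior minimum the gradient vanishes, and the invertible Jacobian forces [phi x = q]. *)
Lemma inverse_exists : exists2 m, 0 < m & exists V1 V2 (psi : vfield R),
  [/\ [/\ open V1, V1 p & V1 `<=` V], open V2,
      (forall x, V1 x -> detJ x != 0),
      (forall x, V1 x -> V2 (phi x) /\ psi (phi x) = x) &
      (forall q, V2 q -> V1 (psi q) /\ phi (psi q) = q) /\
      forall q q', V2 q -> V2 q' -> m * `|psi q' - psi q| <= `|q' - q|].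
Proof.
have [m m0 [r0 r00 [r0V r0D r0m]]] := locally_expanding.
exists m => //; pose r := r0 / 2; have rr0 : r < r0 by rewrite /r; lra.
have r_gt0 : 0 < r by rewrite divr_gt0.
(* For [q] within [d] of [phi p] and [x] on the boundary of the ball, [phi x] is at distance at
   least [4 * d] from [phi p], so [g x] is at least 9 times [d * d], while [g p] is at most twice
   [d * d]: the minimum is interior. *)
pose d := m * r / 4; have d0 : 0 < d by rewrite divr_gt0// mulr_gt0.
have clo x : `|x - p| <= r -> `|x - p| < r0 by move=> xr; exact: le_lt_trans rr0.
pose V2 := [set q : plane R | `|q - phi p| < d].
have oV2 : open V2.
  rewrite (_ : V2 = ball (phi p) d); first exact: ball_open.
  by rewrite -ball_normE; apply/seteqP; split=> q /=; rewrite distrC.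
have Cphi k : Ck k V phi.
  apply/Ck_coordP => // j; apply: Ck_eq (Cf k j) => // q _; by rewrite phi_coord.
pose V1 := [set x : plane R | `|x - p| < r /\ V2 (phi x)].
have nV1 x : V1 x -> `|x - p| < r0 by move=> [/ltW/clo].
have V1V x : V1 x -> V x by move=> /nV1; exact: r0V.
have oV1 : open V1.
  rewrite openE => x [xr xV2]; rewrite /interior; near=> y; split.
    near: y; apply: (@open_near _ [set y : plane R | `|y - p| < r]) => //.
    rewrite (_ : [set y | _] = ball p r); first exact: ball_open.
    by rewrite -ball_normE; apply/seteqP; split=> q /=; rewrite distrC.
  near: y; have cx := Ck_continuous (Cphi 0) (r0V _ (clo _ (ltW xr))).
  by apply: cx; exact: open_near.
have surj q : V2 q -> exists x, V1 x /\ phi x = q.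
  move=> qd; pose B := [set x : plane R | `|x - p| <= r].
  pose h j : plane R -> R := f j + (fun=> - q 0 j).
  have Ch k j : Ck k V (h j) by apply: CkD => //; exact: Ck_cst.
  have dh i j x : V x -> is_derive x 'e_i (h j) (J i j x).
    move=> Vx; have df : is_derive x 'e_i (f j) (J i j x).
      by rewrite /J partialE; apply/derivableP; exact: Ck_derivable (Cf 1 j) Vx.
    by apply: (@is_derive_eq _ _ _ _ _ _ _ _ (is_deriveD df (is_derive_cst _ _ _))); rewrite addr0.
  pose g := h ix0 * h ix0 + h ix1 * h ix1.
  have gE y : g y = h ix0 y * h ix0 y + h ix1 y * h ix1 y by [].
  have Cg k : Ck k V g by apply: CkD => //; exact: CkM.
  have cg : {within B, continuous g}.
    apply: continuous_in_subspaceT => x /set_mem Bx.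
    exact: Ck_continuous (Cg 0) (r0V _ (clo _ Bx)).
  have Bp : B p by rewrite /B/= subrr normr0 ltW.
  have [x /set_mem Bx minx] : exists2 x, x \in B & forall y, y \in B -> g x <= g y.
    by apply: EVT_min_rV cg; [exists p|exact: compact_plane_ball].
  have Vx : V x := r0V _ (clo _ Bx).
  have hE j y : h j y = (phi y - q) 0 j by rewrite /h !mxE.
  have xr : `|x - p| < r.
    rewrite ltNge; apply/negP => rx; have := minx _ (mem_set Bp).
    have := r0m _ _ (clo _ Bp) (clo _ Bx).
    have : `|phi x - phi p| <= `|phi x - q| + `|q - phi p| := ler_distD _ _ _.
    have pq : `|phi p - q| < d by rewrite distrC.
    have := le_lt_trans (plane_norm_coord _ ix0) pq.
    have := le_lt_trans (plane_norm_coord _ ix1) pq.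
    have : `|phi x - q| <= Num.max `|h ix0 x| `|h ix1 x|.
      rewrite [leLHS]/Num.norm/= mx_normrE bigmax_le ?le_max ?normr_ge0// => -[a b] _ /=.
      by rewrite ord1 !hE; case: (ord2 b) => ->; rewrite le_max lexx ?orbT.
    have md : 4 * d <= m * `|x - p|.
      by rewrite [leLHS](_ : _ = m * r); [rewrite ler_wpM2l ?(ltW m0)|rewrite /d; field].
    rewrite -!hE !gE; move: qd; rewrite /V2/=.
    have sq (z : R) : z * z = `|z| * `|z| by rewrite -normrM ger0_norm// -expr2 sqr_ge0.
    rewrite !(sq (h _ _)); have := normr_ge0 (h ix0 x); have := normr_ge0 (h ix1 x).
    have := normr_ge0 (h ix0 p); have := normr_ge0 (h ix1 p); move: md.
    move: `|h ix0 x| `|h ix1 x| `|h ix0 p| `|h ix1 p| => a b a' b'.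
    move: (m * _) `|phi x - q| `|q - phi p| `|phi x - phi p| => k1 k2 k3 k4.
    move=> md b'0 a'0 b0 a0 k3d k2m b'd a'd k4le k1le.
    have k2d : 3 * d < k2 by lra.
    have d30 : 0 <= 3 * d by rewrite mulr_ge0// ltW.
    have a'b' : a' * a' + b' * b' <= 2 * (d * d).
      have : a' * a' <= d * d by apply: ler_pM => //; exact: ltW.
      have : b' * b' <= d * d by apply: ler_pM => //; exact: ltW.
      by lra.
    have ab : 9 * (d * d) <= a * a + b * b.
      move: k2m; rewrite le_max => /orP[k2a|k2b].
        have ha : 3 * d <= a by lra.
        have : (3 * d) * (3 * d) <= a * a by apply: ler_pM.
        by have := mulr_ge0 b0 b0; lra.
      have hb : 3 * d <= b by lra.
      have : (3 * d) * (3 * d) <= b * b by apply: ler_pM.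
      by have := mulr_ge0 a0 a0; lra.
    by have := mulr_gt0 d0 d0; lra.
  have crit i : h ix0 x * J i ix0 x + h ix1 x * J i ix1 x = 0.
    pose e := r - `|x - p|; have e0 : 0 < e by rewrite subr_gt0.
    have seg (t : R) : t \in `]- e, e[%R -> B (x + t *: 'e_i).
      rewrite in_itv/= -ltr_norml => te; rewrite /B/= addrAC.
      apply: le_trans (ler_normD _ _) _; apply: le_trans (lerD (lexx _) (norm_scale_delta _ _)) _.
      by move: te; rewrite /e; move: `|t| `|x - p| => u w; lra.
    have dg y : V y -> is_derive y 'e_i g (partial i g y).
      by move=> Vy; rewrite partialE; apply/derivableP; exact: Ck_derivable (Cg 1) Vy.
    have ne : - e <= e by lra.
    have e00 : 0 \in `]- e, e[%R by rewrite in_itv/= oppr_lt0 e0.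
    have dl (t : R) : t \in `]- e, e[%R ->
        is_derive t 1 (fun t => g (x + t *: 'e_i)) (partial i g (x + t *: 'e_i)).
      by move=> te; rewrite partialE; apply: is_derive_line; have [] := dg _ (r0V _ (clo _ (seg _ te))).
    have := @derive1_at_min _ (fun t => g (x + t *: 'e_i)) (- e) e 0 ne
      (fun t te => @ex_derive _ _ _ _ _ _ _ (dl t te)) e00.
    rewrite scale0r addr0 => /(_ (fun t te => minx _ (mem_set (seg t te)))) D0.
    have g0 : partial i g x = 0.
      have := @derive_val _ _ _ _ _ _ _ (dl _ e00); rewrite (@derive_val _ _ _ _ _ _ _ D0).
      by rewrite scale0r addr0.
    have D1 := is_deriveD (is_deriveM (dh i ix0 x Vx) (dh i ix0 x Vx))
      (is_deriveM (dh i ix1 x Vx) (dh i ix1 x Vx)).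
    have := @derive_val _ _ _ _ _ _ _ D1; rewrite -/g -partialE g0 /GRing.scale/=.
    by move: (h ix0 x * _) (h ix1 x * _) => u w; lra.
  have dx := r0D _ (clo _ Bx); exists x.
  have [h0 h1] := linear_system2 dx (crit ix0) (crit ix1).
  have pxq : phi x = q.
    by apply/subr0_eq/planeP; rewrite -?hE ?h0 ?h1 mxE.
  by split=> //; split=> //; rewrite pxq.
pose psi q := xget p [set x | V1 x /\ phi x = q].
have psiP q : V2 q -> V1 (psi q) /\ phi (psi q) = q.
  by move=> /surj[x xP]; rewrite /psi; case: xgetP => [_ _//|/(_ x)]; exact.
exists V1, V2, psi; split => //.
- split=> //; split; first by rewrite subrr normr0.
  by rewrite /V2/= subrr normr0.
- by move=> x /nV1; exact: r0D.
- move=> x V1x; have V2x : V2 (phi x) by case: V1x.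
  split=> //; have [V1y yE] := psiP _ V2x.
  have := r0m _ _ (nV1 _ V1x) (nV1 _ V1y); rewrite yE subrr normr0 pmulr_rle0//.
  by rewrite normr_le0 subr_eq0 => /eqP.
- split=> // q q' V2q V2q'; have [V1y yE] := psiP _ V2q; have [V1y' yE'] := psiP _ V2q'.
  by have := r0m _ _ (nV1 _ V1y) (nV1 _ V1y'); rewrite yE yE'.
Unshelve. all: by end_near. Qed.

(** The inverse of the Jacobian matrix: [G i j] at [psi q] turns out to be the derivative of the
    [j]-th component of [psi] in direction [i]. *)
Let G i j x :=
  (if i == ix0 then if j == ix0 then J ix1 ix1 x else - J ix0 ix1 x
   else if j == ix0 then - J ix1 ix0 x else J ix0 ix0 x) / detJ x.

(** The derivatives of [psi] are the functions [G i j \o psi], which are as regular as [psi] itself;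
    induction on [k] then leads from continuity to smoothness. *)
Theorem inverse_function_theorem : exists V1 V2 (psi : vfield R),
  [/\ [/\ open V1, V1 p & V1 `<=` V], open V2, forall x, V1 x -> detJ x != 0,
      (forall x, V1 x -> V2 (phi x) /\ psi (phi x) = x) &
      (forall q, V2 q -> V1 (psi q) /\ phi (psi q) = q) /\ smooth V2 psi].
Proof.
have [m m0 [V1 [V2 [psi [[oV1 V1p V1V] oV2 D0 phiK [psiK psiL]]]]]] := inverse_exists.
exists V1, V2, psi; split=> //; split=> //.
have dpsi q i j : V2 q -> is_derive q 'e_i (fun q => psi q 0 j) (G i j (psi q)).
  move=> V2q; have [V1x xE] := psiK q V2q; set x := psi q in V1x xE *.
  have [m' m'0 m'P] := injective_linear_bound (D0 _ V1x).
  (* [m] bounds the displacement of [psi], [m'] inverts the Jacobian at [x], and the 2 accounts for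
     the two components. *)
  apply: is_derive_bound => e e0; pose e' := e * m' * m / 2.
  have e'0 : 0 < e' by rewrite divr_gt0// !mulr_gt0.
  have [r0 r00 f0] := strict_differentiability oV (Cf 1 ix0) (V1V _ V1x) e'0.
  have [r1 r10 f1] := strict_differentiability oV (Cf 1 ix1) (V1V _ V1x) e'0.
  have [r2 r20 r2V] := open_ball_sub oV2 V2q.
  pose d := Num.min r2 (m * Num.min r0 r1).
  exists d; first by rewrite lt_min r20 mulr_gt0// lt_min r00.
  move=> h; rewrite lt_min => /andP[hr2 hm].
  have hq : `|q + h *: 'e_i - q| <= `|h|.
    by rewrite addrC addKr; exact: norm_scale_delta.
  have V2q' : V2 (q + h *: 'e_i) by apply: r2V; exact: le_lt_trans hr2.
  have [V1y yE] := psiK _ V2q'; have mh := le_trans (psiL _ _ V2q V2q') hq.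
  set y := psi _ in V1y yE mh *; rewrite -/x in mh.
  have yr : `|y - x| < Num.min r0 r1 by rewrite -(ltr_pM2l m0); exact: le_lt_trans hm.
  have [yr0 yr1] : `|y - x| < r0 /\ `|y - x| < r1 by move: yr; rewrite lt_min => /andP.
  have x0 : `|x - x| < r0 by rewrite subrr normr0.
  have x1 : `|x - x| < r1 by rewrite subrr normr0.
  have := f0 x y x0 yr0; have := f1 x y x1 yr1.
  have fE k : f k y - f k x = h * (i == k)%:R.
    rewrite -!phi_coord xE yE !mxE/= eq_sym.
    by move: (h * _) (q 0 k) => a b; ring.
  rewrite !fE -!/(J _ _ x); set u := (y - x) 0 ix0; set w := (y - x) 0 ix1.
  have -> : y 0 j - x 0 j = (y - x) 0 j by rewrite !mxE.
  move: mh; move: `|y - x| => H mh b1 b0.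
  have eH : e' * H + e' * H <= e * m' * `|h|.
    rewrite (_ : _ + _ = e * m' * (m * H)); last by rewrite /e'; field.
    by rewrite ler_wpM2l ?mulr_ge0 ?(ltW e0) ?(ltW m'0).
  have Dx := D0 _ V1x.
  have Gu k : J ix0 k x * G i ix0 x + J ix1 k x * G i ix1 x = (i == k)%:R.
    move: Dx; rewrite /G eqxx ix1_neq0 /detJ.
    case: (ord2 i) => ->; case: (ord2 k) => ->; rewrite ?eqxx ?ix0_neq1 ?ix1_neq0 /=;
      move: (J ix0 ix0 x) (J ix0 ix1 x) (J ix1 ix0 x) (J ix1 ix1 x) => a1 a2 a3 a4 Dx;
      by field.
  have lin k : (u - h * G i ix0 x) * J ix0 k x + (w - h * G i ix1 x) * J ix1 k x =
      - (h * (i == k)%:R - (u * J ix0 k x + w * J ix1 k x)).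
    rewrite -Gu; move: (J ix0 k x) (J ix1 k x) (G i ix0 x) (G i ix1 x) => *; ring.
  have [] := m'P (u - h * G i ix0 x) (w - h * G i ix1 x).
  rewrite !lin !normrN => k0 k1.
  have fin (z : R) : m' * `|z| <= `|h * (i == ix0)%:R - (u * J ix0 ix0 x + w * J ix1 ix0 x)| +
     `|h * (i == ix1)%:R - (u * J ix0 ix1 x + w * J ix1 ix1 x)| -> `|z| <= e * `|h|.
    move=> zb; rewrite -(ler_pM2l m'0); apply: le_trans zb _.
    by apply: le_trans (lerD b0 b1) _; rewrite mulrCA mulrA.
  by case: (ord2 j) => ->; exact: fin.
have CG k i j : Ck k V1 (G i j).
  have CJ a b : Ck k V1 (J a b) by apply: Ck_partial; exact: Ck_sub V1V (Cf k.+1 b).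
  have CD : Ck k V1 detJ := CkD oV1 (CkM oV1 (CJ ix0 ix0) (CJ ix1 ix1))
    (CkN oV1 (CkM oV1 (CJ ix1 ix0) (CJ ix0 ix1))).
  rewrite /G; case: (ord2 i) => ->; case: (ord2 j) => ->;
    rewrite ?eqxx ?ix1_neq0 /=; apply: (@CkM _ k V1 _ (fun x => (detJ x)^-1)) => //;
    try (by exact: CkV); by exact: (CkN oV1 (CJ _ _)).
have Cpsi0 : Ck 0 V2 psi.
  split=> // q V2q; have Fq : Filter (nbhs q) := nbhs_filter q.
  apply/(@cvgrPdist_lt _ _ _ (nbhs q) Fq) => e e0; near=> q'.
  have V2q' : V2 q' by near: q'; exact: open_near.
  rewrite distrC -(ltr_pM2l m0); apply: le_lt_trans (psiL _ _ V2q V2q') _.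
  near: q'; apply/nbhs_ballP; exists (m * e); first by rewrite /= mulr_gt0.
  by move=> z; rewrite -ball_normE /= distrC.
elim=> // k IH; apply/Ck_coordP => // j; split=> [q V2q|i].
  by have := (Ck_coordP 0 psi oV2).1 Cpsi0 j; move/Ck_continuous; exact.
split=> [q V2q|]; first by have [] := dpsi q i j V2q.
apply: (@Ck_eq _ _ _ _ (G i j \o psi)) => //.
  by move=> q V2q; rewrite partialE (@derive_val _ _ _ _ _ _ _ (dpsi q i j V2q)).
by apply: Ck_comp (CG k i j) IH _ => // q /psiK[].
Unshelve. all: by end_near. Qed.

End InverseFunction.

(** * Primitives of closed 1-forms *)

Section Poincare.
Context {R : realType}.
Implicit Types (V W : set (plane R)) (p q : plane R) (i j : 'I_2).
Local Notation mu := (@lebesgue_measure R).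

Definition pt (x y : R) : plane R := \row_i (if i == ix0 then x else y).

Lemma coordB p q i : (p - q) 0 i = p 0 i - q 0 i.
Proof. by rewrite !mxE. Qed.

Lemma plane_norm_le p (r : R) : 0 <= r ->
  (`|p| <= r) = (`|p 0 ix0| <= r) && (`|p 0 ix1| <= r).
Proof.
move=> r0; apply/idP/idP => [pr|/andP[p0 p1]].
  by rewrite !(le_trans (plane_norm_coord _ _) pr).
rewrite [leLHS]/Num.norm/= mx_normrE bigmax_le// => -[a b] _ /=.
by rewrite ord1; have [->|->] := ord2 b.
Qed.

Lemma pt0 x y : pt x y 0 ix0 = x. Proof. by rewrite mxE eqxx. Qed.
Lemma pt1 x y : pt x y 0 ix1 = y. Proof. by rewrite mxE ix1_neq0. Qed.
Lemma pt_eta q : pt (q 0 ix0) (q 0 ix1) = q.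
Proof. by apply: planeP; rewrite ?pt0 ?pt1. Qed.

Lemma pt_add0 x y (h : R) : h *: 'e_ix0 + pt x y = pt (h * 1 + x) y.
Proof. by apply: planeP; rewrite !mxE/= ?eqxx ?ix1_neq0/= ?mulr1 ?mulr0 ?add0r. Qed.
Lemma pt_add1 x y (h : R) : h *: 'e_ix1 + pt x y = pt x (h * 1 + y).
Proof.
by apply: planeP; rewrite !mxE/= ?eqxx ?ix1_neq0 ?ix0_neq1/= ?mulr1 ?mulr0 ?add0r.
Qed.

Lemma is_derive_pt0 (f : plane R -> R) x y l :
  is_derive (pt x y) 'e_ix0 f l <-> is_derive x (1 : R) (fun x => f (pt x y)) l.
Proof.
have E : (fun h : R => h^-1 *: ((f \o shift (pt x y)) (h *: 'e_ix0) - f (pt x y))) =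
  (fun h : R => h^-1 *: (((fun x => f (pt x y)) \o shift x) (h *: (1 : R)) - f (pt x y))).
  by apply/funext => h /=; rewrite pt_add0.
by split=> -[d v]; split; move: d v; rewrite /derivable /derive E.
Qed.

Lemma is_derive_pt1 (f : plane R -> R) x y l :
  is_derive (pt x y) 'e_ix1 f l <-> is_derive y (1 : R) (fun y => f (pt x y)) l.
Proof.
have E : (fun h : R => h^-1 *: ((f \o shift (pt x y)) (h *: 'e_ix1) - f (pt x y))) =
  (fun h : R => h^-1 *: (((fun y => f (pt x y)) \o shift y) (h *: (1 : R)) - f (pt x y))).
  by apply/funext => h /=; rewrite pt_add1.
by split=> -[d v]; split; move: d v; rewrite /derivable /derive E.
Qed.

Lemma is_derive_continuous (f : R -> R) x l : is_derive x (1 : R) f l ->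
  {for x, continuous f}.
Proof. by case=> /derivable1_diffP/differentiable_continuous. Qed.

Lemma FTC1_segment (f : R -> R) (a x b : R) : a < x -> x < b ->
  {in `[a, b]%R, forall s, {for s, continuous f}} ->
  is_derive x (1 : R) (fun x => (\int[mu]_(t in `[a, x]) f t)%R) (f x).
Proof.
move=> ax xb cf; have intf : mu.-integrable `[a, b] (EFin \o f).
  apply: continuous_compact_integrable; first exact: segment_compact.
  by apply: continuous_in_subspaceT => s /set_mem; exact: cf.
have cx : {for x, continuous f} by apply: cf; rewrite in_itv/= !ltW.
have [d e] := continuous_FTC1_closed xb intf ax cx.
by split; [exact: d|rewrite -derive1E; exact: e].
Qed.

#[local] Opaque partial derive pt.

(** [F] integrates [P] along the bottom side and then [Q] upwards. Its derivative in [y] is [Q] by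
    the fundamental theorem; in [x], differentiation under the integral sign and closedness turn the
    second integral into that of [partial ix1 P], which completes [P (pt x a1)] to [P (pt x y)]. *)
Theorem poincare V p (P Q : plane R -> R) : open V -> V p ->
  smooth V P -> smooth V Q -> (forall q, V q -> partial ix1 P q = partial ix0 Q q) ->
  exists W F, [/\ open W, W p, W `<=` V, smooth W F &
    forall q, W q -> partial ix0 F q = P q /\ partial ix1 F q = Q q].
Proof.
move=> oV Vp CP CQ PQ; have [r' r'0 r'V] := open_ball_sub oV Vp.
pose r := r' / 2; have r0 : 0 < r by rewrite divr_gt0.
have rr' : r < r' by rewrite /r; lra.
pose px := p 0 ix0; pose py := p 0 ix1.
have inV x y : `|x - px| <= r -> `|y - py| <= r -> V (pt x y).
  move=> xr yr; apply: r'V; rewrite plane_norm_lt// !coordB pt0 pt1.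
  by rewrite !(le_lt_trans _ rr').
(* Integrals start at the lower left corner of the square, not at [p], so that the upper bounds
   always exceed the lower ones. *)
pose a0 := px - r; pose a1 := py - r.
have [a0r a1r] : `|a0 - px| <= r /\ `|a1 - py| <= r.
  by rewrite /a0 /a1; split; rewrite addrC addKr normrN ger0_norm// ltW.
have itv0 x : x \in `[a0, px + r]%R -> `|x - px| <= r.
  by rewrite in_itv/= /a0 ler_norml => /andP[u v]; apply/andP; split; lra.
have itv1 y : y \in `[a1, py + r]%R -> `|y - py| <= r.
  by rewrite in_itv/= /a1 ler_norml => /andP[u v]; apply/andP; split; lra.
have D0 (f : plane R -> R) x y : smooth V f -> `|x - px| <= r -> `|y - py| <= r ->
    is_derive x (1 : R) (fun x => f (pt x y)) (partial ix0 f (pt x y)).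
  move=> Cf xr yr; apply: (is_derive_pt0 f x y _).1; rewrite partialE; apply/derivableP.
  exact: Ck_derivable (Cf 1) (inV _ _ xr yr).
have D1 (f : plane R -> R) x y : smooth V f -> `|x - px| <= r -> `|y - py| <= r ->
    is_derive y (1 : R) (fun y => f (pt x y)) (partial ix1 f (pt x y)).
  move=> Cf xr yr; apply: (is_derive_pt1 f x y _).1; rewrite partialE; apply/derivableP.
  exact: Ck_derivable (Cf 1) (inV _ _ xr yr).
pose F1 x := (\int[mu]_(t in `[a0, x]) P (pt t a1))%R.
pose F2 x y := (\int[mu]_(s in `[a1, y]) Q (pt x s))%R.
pose F q := F1 (q 0 ix0) + F2 (q 0 ix0) (q 0 ix1).
pose W := [set q : plane R | `|q - p| < r].
have oW : open W.
  rewrite (_ : W = ball p r); first exact: ball_open.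
  by rewrite -ball_normE; apply/seteqP; split=> q /=; rewrite distrC.
have WV : W `<=` V by move=> q qr; apply: r'V; exact: lt_trans rr'.
have dF1 x : `|x - px| < r -> is_derive x (1 : R) F1 (P (pt x a1)).
  rewrite ltr_norml => /andP[xl xr]; apply: (@FTC1_segment _ _ _ (px + r)).
  - by rewrite /a0; lra.
  - by lra.
  - by move=> s /itv0 sr; exact: is_derive_continuous (D0 _ _ _ CP sr a1r).
have dF2y x y : `|x - px| < r -> `|y - py| < r ->
    is_derive y (1 : R) (F2 x) (Q (pt x y)).
  move=> /ltW xr; rewrite ltr_norml => /andP[yl yr].
  apply: (@FTC1_segment _ _ _ (py + r)).
  - by rewrite /a1; lra.
  - by lra.
  - by move=> s /itv1 sr; exact: is_derive_continuous (D1 _ _ _ CQ xr sr).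
have dF2x x y : `|x - px| < r -> `|y - py| < r ->
    is_derive x (1 : R) (F2 ^~ y) (P (pt x y) - P (pt x a1)).
  rewrite ltr_norml => /andP[xl xr] yr'; have yr := yr'.
  rewrite ltr_norml in yr; case/andP: yr => yl yu.
  have xI : `](px - r), (px + r)[%classic x by rewrite /= in_itv/=; apply/andP; split; lra.
  have I_r x' : `](px - r), (px + r)[%classic x' -> `|x' - px| <= r.
    by rewrite /= in_itv/= ler_norml => /andP[u v]; apply/andP; split; lra.
  have B_r s : `[a1, y]%classic s -> `|s - py| <= r.
    by rewrite /= in_itv/= /a1 ler_norml => /andP[u v]; apply/andP; split; lra.
  pose f x s := Q (pt x s).
  have intf x' : `](px - r), (px + r)[%classic x' -> mu.-integrable `[a1, y] (EFin \o f x').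
    move=> x'I; apply: continuous_compact_integrable; first exact: segment_compact.
    apply: continuous_in_subspaceT => s /set_mem/B_r sr.
    exact: is_derive_continuous (D1 _ _ _ CQ (I_r _ x'I) sr).
  have df x' s : `](px - r), (px + r)[%classic x' -> `[a1, y]%classic s ->
      is_derive x' (1 : R) (f ^~ s) (partial ix0 Q (pt x' s)).
    by move=> x'I sB; exact: D0 CQ (I_r _ x'I) (B_r _ sB).
  (* A constant dominating the derivative of the integrand, by compactness of the closed ball. *)
  have [M M0 HM] : exists2 M : R, 0 <= M & forall q, `|q - p| <= r -> `|partial ix0 Q q| <= M.
    have Bp : [set q : plane R | `|q - p| <= r] p by rewrite /= subrr normr0 ltW.
    have cn : {within [set q : plane R | `|q - p| <= r], continuous (fun q => `|partial ix0 Q q|)}.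
      apply: continuous_in_subspaceT => q /set_mem /= qr.
      apply: (@continuous_comp _ _ _ (partial ix0 Q)); last exact: norm_continuous.
      by apply: Ck_continuous (Ck_partial ix0 (CQ 1)) (r'V _ _); exact: le_lt_trans rr'.
    have [m _ mmax] := EVT_max_rV (ex_intro _ p Bp) (@compact_plane_ball _ p r) cn.
    exists `|partial ix0 Q m| => // q qr; apply: mmax; exact: mem_set.
  have G_ub x' s : `](px - r), (px + r)[%classic x' -> `[a1, y]%classic s -> `|partial1of2 f x' s| <= cst M s.
    move=> x'I sB; rewrite partial1of2E (@derive_val _ _ _ _ _ _ _ (df _ _ x'I sB)).
    apply: HM; rewrite (plane_norm_le _ (ltW r0)).
    by rewrite !coordB pt0 pt1 I_r// B_r.
  have intG : mu.-integrable `[a1, y] (EFin \o cst M).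
    apply: continuous_compact_integrable; first exact: segment_compact.
    by apply: continuous_subspaceT; exact: cst_continuous.
  have H := @cvg_differentiation_under_integral R _ _ mu f `[a1, y]
    (measurable_itv _) x _ _ xI intf (fun x s xI sB => @ex_derive _ _ _ _ _ _ _ (df x s xI sB))
    (cst M) (fun=> M0) intG G_ub.
  have H' := @derivable_under_integral R _ _ mu f `[a1, y]
    (measurable_itv _) x _ _ xI intf (fun x s xI sB => @ex_derive _ _ _ _ _ _ _ (df x s xI sB))
    (cst M) (fun=> M0) intG G_ub.
  have H'' := @differentiation_under_integral R _ _ mu f `[a1, y]
    (measurable_itv _) x _ _ xI intf (fun x s xI sB => @ex_derive _ _ _ _ _ _ _ (df x s xI sB))
    (cst M) (fun=> M0) intG G_ub.
  split; first exact: H'.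
  rewrite -derive1E; apply: etrans H'' _.
  have xr' : `|x - px| <= r := I_r _ xI.
  have a1y : a1 < y by rewrite /a1; lra.
  have E s : `[a1, y]%classic s ->
      (partial1of2 f ^~ s) x = partial ix1 P (pt x s).
    move=> sB; rewrite partial1of2E (@derive_val _ _ _ _ _ _ _ (df _ _ xI sB)).
    by rewrite PQ//; apply: inV => //; exact: B_r.
  have dP s : `[a1, y]%classic s -> is_derive s (1 : R) (fun s => P (pt x s)) (partial ix1 P (pt x s)).
    by move=> sB; apply: D1 => //; exact: B_r.
  have FT : (\int[mu]_(s in `[a1, y]) partial ix1 P (pt x s))%R = P (pt x y) - P (pt x a1).
  rewrite /Rintegral (@continuous_FTC2 _ _ (fun s => P (pt x s)) _ _ a1y); [by []| | |].
  - apply: continuous_in_subspaceT => s /set_mem/B_r sr.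
    have CP1 : smooth V (partial ix1 P) by move=> k; exact: Ck_partial (CP k.+1).
    exact: is_derive_continuous (D1 _ _ _ CP1 xr' sr).
  - have cP s : `[a1, y]%classic s -> {for s, continuous (fun s => P (pt x s))}.
      by move=> sB; exact: is_derive_continuous (dP _ sB).
    split=> [s /subset_itv_oo_cc sB||]; first by have [] := dP _ sB.
      by apply: cvg_at_right_filter; apply: cP; rewrite /= in_itv/= lexx ltW.
    by apply: cvg_at_left_filter; apply: cP; rewrite /= in_itv/= lexx ltW.
  - move=> s /subset_itv_oo_cc sB; rewrite derive1E.
    exact: (@derive_val _ _ _ _ _ _ _ (dP _ sB)).
  by rewrite -FT; apply: eq_Rintegral => s /set_mem sB; exact: E.
have dF q : W q -> is_derive q 'e_ix0 F (P q) /\ is_derive q 'e_ix1 F (Q q).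
  rewrite /W/= plane_norm_lt// !coordB => /andP[xr yr].
  rewrite -(pt_eta q); split.
    apply/is_derive_pt0; rewrite /F; under eq_fun do rewrite pt0 pt1.
    apply: is_derive_eq (is_deriveD (dF1 _ xr) (dF2x _ _ xr yr)) _.
    by rewrite addrC subrK.
  apply/is_derive_pt1; rewrite /F; under eq_fun do rewrite pt0 pt1.
  apply: is_derive_eq (is_deriveD (is_derive_cst _ _ _) (dF2y _ _ xr yr)) _.
  by rewrite add0r.
have dFE q : W q -> partial ix0 F q = P q /\ partial ix1 F q = Q q.
  by move=> /dF[[_ e0] [_ e1]]; rewrite !partialE.
exists W, F; split=> //; first by rewrite /W/= subrr normr0.
have dFd q i : W q -> derivable F q 'e_i.
  by move=> /dF[[d0 _] [d1 _]]; case: (ord2 i) => ->.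
have CpF k i : Ck k W (partial i F).
  case: (ord2 i) => ->.
    by apply: Ck_eq (Ck_sub WV (CP k)) => // q /dFE[].
  by apply: Ck_eq (Ck_sub WV (CQ k)) => // q /dFE[].
have cF q : W q -> {for q, continuous F}.
  move=> Wq; apply: (partial_continuous oW (fun i q => dFd q i)) => // i.
  exact: Ck_continuous (CpF 0 i) Wq.
case=> [|k]; split=> //.
by move=> i; split=> [q Wq|]; [exact: dFd|exact: CpF].
Qed.

End Poincare.

(** * Germs of smooth functions *)

Section GermRing.
Local Open Scope quotient_scope.
Context {R : realType}.
Implicit Types (V W : set (plane R)) (p q : plane R) (i j : 'I_2) (f g : plane R -> R).

Definition smooth_near p : {pred plane R -> R} :=
  fun f => `[< exists V, [/\ open V, V p & smooth V f] >].

Lemma smooth_nearP p f :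
  reflect (exists V, [/\ open V, V p & smooth V f]) (f \in smooth_near p).
Proof. exact: asboolP. Qed.

Lemma smooth_near2 p f g : f \in smooth_near p -> g \in smooth_near p ->
  exists V, [/\ open V, V p, smooth V f & smooth V g].
Proof.
move=> /smooth_nearP[V [oV Vp Cf]] /smooth_nearP[W [oW Wp Cg]].
exists (V `&` W); split; [exact: openI|by split| |] => k.
  by apply: Ck_sub (Cf k); exact: subIsetl.
by apply: Ck_sub (Cg k); exact: subIsetr.
Qed.

Fact smooth_near_subring p : subring_closed (smooth_near p).
Proof.
split=> [|f g sf sg|f g sf sg]; apply/smooth_nearP.
- by exists setT; split=> //; [exact: openT|move=> k; exact: Ck_cst].
- have [V [oV Vp Cf Cg]] := smooth_near2 sf sg; exists V; split=> // k.
  by apply: CkD => //; exact: CkN.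
- have [V [oV Vp Cf Cg]] := smooth_near2 sf sg; exists V; split=> // k.
  exact: CkM.
Qed.

HB.instance Definition _ p :=
  GRing.isSubringClosed.Build (plane R -> R) (smooth_near p) (smooth_near_subring p).

Record smooth_rep p := SmoothRep {
  rep_fun : plane R -> R;
  rep_smooth : rep_fun \in smooth_near p }.

HB.instance Definition _ p := [isSub for @rep_fun p].
HB.instance Definition _ p := [Choice of smooth_rep p by <:].
HB.instance Definition _ p := [SubChoice_isSubComNzRing of smooth_rep p by <:].

Definition null_germ p : {pred smooth_rep p} :=
  fun u => `[< \forall q \near p, rep_fun u q = 0 >].
Arguments null_germ : clear implicits.

Lemma null_germP p (u : smooth_rep p) :
  reflect (\forall q \near p, rep_fun u q = 0) (u \in null_germ p).
Proof. exact: asboolP. Qed.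

(** Properness, the second conjunct, holds because a function that is null near [p] is null at [p];
    it makes the quotient a nonzero ring. *)
Fact null_germ_ideal p : idealr_closed (null_germ p).
Proof.
split.
- by apply/null_germP; near=> q.
- by apply/null_germP => /nbhs_singleton /eqP; rewrite /= oner_eq0.
move=> a u v /null_germP u0 /null_germP v0; apply/null_germP; near=> q.
have uq : rep_fun u q = 0 by near: q.
have vq : rep_fun v q = 0 by near: q.
by rewrite /= !fctE uq vq mulr0 addr0.
Unshelve. all: by end_near. Qed.

HB.instance Definition _ p := isIdealr.Build _ (null_germ p) (null_germ_ideal p).

Definition germ p := {ideal_quot (null_germ p)}.
HB.instance Definition _ p := GRing.ComNzRing.on (germ p).

(** Total: a function that is not smooth near [p] is sent to 0. *)
Definition germ_of p f : germ p :=
  if insub f is Some u then \pi_(germ p) u else 0.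
Definition germ_rep p (x : germ p) : plane R -> R := rep_fun (repr x).

Lemma germ_of_eq p f g : f \in smooth_near p -> g \in smooth_near p ->
  germ_of p f = germ_of p g <-> \forall q \near p, f q = g q.
Proof.
move=> sf sg; rewrite /germ_of !insubT; split.
  move/eqP; rewrite -Quotient.idealrBE => /null_germP/= fg.
  near=> q; apply/subr0_eq; near: q; exact: fg.
move=> fg; apply/eqP; rewrite -Quotient.idealrBE; apply/null_germP => /=.
by near=> q; apply/eqP; rewrite subr_eq0; apply/eqP; near: q.
Unshelve. all: by end_near. Qed.

Lemma germ_rep_smooth p (x : germ p) : germ_rep x \in smooth_near p.
Proof. exact: rep_smooth. Qed.

Lemma germ_of_pi p (u : smooth_rep p) : germ_of p (rep_fun u) = \pi_(germ p) u.
Proof. by rewrite /germ_of; case: u => f sf /=; rewrite insubT. Qed.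

Lemma germ_ofK p (x : germ p) : germ_of p (germ_rep x) = x.
Proof. by rewrite germ_of_pi reprK. Qed.

Lemma germ_repK p f : f \in smooth_near p ->
  \forall q \near p, germ_rep (germ_of p f) q = f q.
Proof. by move=> sf; apply/germ_of_eq; rewrite ?germ_ofK//; exact: germ_rep_smooth. Qed.

Lemma germP p (x : germ p) : exists2 f, f \in smooth_near p & x = germ_of p f.
Proof. by exists (germ_rep x); rewrite ?germ_ofK//; exact: germ_rep_smooth. Qed.

Lemma smooth_nearD p f g : f \in smooth_near p -> g \in smooth_near p ->
  f + g \in smooth_near p.
Proof. exact: rpredD. Qed.

Lemma smooth_nearM p f g : f \in smooth_near p -> g \in smooth_near p ->
  f * g \in smooth_near p.
Proof. exact: rpredM. Qed.

Lemma smooth_near_cst p (r : R) : (fun=> r) \in smooth_near p.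
Proof.
by apply/smooth_nearP; exists setT; split=> // [|k]; [exact: openT|exact: Ck_cst].
Qed.

Lemma smooth_near_partial p f i : f \in smooth_near p -> partial i f \in smooth_near p.
Proof.
move=> /smooth_nearP[V [oV Vp Cf]]; apply/smooth_nearP; exists V; split=> // k.
exact: Ck_partial (Cf k.+1).
Qed.

Lemma germ_ofD p f g : f \in smooth_near p -> g \in smooth_near p ->
  germ_of p (f + g) = germ_of p f + germ_of p g.
Proof.
move=> sf sg; pose u := SmoothRep sf; pose v := SmoothRep sg.
have -> : f + g = rep_fun (u + v) by [].
by rewrite -[f]/(rep_fun u) -[g]/(rep_fun v) !germ_of_pi raddfD.
Qed.

Lemma germ_ofM p f g : f \in smooth_near p -> g \in smooth_near p ->
  germ_of p (f * g) = germ_of p f * germ_of p g.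
Proof.
move=> sf sg; pose u := SmoothRep sf; pose v := SmoothRep sg.
have -> : f * g = rep_fun (u * v) by [].
by rewrite -[f]/(rep_fun u) -[g]/(rep_fun v) !germ_of_pi rmorphM.
Qed.

Lemma germ_of0 p : germ_of p (fun=> 0) = 0.
Proof.
have -> : (fun=> 0) = rep_fun (0 : smooth_rep p) by [].
by rewrite germ_of_pi raddf0.
Qed.

Lemma germ_of1 p : germ_of p (fun=> 1) = 1.
Proof.
have -> : (fun=> 1) = rep_fun (1 : smooth_rep p) by [].
by rewrite germ_of_pi rmorph1.
Qed.

Definition germ_diff p i (x : germ p) : germ p := germ_of p (partial i (germ_rep x)).
Definition germ_ev p (x : germ p) : R := germ_rep x p.
Definition germ_cst p (r : R) : germ p := germ_of p (fun=> r).

Lemma germ_diff_of p i f : f \in smooth_near p ->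
  germ_diff i (germ_of p f) = germ_of p (partial i f).
Proof.
move=> sf; apply/germ_of_eq; try exact: smooth_near_partial.
  by apply: smooth_near_partial; exact: germ_rep_smooth.
by apply: near_partial; exact: germ_repK.
Qed.

Lemma germ_ev_of p f : f \in smooth_near p -> germ_ev (germ_of p f) = f p.
Proof. by move=> /germ_repK /nbhs_singleton. Qed.

Lemma near_derivable p f i : f \in smooth_near p -> \forall q \near p, derivable f q 'e_i.
Proof.
move=> /smooth_nearP[V [oV Vp Cf]]; near=> q.
by apply: (Ck_derivable (Cf 1)); near: q; exact: open_near.
Unshelve. all: by end_near. Qed.

Lemma germ_diffD p i (x y : germ p) : germ_diff i (x + y) = germ_diff i x + germ_diff i y.
Proof.
have [[f sf ->] [g sg ->]] := (germP x, germP y).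
rewrite -germ_ofD// !germ_diff_of//; last exact: smooth_nearD.
rewrite -germ_ofD; try exact: smooth_near_partial.
apply/germ_of_eq; [by apply/smooth_near_partial/smooth_nearD|
  by apply: smooth_nearD; exact: smooth_near_partial|].
move: (near_derivable i sf) (near_derivable i sg); apply: filterS2 => q dfq dgq.
by rewrite /partial (deriveD dfq dgq).
Qed.

Lemma germ_diffM p i (x y : germ p) :
  germ_diff i (x * y) = germ_diff i x * y + x * germ_diff i y.
Proof.
have [[f sf ->] [g sg ->]] := (germP x, germP y).
rewrite -germ_ofM// !germ_diff_of//; last exact: smooth_nearM.
have [sf' sg'] := (smooth_near_partial i sf, smooth_near_partial i sg).
have [s1 s2] := (smooth_nearM sf' sg, smooth_nearM sf sg').
rewrite -!germ_ofM// -germ_ofD//.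
apply/germ_of_eq; [by apply/smooth_near_partial/smooth_nearM|exact: smooth_nearD|].
move: (near_derivable i sf) (near_derivable i sg); apply: filterS2 => q dfq dgq.
rewrite /partial (deriveM dfq dgq) addrC; congr (_ + _); exact: mulrC.
Qed.

Lemma germ_diff_cst p i (r : R) : germ_diff i (germ_cst p r) = 0.
Proof.
rewrite /germ_cst germ_diff_of; last exact: smooth_near_cst.
suff -> : partial i (fun=> r) = (fun=> 0) :> (plane R -> R) by exact: germ_of0.
by apply/funext => q; exact: derive_cst.
Qed.

Lemma germ_diffC p i j (x : germ p) :
  germ_diff i (germ_diff j x) = germ_diff j (germ_diff i x).
Proof.
have [f sf ->] := germP x.
have [si sj] := (smooth_near_partial i sf, smooth_near_partial j sf).
rewrite (germ_diff_of j sf) (germ_diff_of i sf) (germ_diff_of i sj) (germ_diff_of j si).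
apply: (germ_of_eq (smooth_near_partial i sj) (smooth_near_partial j si)).2.
have /smooth_nearP[V [oV Vp Cf]] := sf.
by apply: filterS (open_near oV Vp) => q Vq; exact: (Ck_schwarz i j oV (Cf 2) Vq).
Qed.

Lemma germ_evD p (x y : germ p) : germ_ev (x + y) = germ_ev x + germ_ev y.
Proof.
have [[f sf ->] [g sg ->]] := (germP x, germP y).
by rewrite -germ_ofD// !germ_ev_of//; exact: smooth_nearD.
Qed.

Lemma germ_evM p (x y : germ p) : germ_ev (x * y) = germ_ev x * germ_ev y.
Proof.
have [[f sf ->] [g sg ->]] := (germP x, germP y).
by rewrite -germ_ofM// !germ_ev_of//; exact: smooth_nearM.
Qed.

Lemma germ_ev_cst p r : germ_ev (germ_cst p r) = r.
Proof. by rewrite germ_ev_of// smooth_near_cst. Qed.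

Lemma germ_inv p (x : germ p) : germ_ev x != 0 -> exists y, x * y = 1.
Proof.
have [f sf ->] := germP x; rewrite germ_ev_of// => fp0.
have /smooth_nearP[V [oV Vp Cf]] := sf.
have cf : {for p, continuous f} := Ck_continuous (Cf 0) Vp.
have f0 : \forall q \near p, f q != 0.
  have /cvgrPdist_lt/(_ `|f p|) := cf; rewrite normr_gt0 => /(_ fp0).
  apply: filterS => q; apply: contraTneq => ->; by rewrite subr0 ltxx.
(* The second set is the interior of the set where [f] does not vanish: smoothness of the inverse is
   needed on an open set. *)
pose W := V `&` [set q | \forall q' \near q, f q' != 0].
have oW : open W by apply: openI => //; exact: open_interior.
have Wp : W p by split.
have sg : (fun q => (f q)^-1) \in smooth_near p.
  apply/smooth_nearP; exists W; split=> // k; apply: CkV => //.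
    by move=> q [_ /nbhs_singleton].
  by apply: Ck_sub (Cf k); exact: subIsetl.
exists (germ_of p (fun q => (f q)^-1)); rewrite -germ_ofM// -germ_of1.
apply/germ_of_eq; [exact: smooth_nearM|exact: smooth_near_cst|].
by apply: filterS f0 => q fq; rewrite fctE mulfV.
Qed.

End GermRing.

Section GermAnalysis.
Context {R : realType}.
Implicit Types (V W : set (plane R)) (p q : plane R) (i j : 'I_2) (f g : plane R -> R).

#[local] Opaque partial derive.

Lemma open_near_set p (P : plane R -> Prop) : (\forall q \near p, P q) ->
  exists V, [/\ open V, V p & forall q, V q -> P q].
Proof.
move=> Pp; exists (interior [set q | P q]); split=> //.
  exact: open_interior.
by move=> q /nbhs_singleton.
Qed.

Lemma smooth_sub V W f : W `<=` V -> smooth V f -> smooth W f.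
Proof. by move=> WV Cf k; exact: Ck_sub (Cf k). Qed.

Lemma smooth_near_family p (I : finType) (f : I -> plane R -> R) :
  (forall a, f a \in smooth_near p) ->
  exists V, [/\ open V, V p & forall a, smooth V (f a)].
Proof.
move=> sf; have sf' a := elimT (smooth_nearP p (f a)) (sf a).
pose V a := projT1 (cid (sf' a)).
have VP a : [/\ open (V a), V a p & smooth (V a) (f a)] := projT2 (cid (sf' a)).
have nV : \forall q \near p, forall a, V a q.
  apply: (@filter_forall _ _ (fun a q => V a q) _ (nbhs_filter p)) => a.
  by have [oV Vp _] := VP a; exact: open_near.
have [W [oW Wp WV]] := open_near_set nV; exists W; split=> // a.
by have [_ _ Cf] := VP a; apply: smooth_sub Cf => q /WV.
Qed.

Lemma smooth_near_sum p (I : finType) (f : I -> plane R -> R) :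
  (forall a, f a \in smooth_near p) -> \sum_a f a \in smooth_near p.
Proof. by move=> sf; apply: rpred_sum. Qed.

Lemma germ_of_sum p (I : finType) (f : I -> plane R -> R) :
  (forall a, f a \in smooth_near p) ->
  germ_of p (\sum_a f a) = \sum_a germ_of p (f a).
Proof.
move=> sf; suff [_ ->] : \sum_a f a \in smooth_near p /\
    germ_of p (\sum_a f a) = \sum_a germ_of p (f a) by [].
apply: (big_ind2 (fun x y => x \in smooth_near p /\ germ_of p x = y)) => //.
- by split; [exact: rpred0|exact: germ_of0].
- by move=> x _ y _ [sx <-] [sy <-]; rewrite germ_ofD//; split=> //; exact: rpredD.
Qed.

Lemma germ_uniq p n (u : 'I_n -> germ p) (c : 'I_2 -> 'I_n -> 'I_n -> germ p) :
  (forall i a, germ_diff i (u a) = \sum_b c i a b * u b) ->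
  (forall a, germ_ev (u a) = 0) -> forall a, u a = 0.
Proof.
move=> du u0; pose U a := germ_rep (u a); pose C i a b := germ_rep (c i a b).
have sU a : U a \in smooth_near p := germ_rep_smooth (u a).
have sC i a b : C i a b \in smooth_near p := germ_rep_smooth (c i a b).
have [V1 [oV1 V1p CU]] := smooth_near_family sU.
have [V2 [oV2 V2p CC]] := smooth_near_family (fun t : 'I_2 * 'I_n * 'I_n => sC t.1.1 t.1.2 t.2).
have eqn : \forall q \near p, forall (t : 'I_2 * 'I_n),
    partial t.1 (U t.2) q = \sum_b C t.1 t.2 b q * U b q.
  apply: (@filter_forall _ _ (fun t q => _) _ (nbhs_filter p)) => -[i a] /=.
  have sCU b : C i a b * U b \in smooth_near p by exact: smooth_nearM.
  have : germ_of p (partial i (U a)) = germ_of p (\sum_b C i a b * U b).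
    rewrite germ_of_sum// -germ_diff_of// germ_ofK du; apply: eq_bigr => b _.
    by rewrite germ_ofM// !germ_ofK.
  move=> /(germ_of_eq (smooth_near_partial i (sU a)) (smooth_near_sum sCU)).
  by apply: filterS => q ->; rewrite fct_sumE.
have [V3 [oV3 V3p eq3]] := open_near_set eqn.
pose V := V1 `&` V2 `&` V3.
have oV : open V by apply: openI => //; exact: openI.
have H := @linear_system_unique R n U C V p oV (conj (conj V1p V2p) V3p).
have {}H := H (fun a => Ck_sub (fun q (Vq : V q) => Vq.1.1) (CU a 1)).
have {}H := H (fun i a b => Ck_sub (fun q (Vq : V q) => Vq.1.2) (CC (i, a, b) 0)).
have {}H := H (fun i a q (Vq : V q) => eq3 q Vq.2 (i, a)) u0.
move=> a; rewrite -[u a]germ_ofK -(germ_of0 p).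
apply: (germ_of_eq (sU a) (smooth_near_cst p 0)).2.
by apply: filterS H => q; exact.
Qed.

Lemma germ_poincare p (x y : germ p) : germ_diff ix1 x = germ_diff ix0 y ->
  exists z, [/\ germ_diff ix0 z = x, germ_diff ix1 z = y & germ_ev z = 0].
Proof.
have [[f sf ->] [g sg ->]] := (germP x, germP y).
rewrite (germ_diff_of _ sf) (germ_diff_of _ sg).
move=> /(germ_of_eq (smooth_near_partial ix1 sf) (smooth_near_partial ix0 sg)) fg.
have [V1 [oV1 V1p CP CQ]] := smooth_near2 sf sg.
have [V2 [oV2 V2p eqV]] := open_near_set fg.
have oV := openI oV1 oV2.
have [W [F [oW Wp WV CF dF]]] := @poincare R _ p f g oV (conj V1p V2p)
  (smooth_sub (@subIsetl _ V1 V2) CP) (smooth_sub (@subIsetl _ V1 V2) CQ)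
  (fun q Vq => eqV q Vq.2).
have sF : F \in smooth_near p by apply/smooth_nearP; exists W.
exists (germ_of p F + germ_cst p (- F p)).
have d i : germ_diff i (germ_of p F + germ_cst p (- F p)) = germ_of p (partial i F).
  by rewrite germ_diffD germ_diff_cst addr0 (germ_diff_of i sF).
split; last by rewrite germ_evD germ_ev_cst (germ_ev_of sF) subrr.
  rewrite d; apply: (germ_of_eq (smooth_near_partial ix0 sF) sf).2.
  by apply: filterS (open_near oW Wp) => q /dF[].
rewrite d; apply: (germ_of_eq (smooth_near_partial ix1 sF) sg).2.
by apply: filterS (open_near oW Wp) => q /dF[].
Qed.

(** Used for solutions of linear equations with constant coefficients: the functions [h] of the
    fourth case, and the exponential, which solves [h'' - h' = 0]. *)
Definition germ_comp p (h : R -> R) (x : germ p) : germ p :=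
  germ_of p (h \o germ_rep x).

Lemma smooth_near_ode p alpha beta h f : ode_solution alpha beta h ->
  f \in smooth_near p -> h \o f \in smooth_near p.
Proof.
move=> hs /smooth_nearP[V [oV Vp Cf]]; apply/smooth_nearP; exists V; split=> // k.
exact: Ck_ode_solution oV hs (Cf k).
Qed.

Lemma germ_comp_of p alpha beta h f : ode_solution alpha beta h ->
  f \in smooth_near p -> germ_comp h (germ_of p f) = germ_of p (h \o f).
Proof.
move=> hs sf.
apply: (germ_of_eq (smooth_near_ode hs (germ_rep_smooth _)) (smooth_near_ode hs sf)).2.
by apply: filterS (germ_repK sf) => q /= ->.
Qed.

Lemma germ_diff_comp p i alpha beta h (x : germ p) : ode_solution alpha beta h ->
  germ_diff i (germ_comp h x) = germ_comp h^`()%classic x * germ_diff i x.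
Proof.
move=> hs; have [f sf ->] := germP x.
have hs' := ode_solution_derive hs.
have [s1 s2] := (smooth_near_ode hs sf, smooth_near_ode hs' sf).
have s3 := smooth_near_partial i sf.
rewrite (germ_comp_of hs sf) (germ_comp_of hs' sf) (germ_diff_of _ s1) (germ_diff_of _ sf).
rewrite -(germ_ofM s2 s3).
apply: (germ_of_eq (smooth_near_partial i s1) (smooth_nearM s2 s3)).2.
have /smooth_nearP[V [oV Vp Cf]] := sf.
apply: filterS (open_near oV Vp) => q Vq; rewrite partialE.
have [dh _ _] := hs (f q).
exact: (@derive_val _ _ _ _ _ _ _ (partial_comp_real i (Cf 1) Vq dh)).
Qed.

Lemma germ_comp_ode p alpha beta h (x : germ p) : ode_solution alpha beta h ->
  germ_comp h^`(2)%classic x + germ_cst p alpha * germ_comp h^`()%classic x +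
  germ_cst p beta * germ_comp h x = 0.
Proof.
move=> hs; have hs1 := ode_solution_derive hs; have hs2 := ode_solution_derive hs1.
have [sx] := germ_rep_smooth x.
have s0 := smooth_near_ode hs (germ_rep_smooth x).
have s1 := smooth_near_ode hs1 (germ_rep_smooth x).
have s2 : h^`(2)%classic \o germ_rep x \in smooth_near p := smooth_near_ode hs2 (germ_rep_smooth x).
have sa := smooth_near_cst p alpha; have sb := smooth_near_cst p beta.
have [sa1 sb0] := (smooth_nearM sa s1, smooth_nearM sb s0).
rewrite /germ_comp /germ_cst -(germ_ofM sa s1) -(germ_ofM sb s0).
rewrite -(germ_ofD s2 sa1) -(germ_ofD (smooth_nearD s2 sa1) sb0) -germ_of0.
by congr germ_of; apply/funext => q; have [_ _] := hs (germ_rep x q).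
Qed.

Lemma germ_ev_comp p alpha beta h (x : germ p) : ode_solution alpha beta h ->
  germ_ev (germ_comp h x) = h (germ_ev x).
Proof.
move=> hs; have [f sf ->] := germP x.
by rewrite (germ_comp_of hs sf) !germ_ev_of//; exact: smooth_near_ode hs sf.
Qed.

Lemma germ_cst_monoid p : monoid_morphism (germ_cst p).
Proof.
split=> [|r s]; first exact: germ_of1.
by rewrite /germ_cst -germ_ofM//; exact: smooth_near_cst.
Qed.

Lemma germ_cst_zmod p : zmod_morphism (germ_cst p).
Proof.
move=> r s; apply/(@addIr _ (germ_cst p s)); rewrite subrK.
rewrite /germ_cst -germ_ofD; try exact: smooth_near_cst.
by congr germ_of; apply/funext => q; rewrite !fctE subrK.
Qed.

HB.instance Definition _ p := GRing.isZmodMorphism.Build R (germ p) (germ_cst p) (germ_cst_zmod p).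
HB.instance Definition _ p := GRing.isMonoidMorphism.Build R (germ p) (germ_cst p) (germ_cst_monoid p).

Lemma germ_ev_zmod p : zmod_morphism (@germ_ev R p).
Proof. by move=> x y; apply/(@addIr _ (germ_ev y)); rewrite -germ_evD !subrK. Qed.

Lemma germ_ev_monoid p : monoid_morphism (@germ_ev R p).
Proof. by split; [rewrite -[1](rmorph1 (germ_cst p)) germ_ev_cst|exact: germ_evM]. Qed.

HB.instance Definition _ p := GRing.isZmodMorphism.Build (germ p) R (@germ_ev R p) (@germ_ev_zmod p).
HB.instance Definition _ p := GRing.isMonoidMorphism.Build (germ p) R (@germ_ev R p) (@germ_ev_monoid p).

End GermAnalysis.

(* The formal properties of germs of smooth functions, with two commuting
   derivations forming a frame: any commuting frame of vector fields provides
   another such structure on the same ring, which replaces a change of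
   coordinates. *)
Record germ_algebra (R : realType) := GermAlgebra {
  ga_ring :> comNzRingType;
  ga_cst : {rmorphism R -> ga_ring};
  ga_ev : {rmorphism ga_ring -> R};
  ga_d0 : ga_ring -> ga_ring;
  ga_d1 : ga_ring -> ga_ring;
  ga_comp : (R -> R) -> ga_ring -> ga_ring;
  ga_evC : forall r, ga_ev (ga_cst r) = r;
  ga_d0D : forall x y, ga_d0 (x + y) = ga_d0 x + ga_d0 y;
  ga_d1D : forall x y, ga_d1 (x + y) = ga_d1 x + ga_d1 y;
  ga_d0M : forall x y, ga_d0 (x * y) = ga_d0 x * y + x * ga_d0 y;
  ga_d1M : forall x y, ga_d1 (x * y) = ga_d1 x * y + x * ga_d1 y;
  ga_d0C : forall r, ga_d0 (ga_cst r) = 0;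
  ga_d1C : forall r, ga_d1 (ga_cst r) = 0;
  ga_dC : forall x, ga_d0 (ga_d1 x) = ga_d1 (ga_d0 x);
  ga_inv : forall x, ga_ev x != 0 -> exists y, x * y = 1;
  ga_uniq : forall n (u : 'I_n -> ga_ring),
    (forall a, exists c, ga_d0 (u a) = \sum_b c b * u b) ->
    (forall a, exists c, ga_d1 (u a) = \sum_b c b * u b) ->
    (forall a, ga_ev (u a) = 0) -> forall a, u a = 0;
  ga_poincare : forall x y, ga_d1 x = ga_d0 y ->
    exists z, [/\ ga_d0 z = x, ga_d1 z = y & ga_ev z = 0];
  ga_d0comp : forall alpha beta h x, ode_solution alpha beta h ->
    ga_d0 (ga_comp h x) = ga_comp h^`()%classic x * ga_d0 x;
  ga_d1comp : forall alpha beta h x, ode_solution alpha beta h ->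
    ga_d1 (ga_comp h x) = ga_comp h^`()%classic x * ga_d1 x;
  ga_compode : forall alpha beta h x, ode_solution alpha beta h ->
    ga_comp h^`(2)%classic x + ga_cst alpha * ga_comp h^`()%classic x +
    ga_cst beta * ga_comp h x = 0;
  ga_evcomp : forall alpha beta h x, ode_solution alpha beta h ->
    ga_ev (ga_comp h x) = h (ga_ev x) }.

Section GermAlgebraInstance.
Context {R : realType} (p : plane R).

(** With existential coefficients the property passes to another frame by linear combination. *)
Lemma germ_uniq_ex n (u : 'I_n -> germ p) :
  (forall a, exists c, germ_diff ix0 (u a) = \sum_b c b * u b) ->
  (forall a, exists c, germ_diff ix1 (u a) = \sum_b c b * u b) ->
  (forall a, germ_ev (u a) = 0) -> forall a, u a = 0.
Proof.
move=> e0 e1 u0.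
pose c i a b := if i == ix0 then projT1 (cid (e0 a)) b else projT1 (cid (e1 a)) b.
apply: (@germ_uniq _ p n u c) => // i a; rewrite /c.
case: (ord2 i) => ->; first by rewrite eqxx; exact: (projT2 (cid (e0 a))).
by rewrite ix1_neq0; exact: (projT2 (cid (e1 a))).
Qed.

Definition germ_alg : germ_algebra R := {|
  ga_ring := germ p;
  ga_cst := germ_cst p;
  ga_ev := @germ_ev R p;
  ga_d0 := germ_diff ix0;
  ga_d1 := germ_diff ix1;
  ga_comp := @germ_comp R p;
  ga_evC := @germ_ev_cst R p;
  ga_d0D := germ_diffD ix0;
  ga_d1D := germ_diffD ix1;
  ga_d0M := germ_diffM ix0;
  ga_d1M := germ_diffM ix1;
  ga_d0C := germ_diff_cst p ix0;
  ga_d1C := germ_diff_cst p ix1;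
  ga_dC := germ_diffC ix0 ix1;
  ga_inv := @germ_inv R p;
  ga_uniq := germ_uniq_ex;
  ga_poincare := @germ_poincare R p;
  ga_d0comp := fun alpha beta h x => @germ_diff_comp R p ix0 alpha beta h x;
  ga_d1comp := fun alpha beta h x => @germ_diff_comp R p ix1 alpha beta h x;
  ga_compode := fun alpha beta h x => @germ_comp_ode R p alpha beta h x;
  ga_evcomp := fun alpha beta h x => @germ_ev_comp R p alpha beta h x |}.

End GermAlgebraInstance.

(** * Vector fields and connections over a ring of germs *)

(** Closes a goal whose two sides differ, up to [ring], by exactly the difference of the two sides
    of [e]. *)
Ltac ring_from e := match type of e with ?L = ?M =>
  apply: subr0_eq; apply: (@etrans _ _ (L - M)); [ring | by rewrite e subrr] end.

Section GermVectorFields.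
Context {R : realType} (G : germ_algebra R).
Local Notation A := (ga_ring G).
Local Notation d0 := (ga_d0 (g := G)).
Local Notation d1 := (ga_d1 (g := G)).
Local Notation ev := (ga_ev G).
Local Notation cst := (ga_cst G).
Local Notation vec := (A * A)%type.
Implicit Types (X Y Z W : vec) (f g h x y : A) (r s : R).

Lemma d0N f : d0 (- f) = - d0 f.
Proof.
apply/eqP; rewrite -addr_eq0 -ga_d0D addNr.
by have := ga_d0C G 0; rewrite rmorph0 => ->.
Qed.
Lemma d1N f : d1 (- f) = - d1 f.
Proof.
apply/eqP; rewrite -addr_eq0 -ga_d1D addNr.
by have := ga_d1C G 0; rewrite rmorph0 => ->.
Qed.
Lemma d00 : d0 0 = 0. Proof. by have := ga_d0C G 0; rewrite rmorph0. Qed.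
Lemma d10 : d1 0 = 0. Proof. by have := ga_d1C G 0; rewrite rmorph0. Qed.
Lemma d01 : d0 1 = 0. Proof. by have := ga_d0C G 1; rewrite rmorph1. Qed.
Lemma d11 : d1 1 = 0. Proof. by have := ga_d1C G 1; rewrite rmorph1. Qed.

Definition dE := (ga_d0D, ga_d1D, ga_d0M, ga_d1M, d0N, d1N, ga_d0C, ga_d1C,
  d00, d10, d01, d11, ga_dC).

Definition vscale f X : vec := (f * X.1, f * X.2).
Definition der X f : A := X.1 * d0 f + X.2 * d1 f.
Definition br X Y : vec := (der X Y.1 - der Y X.1, der X Y.2 - der Y X.2).
Definition evv X : R * R := (ev X.1, ev X.2).
Definition frame0 : vec := (1, 0).
Definition frame1 : vec := (0, 1).
(** A nonzero value of this determinant at the base point is how linear independence of two fields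
    there is expressed. *)
Definition wedge X Y : A := X.1 * Y.2 - X.2 * Y.1.

(* [ch_ij] is the germ of nabla_{d_i} d_j. *)
Record christoffel := Christoffel { ch00 : vec; ch01 : vec; ch10 : vec; ch11 : vec }.
Implicit Type C : christoffel.

Definition nab C X Y : vec :=
  (der X Y.1 + (X.1 * Y.1 * (ch00 C).1 + X.1 * Y.2 * (ch01 C).1 +
                X.2 * Y.1 * (ch10 C).1 + X.2 * Y.2 * (ch11 C).1),
   der X Y.2 + (X.1 * Y.1 * (ch00 C).2 + X.1 * Y.2 * (ch01 C).2 +
                X.2 * Y.1 * (ch10 C).2 + X.2 * Y.2 * (ch11 C).2)).

Definition lie_nab C X Y Z : vec := br X (nab C Y Z) - nab C (br X Y) Z - nab C Y (br X Z).

Definition kil C X : Prop := forall Y Z, lie_nab C X Y Z = 0.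

Definition tors C X Y : vec := nab C X Y - nab C Y X - br X Y.
Definition curv C X Y Z : vec :=
  nab C X (nab C Y Z) - nab C Y (nab C X Z) - nab C (br X Y) Z.

Lemma vecP X Y : X.1 = Y.1 -> X.2 = Y.2 -> X = Y.
Proof. by case: X Y => [a b] [c d] /= -> ->. Qed.

Ltac dring := rewrite ?dE; ring.
Ltac vring := apply: vecP; rewrite /= ?dE; ring.

Lemma br_add_l X Y Z : br (X + Y) Z = br X Z + br Y Z.
Proof. by case: X Y Z => [??] [??] [??]; rewrite /br /der /=; vring. Qed.
Lemma br_add_r X Y Z : br X (Y + Z) = br X Y + br X Z.
Proof. by case: X Y Z => [??] [??] [??]; rewrite /br /der /=; vring. Qed.
Lemma br_cst_l r X Y : br (vscale (cst r) X) Y = vscale (cst r) (br X Y).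
Proof. by case: X Y => [??] [??]; rewrite /br /der /vscale /=; vring. Qed.
Lemma br_cst_r r X Y : br X (vscale (cst r) Y) = vscale (cst r) (br X Y).
Proof. by case: X Y => [??] [??]; rewrite /br /der /vscale /=; vring. Qed.
Lemma br_anti X Y : br X Y = - br Y X.
Proof. by case: X Y => [??] [??]; rewrite /br /der /=; vring. Qed.
Lemma br_self X : br X X = 0.
Proof. by case: X => [??]; rewrite /br /der /=; vring. Qed.
Lemma br_opp_l X Y : br (- X) Y = - br X Y.
Proof. by case: X Y => [??] [??]; rewrite /br /der /=; vring. Qed.
Lemma br_opp_r X Y : br X (- Y) = - br X Y.
Proof. by case: X Y => [??] [??]; rewrite /br /der /=; vring. Qed.
Lemma br_scale_l f X Y : br (vscale f X) Y = vscale f (br X Y) - vscale (der Y f) X.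
Proof. by case: X Y => [??] [??]; rewrite /br /der /vscale /=; vring. Qed.
Lemma br_scale_r f X Y : br X (vscale f Y) = vscale f (br X Y) + vscale (der X f) Y.
Proof. by case: X Y => [??] [??]; rewrite /br /der /vscale /=; vring. Qed.
Lemma br_zero_l X : br 0 X = 0.
Proof. by case: X => [??]; rewrite /br /der /=; vring. Qed.
Lemma br_zero_r X : br X 0 = 0.
Proof. by case: X => [??]; rewrite /br /der /=; vring. Qed.

Lemma jacobi X Y Z : br X (br Y Z) = br (br X Y) Z + br Y (br X Z).
Proof. by case: X Y Z => [??] [??] [??]; rewrite /br /der /=; vring. Qed.

Lemma der_br X Y f : der (br X Y) f = der X (der Y f) - der Y (der X f).
Proof. by case: X Y => [??] [??]; rewrite /br /der /=; dring. Qed.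

Lemma derD X f g : der X (f + g) = der X f + der X g.
Proof. by rewrite /der; dring. Qed.
Lemma derN X f : der X (- f) = - der X f.
Proof. by rewrite /der; dring. Qed.
Lemma derM X f g : der X (f * g) = der X f * g + f * der X g.
Proof. by rewrite /der; dring. Qed.
Lemma derC X r : der X (cst r) = 0.
Proof. by rewrite /der; dring. Qed.
Lemma der_comp X alpha beta (h : R -> R) f : ode_solution alpha beta h ->
  der X (ga_comp h f) = ga_comp h^`()%classic f * der X f.
Proof. by move=> hs; rewrite /der (ga_d0comp _ hs) (ga_d1comp _ hs); ring. Qed.

Lemma vscaleDr f X Y : vscale f (X + Y) = vscale f X + vscale f Y.
Proof. by case: X Y => [??] [??]; rewrite /vscale /=; vring. Qed.
Lemma vscaleDl f g X : vscale (f + g) X = vscale f X + vscale g X.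
Proof. by case: X => [??]; rewrite /vscale /=; vring. Qed.
Lemma vscaleA f g X : vscale f (vscale g X) = vscale (f * g) X.
Proof. by case: X => [??]; rewrite /vscale /=; vring. Qed.
Lemma vscale1 X : vscale 1 X = X.
Proof. by case: X => [??]; rewrite /vscale /=; vring. Qed.
Lemma vscale0 X : vscale 0 X = 0.
Proof. by case: X => [??]; rewrite /vscale /=; vring. Qed.
Lemma vscaler0 f : vscale f 0 = 0.
Proof. by rewrite /vscale /=; vring. Qed.
Lemma vscaleN f X : vscale (- f) X = - vscale f X.
Proof. by case: X => [??]; rewrite /vscale /=; vring. Qed.

Lemma unit_cancel w f : ev w != 0 -> w * f = 0 -> f = 0.
Proof.
move=> /ga_inv[w' ww'] wf; have -> : f = w' * (w * f).
  by rewrite mulrA (mulrC w') ww' mul1r.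
by rewrite wf mulr0.
Qed.

Lemma cst_eq0 r : cst r = 0 -> r = 0.
Proof. by move=> e; rewrite -(ga_evC G r) e rmorph0. Qed.

Section Ideal.
Variable s : seq A.

(** Membership in the ideal generated by [s], in the form that [ga_uniq] requires. *)
Definition idl f := exists c : 'I_(size s) -> A, f = \sum_i c i * s`_i.

Lemma idl_add f g : idl f -> idl g -> idl (f + g).
Proof.
move=> [c ->] [e ->]; exists (fun i => c i + e i); rewrite -big_split.
by apply: eq_bigr => i _; rewrite mulrDl.
Qed.

Lemma idl_mul f g : idl g -> idl (f * g).
Proof.
move=> [c ->]; exists (fun i => f * c i); rewrite mulr_sumr.
by apply: eq_bigr => i _; rewrite mulrA.
Qed.

Lemma idl_opp f : idl f -> idl (- f).
Proof. by move=> /(idl_mul (-1)); rewrite mulN1r. Qed.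

Lemma idl0 : idl 0.
Proof. by exists (fun=> 0); rewrite big1// => i _; rewrite mul0r. Qed.

Lemma idl_mem f : f \in s -> idl f.
Proof.
move=> fs; have lt := fs; rewrite -index_mem in lt.
exists (fun i => (i == Ordinal lt)%:R); rewrite (bigD1 (Ordinal lt))//= eqxx mul1r.
by rewrite nth_index// big1 ?addr0// => i /negPf ->; rewrite mul0r.
Qed.

Lemma idl_unit w f : ev w != 0 -> idl (w * f) -> idl f.
Proof.
move=> /ga_inv[w' ww'] /(idl_mul w'); by rewrite mulrA (mulrC w') ww' mul1r.
Qed.

(* Uniqueness for a linear total differential system. *)
Lemma idl_vanish : {in s, forall f, [/\ idl (d0 f), idl (d1 f) & ev f = 0]} ->
  {in s, forall f, f = 0}.
Proof.
move=> H f fs; have sP (i : 'I_(size s)) : s`_i \in s by exact: mem_nth.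
have lt := fs; rewrite -index_mem in lt; rewrite -(nth_index 0 fs).
apply: (@ga_uniq _ G (size s) (fun i => s`_i) _ _ _ (Ordinal lt)) => i;
  by have [] := H _ (sP i).
Qed.

(** By Cramer's rule the coordinate derivatives, multiplied by the unit [wedge X Y], are
    combinations of those along [X] and [Y]. *)
Lemma idl_vanish_frame X Y : ev (wedge X Y) != 0 ->
  {in s, forall f, [/\ idl (der X f), idl (der Y f) & ev f = 0]} ->
  {in s, forall f, f = 0}.
Proof.
move=> w0 H; apply: idl_vanish => f /H[iX iY f0]; split=> //; apply: (idl_unit w0).
  have -> : wedge X Y * d0 f = Y.2 * der X f + (- X.2) * der Y f by rewrite /wedge /der; ring.
  by apply: idl_add; exact: idl_mul.
have -> : wedge X Y * d1 f = (- Y.1) * der X f + X.1 * der Y f by rewrite /wedge /der; ring.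
by apply: idl_add; exact: idl_mul.
Qed.

End Ideal.

Lemma constant_frame X Y f : ev (wedge X Y) != 0 -> der X f = 0 -> der Y f = 0 ->
  f = cst (ev f).
Proof.
move=> w0 fX fY; apply: subr0_eq.
apply: (@idl_vanish_frame [:: f - cst (ev f)] X Y) => // [g|]; last exact: mem_head.
rewrite inE => /eqP ->; rewrite !derD !derN !derC fX fY subr0.
by split; [exact: idl0|exact: idl0|rewrite rmorphB ga_evC subrr].
Qed.

Lemma der_eq0_frame X Y f : ev (wedge X Y) != 0 -> der X f = 0 -> der Y f = 0 ->
  ev f = 0 -> f = 0.
Proof. by move=> w0 fX fY f0; rewrite (constant_frame w0 fX fY) f0 rmorph0. Qed.

(** The condition on [f] and [g] is the integrability of [X h = f], [Y h = g] in a frame that need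
    not commute: [[X, Y] h] must be [mu * X h]. *)
Lemma poincare_frame X Y (mu : A) f g : ev (wedge X Y) != 0 ->
  br X Y = vscale mu X -> der X g - der Y f = mu * f ->
  exists h, [/\ der X h = f, der Y h = g & ev h = 0].
Proof.
move=> w0 brXY fg; have [w' ww'] := ga_inv w0.
have [P [Q [eX eY]]] : exists P Q, X.1 * P + X.2 * Q = f /\ Y.1 * P + Y.2 * Q = g.
  exists (w' * (f * Y.2 - g * X.2)), (w' * (X.1 * g - Y.1 * f)).
  by split; rewrite -[RHS]mul1r -ww' /wedge; ring.
have PQ : d1 P = d0 Q.
  apply: subr0_eq; apply: (unit_cancel w0).
  have -> : wedge X Y * (d1 P - d0 Q) = (br X Y).1 * P + (br X Y).2 * Q -
      (der X (Y.1 * P + Y.2 * Q) - der Y (X.1 * P + X.2 * Q)).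
    by rewrite /wedge /br /der /= ?dE; ring.
  by rewrite eX eY fg brXY -eX /vscale /=; ring.
have [h [h0 h1 evh]] := ga_poincare PQ.
by exists h; rewrite /der h0 h1; split.
Qed.

Lemma nab_add_l C X Y Z : nab C (X + Y) Z = nab C X Z + nab C Y Z.
Proof. by case: X Y Z => [??] [??] [??]; rewrite /nab /der /=; vring. Qed.
Lemma nab_add_r C X Y Z : nab C X (Y + Z) = nab C X Y + nab C X Z.
Proof. by case: X Y Z => [??] [??] [??]; rewrite /nab /der /=; vring. Qed.
Lemma nab_scale_l C f X Y : nab C (vscale f X) Y = vscale f (nab C X Y).
Proof. by case: X Y => [??] [??]; rewrite /nab /der /vscale /=; vring. Qed.
Lemma nab_scale_r C f X Y :
  nab C X (vscale f Y) = vscale f (nab C X Y) + vscale (der X f) Y.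
Proof. by case: X Y => [??] [??]; rewrite /nab /der /vscale /=; vring. Qed.
Lemma nab_opp_l C X Y : nab C (- X) Y = - nab C X Y.
Proof. by case: X Y => [??] [??]; rewrite /nab /der /=; vring. Qed.
Lemma nab_opp_r C X Y : nab C X (- Y) = - nab C X Y.
Proof. by case: X Y => [??] [??]; rewrite /nab /der /=; vring. Qed.

Lemma lie_nab_add_m C X Y Y' Z : lie_nab C X (Y + Y') Z = lie_nab C X Y Z + lie_nab C X Y' Z.
Proof.
rewrite /lie_nab !(nab_add_l, br_add_r).
move: (br X (nab C Y Z)) (br X (nab C Y' Z)) (nab C (br X Y) Z) (nab C (br X Y') Z)
  (nab C Y (br X Z)) (nab C Y' (br X Z)) => *; vring.
Qed.
Lemma lie_nab_add_r C X Y Z Z' : lie_nab C X Y (Z + Z') = lie_nab C X Y Z + lie_nab C X Y Z'.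
Proof.
rewrite /lie_nab !(nab_add_r, br_add_r).
move: (br X (nab C Y Z)) (br X (nab C Y Z')) (nab C (br X Y) Z) (nab C (br X Y) Z')
  (nab C Y (br X Z)) (nab C Y (br X Z')) => *; vring.
Qed.
Lemma lie_nab_scale_m C X f Y Z : lie_nab C X (vscale f Y) Z = vscale f (lie_nab C X Y Z).
Proof.
rewrite /lie_nab nab_scale_l !br_scale_r nab_add_l !nab_scale_l.
move: (br X (nab C Y Z)) (nab C (br X Y) Z) (nab C Y (br X Z)) (nab C Y Z) (der X f) => *; vring.
Qed.
Lemma lie_nab_scale_r C X Y f Z : lie_nab C X Y (vscale f Z) = vscale f (lie_nab C X Y Z).
Proof.
rewrite /lie_nab nab_scale_r br_add_r !br_scale_r nab_add_r !nab_scale_r der_br.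
move: (br X (nab C Y Z)) (nab C (br X Y) Z) (nab C Y (br X Z)) (nab C Y Z) (br X Z)
  (der X (der Y f)) (der Y (der X f)) (der X f) (der Y f) => *; vring.
Qed.

(** [lie_nab C X] is a tensor, although [nab C] is not, so its values on the frame decide. *)
Lemma kilP C X : kil C X <->
  [/\ lie_nab C X frame0 frame0 = 0, lie_nab C X frame0 frame1 = 0,
      lie_nab C X frame1 frame0 = 0 & lie_nab C X frame1 frame1 = 0].
Proof.
have coordE Y : Y = vscale Y.1 frame0 + vscale Y.2 frame1 by vring.
split=> [kX|[e1 e2 e3 e4] Y Z]; first by split; exact: kX.
rewrite (coordE Y) (coordE Z) !(lie_nab_add_m, lie_nab_add_r, lie_nab_scale_m, lie_nab_scale_r).
by rewrite e1 e2 e3 e4 !vscaler0 !addr0.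
Qed.

Lemma kilE C X Y Z : kil C X -> br X (nab C Y Z) = nab C (br X Y) Z + nab C Y (br X Z).
Proof.
move=> kX; have := kX Y Z; rewrite /lie_nab -addrA -opprD.
by move/subr0_eq.
Qed.

Lemma kil_add C X Y : kil C X -> kil C Y -> kil C (X + Y).
Proof.
move=> kX kY V W; rewrite /lie_nab !br_add_l nab_add_l nab_add_r.
by rewrite (kilE _ _ kX) (kilE _ _ kY); apply: vecP; rewrite /=; ring.
Qed.

Lemma kil_cst C r X : kil C X -> kil C (vscale (cst r) X).
Proof.
move=> kX V W; rewrite /lie_nab !br_cst_l nab_scale_l nab_scale_r derC vscale0 addr0.
by rewrite (kilE _ _ kX) vscaleDr; apply: vecP; rewrite /=; ring.
Qed.

Lemma kil_opp C X : kil C X -> kil C (- X).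
Proof.
move=> kX V W; rewrite /lie_nab !br_opp_l nab_opp_l nab_opp_r.
by rewrite (kilE _ _ kX); apply: vecP; rewrite /=; ring.
Qed.

Lemma kil_br C X Y : kil C X -> kil C Y -> kil C (br X Y).
Proof.
move=> kX kY V W; rewrite /lie_nab.
have e Z : br (br X Y) Z = br X (br Y Z) - br Y (br X Z).
  by rewrite [in RHS](jacobi X) addrK.
rewrite !e !(kilE _ _ kX, kilE _ _ kY, br_add_r) !nab_add_l !nab_add_r !nab_opp_l !nab_opp_r.
by apply: vecP; rewrite /=; ring.
Qed.

End GermVectorFields.

Ltac vring := apply: vecP; rewrite /= ?dE; ring.

(** * Torsion, curvature and the curvature of bivectors *)

Section Invariants.
Context {R : realType} (G : germ_algebra R).
Local Notation A := (ga_ring G).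
Local Notation d0 := (ga_d0 (g := G)).
Local Notation d1 := (ga_d1 (g := G)).
Local Notation ev := (ga_ev G).
Local Notation vec := (A * A)%type.
Implicit Types (X Y Z W U V : vec) (f g x y : A) (r s : R) (C : christoffel G).

Lemma frame_decomp U V X : ev (wedge U V) != 0 ->
  exists f g, X = vscale f U + vscale g V.
Proof.
move=> /ga_inv[w ww]; exists (w * wedge X V), (w * wedge U X).
by apply: vecP; rewrite /= -[LHS]mul1r -ww /wedge; ring.
Qed.

Lemma tors_anti C X Y : tors C X Y = - tors C Y X.
Proof. by rewrite /tors (br_anti X); vring. Qed.
Lemma tors_add_l C X Y Z : tors C (X + Y) Z = tors C X Z + tors C Y Z.
Proof. by rewrite /tors nab_add_l nab_add_r br_add_l; vring. Qed.
Lemma tors_scale_l C f X Y : tors C (vscale f X) Y = vscale f (tors C X Y).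
Proof. by rewrite /tors nab_scale_l nab_scale_r br_scale_l; vring. Qed.
Lemma tors_add_r C X Y Z : tors C X (Y + Z) = tors C X Y + tors C X Z.
Proof. by rewrite tors_anti tors_add_l !(tors_anti _ X) opprD. Qed.
Lemma tors_scale_r C f X Y : tors C X (vscale f Y) = vscale f (tors C X Y).
Proof. by rewrite tors_anti tors_scale_l (tors_anti _ X); vring. Qed.
Lemma tors_self C X : tors C X X = 0.
Proof. by rewrite /tors br_self; vring. Qed.

Lemma curv_anti C X Y Z : curv C X Y Z = - curv C Y X Z.
Proof. by rewrite /curv (br_anti X) nab_opp_l; vring. Qed.
Lemma curv_add_l C X Y Z W : curv C (X + Y) Z W = curv C X Z W + curv C Y Z W.
Proof. by rewrite /curv br_add_l !nab_add_l !nab_add_r; vring. Qed.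
Lemma curv_scale_l C f X Y Z : curv C (vscale f X) Y Z = vscale f (curv C X Y Z).
Proof.
by rewrite /curv br_scale_l -vscaleN nab_add_l !nab_scale_l nab_scale_r; vring.
Qed.
Lemma curv_add_m C X Y Z W : curv C X (Y + Z) W = curv C X Y W + curv C X Z W.
Proof. by rewrite curv_anti curv_add_l !(curv_anti _ X) opprD. Qed.
Lemma curv_scale_m C f X Y Z : curv C X (vscale f Y) Z = vscale f (curv C X Y Z).
Proof. by rewrite curv_anti curv_scale_l (curv_anti _ X); vring. Qed.
Lemma curv_add_r C X Y Z W : curv C X Y (Z + W) = curv C X Y Z + curv C X Y W.
Proof. by rewrite /curv !nab_add_r; vring. Qed.
Lemma curv_scale_r C f X Y Z : curv C X Y (vscale f Z) = vscale f (curv C X Y Z).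
Proof.
rewrite /curv !(nab_scale_r, nab_add_r) der_br.
by move: (der X (der Y f)) (der Y (der X f)) => u v; vring.
Qed.
Lemma curv_self C X Z : curv C X X Z = 0.
Proof.
rewrite /curv br_self -(vscale0 X) nab_scale_l vscale0.
by vring.
Qed.

Definition flat_germ C := (forall X Y, tors C X Y = 0) /\ (forall X Y Z, curv C X Y Z = 0).

Lemma flat_germ_frame C U V : ev (wedge U V) != 0 -> tors C U V = 0 ->
  curv C U V U = 0 -> curv C U V V = 0 -> flat_germ C.
Proof.
move=> w0 t0 c0 c1; split=> [X Y|X Y Z]; have [f [g ->]] := frame_decomp X w0;
  have [h [k ->]] := frame_decomp Y w0.
  rewrite !(tors_add_l, tors_add_r, tors_scale_l, tors_scale_r) !tors_self.
  by rewrite (tors_anti _ V) t0 oppr0 !vscaler0 !addr0.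
have [l [m ->]] := frame_decomp Z w0.
rewrite !(curv_add_l, curv_add_m, curv_add_r, curv_scale_l, curv_scale_m, curv_scale_r).
by rewrite !curv_self !(curv_anti _ V) c0 c1 !oppr0 !vscaler0 !addr0.
Qed.

Lemma kil_tors C X Y Z : kil C X ->
  br X (tors C Y Z) = tors C (br X Y) Z + tors C Y (br X Z).
Proof.
move=> kX; rewrite /tors !(br_add_r, br_opp_r) !(kilE _ _ kX) (jacobi X Y Z).
by vring.
Qed.

Lemma kil_curv C X Y Z W : kil C X -> br X (curv C Y Z W) =
  curv C (br X Y) Z W + curv C Y (br X Z) W + curv C Y Z (br X W).
Proof.
move=> kX; rewrite /curv !(br_add_r, br_opp_r) !(kilE _ _ kX, nab_add_r) (jacobi X Y Z).
by rewrite nab_add_l; vring.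
Qed.

Lemma frame_coord X : X = vscale X.1 (frame0 G) + vscale X.2 (frame1 G).
Proof. by rewrite /frame0 /frame1; vring. Qed.

Lemma wedge_frame : ev (wedge (frame0 G) (frame1 G)) != 0.
Proof. by rewrite /wedge /= mulr1 mulr0 subr0 rmorph1 oner_neq0. Qed.

(** A 2-form in the plane is known by its value on the frame, so torsion becomes the vector [tau]
    and curvature the endomorphism [rho]. Both are relative to the bivector of the frame, which a
    field [X] multiplies by its divergence, up to sign; hence [diver] in their Lie derivatives. *)
Definition diver X : A := d0 X.1 + d1 X.2.
Definition tau C : vec := tors C (frame0 G) (frame1 G).
Definition rho C X : vec := curv C (frame0 G) (frame1 G) X.
Arguments tau : simpl never.
Arguments rho : simpl never.

Lemma torsE C X Y : tors C X Y = vscale (wedge X Y) (tau C).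
Proof.
rewrite [X in LHS]frame_coord [Y in LHS]frame_coord.
rewrite !(tors_add_l, tors_add_r, tors_scale_l, tors_scale_r) !tors_self.
by rewrite (tors_anti _ (frame1 G)) /wedge /tau; vring.
Qed.

Lemma curvE C X Y Z : curv C X Y Z = vscale (wedge X Y) (rho C Z).
Proof.
rewrite [X in LHS]frame_coord [Y in LHS]frame_coord.
rewrite !(curv_add_l, curv_add_m, curv_scale_l, curv_scale_m) !curv_self.
by rewrite (curv_anti _ (frame1 G)) /wedge /rho; vring.
Qed.

Lemma rho_coord C X : rho C X =
  vscale X.1 (rho C (frame0 G)) + vscale X.2 (rho C (frame1 G)).
Proof. by rewrite /rho [X in LHS]frame_coord curv_add_r !curv_scale_r. Qed.

Lemma kil_tau C X : kil C X -> br X (tau C) = vscale (- diver X) (tau C).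
Proof.
move=> kX; rewrite /tau kil_tors// !torsE.
by move: (tau C) => t; rewrite /wedge /br /der /diver; vring.
Qed.

Lemma kil_rho C X Y : kil C X ->
  br X (rho C Y) = vscale (- diver X) (rho C Y) + rho C (br X Y).
Proof.
move=> kX; rewrite [in LHS]/rho kil_curv// !curvE.
move: (rho C Y) (rho C (br X Y)) => t u; rewrite /wedge /br /der /diver; vring.
Qed.

Lemma kil_tau_coord C X : kil C X ->
  der X (tau C).1 = (tau C).1 * d0 X.1 + (tau C).2 * d1 X.1 - diver X * (tau C).1 /\
  der X (tau C).2 = (tau C).1 * d0 X.2 + (tau C).2 * d1 X.2 - diver X * (tau C).2.
Proof.
move=> /kil_tau; move: (tau C) => t bX; have := congr1 fst bX; have := congr1 snd bX.
rewrite /br /vscale /=.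
by move=> /eqP + /eqP; rewrite !subr_eq => /eqP -> /eqP ->; split; rewrite /der; ring.
Qed.

Lemma kil_rho_coord C X : kil C X -> let r0 := rho C (frame0 G) in let r1 := rho C (frame1 G) in
  [/\ der X r0.1 = r0.1 * d0 X.1 + r0.2 * d1 X.1 - diver X * r0.1
                   - (d0 X.1 * r0.1 + d0 X.2 * r1.1),
      der X r0.2 = r0.1 * d0 X.2 + r0.2 * d1 X.2 - diver X * r0.2
                   - (d0 X.1 * r0.2 + d0 X.2 * r1.2),
      der X r1.1 = r1.1 * d0 X.1 + r1.2 * d1 X.1 - diver X * r1.1
                   - (d1 X.1 * r0.1 + d1 X.2 * r1.1) &
      der X r1.2 = r1.1 * d0 X.2 + r1.2 * d1 X.2 - diver X * r1.2
                   - (d1 X.1 * r0.2 + d1 X.2 * r1.2)].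
Proof.
move=> kX r0 r1.
have E0 := kil_rho (frame0 G) kX; have E1 := kil_rho (frame1 G) kX.
have b0 : br X (frame0 G) = (- d0 X.1, - d0 X.2).
  by case: X {kX E0 E1} => a b; rewrite /br /der /frame0; vring.
have b1 : br X (frame1 G) = (- d1 X.1, - d1 X.2).
  by case: X {kX E0 E1 b0} => a b; rewrite /br /der /frame1; vring.
rewrite b0 [rho C (- _, _)]rho_coord -/r0 -/r1 in E0.
rewrite b1 [rho C (- _, _)]rho_coord -/r0 -/r1 in E1.
move: E0 E1; rewrite /br /vscale; move: r0 r1 => r0 r1 E0 E1.
have := congr1 fst E0; have := congr1 snd E0; have := congr1 fst E1; have := congr1 snd E1.
rewrite /= => {E0 E1}.
move=> /eqP + /eqP + /eqP + /eqP; rewrite !subr_eq => /eqP -> /eqP -> /eqP -> /eqP ->.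
by split; rewrite /der; ring.
Qed.

Ltac idl_tac := repeat first
  [ apply: idl_add | apply: idl_opp | apply: idl_mem; rewrite !inE eqxx ?orbT; reflexivity
  | apply: idl_mul; apply: idl_mem; rewrite !inE eqxx ?orbT; reflexivity
  | rewrite mulrC; apply: idl_mul; apply: idl_mem; rewrite !inE eqxx ?orbT; reflexivity ].

(** The derivatives of [tau] along Killing fields are linear in [tau]; two transverse fields give a
    closed system, so one zero forces identical vanishing. *)
Lemma tau_vanish C X Y : kil C X -> kil C Y -> ev (wedge X Y) != 0 ->
  evv (tau C) = 0 -> tau C = 0.
Proof.
move=> kX kY w0 [t1 t2]; pose s := [:: (tau C).1; (tau C).2].
have H : {in s, forall f, f = 0}.
  apply: (idl_vanish_frame w0) => f.
  have [x1 x2] := kil_tau_coord kX; have [y1 y2] := kil_tau_coord kY.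
  by rewrite !inE => /orP[] /eqP ->; rewrite ?x1 ?x2 ?y1 ?y2; split=> //; idl_tac.
by apply: vecP; apply: H; rewrite !inE eqxx ?orbT.
Qed.

Lemma rho_vanish C X Y : kil C X -> kil C Y -> ev (wedge X Y) != 0 ->
  evv (rho C (frame0 G)) = 0 -> evv (rho C (frame1 G)) = 0 -> forall Z, rho C Z = 0.
Proof.
move=> kX kY w0 [a1 a2] [b1 b2]; pose r0 := rho C (frame0 G); pose r1 := rho C (frame1 G).
pose s := [:: r0.1; r0.2; r1.1; r1.2].
have H : {in s, forall f, f = 0}.
  apply: (idl_vanish_frame w0) => f.
  have [x1 x2 x3 x4] := kil_rho_coord kX; have [y1 y2 y3 y4] := kil_rho_coord kY.
  rewrite !inE => /or4P[] /eqP ->; split=> //; rewrite ?x1 ?x2 ?x3 ?x4 ?y1 ?y2 ?y3 ?y4;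
    by idl_tac.
have H0 : r0 = 0 by apply: vecP; apply: H; rewrite !inE eqxx ?orbT.
have H1 : r1 = 0 by apply: vecP; apply: H; rewrite !inE eqxx ?orbT.
by move=> Z; rewrite rho_coord -/r0 -/r1 H0 H1 !vscaler0 addr0.
Qed.

Lemma tau_rho_flat C : tau C = 0 -> (forall Z, rho C Z = 0) -> flat_germ C.
Proof.
by move=> t0 r0; split=> [X Y|X Y Z]; rewrite ?torsE ?curvE ?t0 ?r0 vscaler0.
Qed.

(* The connection form of the line bundle of 2-vectors, its curvature [ctr]
   and the covariant derivative of the latter. *)
Definition th0 C : A := (ch00 C).1 + (ch01 C).2.
Definition th1 C : A := (ch10 C).1 + (ch11 C).2.
Definition ctr C : A := (rho C (frame0 G)).1 + (rho C (frame1 G)).2.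
Definition mu0 C : A := d0 (ctr C) - ctr C * th0 C.
Definition mu1 C : A := d1 (ctr C) - ctr C * th1 C.

(** The curvature of a line bundle is the exterior derivative of its connection form, and on
    bivectors the curvature acts by its trace. *)
Lemma ctrE C : ctr C = d0 (th1 C) - d1 (th0 C).
Proof.
case: C => [[c1 c2] [c3 c4] [c5 c6] [c7 c8]].
by rewrite /ctr /rho /curv /nab /br /der /th0 /th1 /frame0 /frame1 /= ?dE; ring.
Qed.

(** These are traces of the Killing equations: in each direction, the first component of the
    equation for [frame0] plus the second component of the one for [frame1]. *)
Lemma kil_th C X : kil C X ->
  der X (th0 C) = - (d0 X.1 * th0 C + d0 X.2 * th1 C + d0 (diver X)) /\
  der X (th1 C) = - (d1 X.1 * th0 C + d1 X.2 * th1 C + d1 (diver X)).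
Proof.
move=> kX; have e00 := congr1 fst (kX (frame0 G) (frame0 G)).
have e01 := congr1 snd (kX (frame0 G) (frame1 G)).
have e10 := congr1 fst (kX (frame1 G) (frame0 G)).
have e11 := congr1 snd (kX (frame1 G) (frame1 G)).
have {e00 e01} e0 := congr2 +%R e00 e01; have {e10 e11} e1 := congr2 +%R e10 e11.
case: C X e0 e1 {kX} => [[c1 c2] [c3 c4] [c5 c6] [c7 c8]] [x1 x2].
rewrite /lie_nab /th0 /th1 /diver /frame0 /frame1 /= addr0 => e0 e1.
split; apply/subr0_eq; [rewrite -e0|rewrite -e1];
  by rewrite /nab /br /der /= ?dE; ring.
Qed.

Lemma kil_ctr C X : kil C X -> der X (ctr C) = - (diver X * ctr C).
Proof.
move=> /kil_rho_coord[e0 _ _ e3]; rewrite /ctr derD e0 e3 /diver; ring.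
Qed.

Lemma kil_mu C X : kil C X ->
  der X (mu0 C) = - (d0 X.1 * mu0 C + d0 X.2 * mu1 C + diver X * mu0 C) /\
  der X (mu1 C) = - (d1 X.1 * mu0 C + d1 X.2 * mu1 C + diver X * mu1 C).
Proof.
move=> kX; have [t0 t1] := kil_th kX; have s := kil_ctr kX.
have c0 := congr1 d0 s; have c1 := congr1 d1 s.
rewrite /mu0 /mu1 !derD !derN !derM t0 t1 s.
move: (ctr C) (th0 C) (th1 C) c0 c1 {s t0 t1} => s t0 t1; rewrite /der /diver ?dE => c0 c1.
by split; rewrite ?dE; [ring_from c0|ring_from c1].
Qed.

(** A zero of the covariant derivative of [ctr] forces it to vanish identically, since its own
    derivatives along [X] and [Y] are linear in it. Differentiating once more, [ctr] times the
    curvature of its line bundle, that is the square of [ctr], is zero. *)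
Lemma ctr_vanish C X Y : kil C X -> kil C Y -> ev (wedge X Y) != 0 ->
  ev (mu0 C) = 0 -> ev (mu1 C) = 0 -> ev (ctr C) = 0.
Proof.
move=> kX kY w0 m0 m1; pose s := [:: mu0 C; mu1 C].
have H : {in s, forall f, f = 0}.
  apply: (idl_vanish_frame w0) => f.
  have [x1 x2] := kil_mu kX; have [y1 y2] := kil_mu kY.
  by rewrite !inE => /orP[] /eqP ->; rewrite ?x1 ?x2 ?y1 ?y2; split=> //; idl_tac.
have M0 : mu0 C = 0 by apply: H; rewrite !inE eqxx.
have M1 : mu1 C = 0 by apply: H; rewrite !inE eqxx orbT.
have : d0 (mu1 C) - d1 (mu0 C) + (mu0 C * th1 C - mu1 C * th0 C) = - (ctr C * ctr C).
  move: (ctrE C); rewrite /mu0 /mu1; move: (ctr C) (th0 C) (th1 C) => s' t0 t1 sE.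
  by rewrite [X in _ = - (s' * X)]sE ?dE; ring.
rewrite M0 M1 d00 d10 !mul0r !subrr addr0 => /(congr1 ev); rewrite rmorph0 rmorphN rmorphM.
by move/esym/eqP; rewrite oppr_eq0 mulf_eq0 orbb => /eqP.
Qed.

End Invariants.

(** * Isotropy *)

Section Isotropy.
Context {R : realType} (G : germ_algebra R).
Local Notation A := (ga_ring G).
Local Notation d0 := (ga_d0 (g := G)).
Local Notation d1 := (ga_d1 (g := G)).
Local Notation ev := (ga_ev G).
Local Notation cst := (ga_cst G).
Local Notation vec := (A * A)%type.
Implicit Types (X Y Z W U V : vec) (f g x y : A) (r s : R) (C : christoffel G).

(** On a pair of frame fields, each component of the Killing equation contains exactly one second
    derivative of [X], which it expresses through the 1-jet. *)
Lemma kil_second_derivatives C X :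
  kil C X -> let s := [:: X.1; X.2; d0 X.1; d1 X.1; d0 X.2; d1 X.2] in
  [/\ idl s (d0 (d0 X.1)), idl s (d1 (d0 X.1)) & idl s (d1 (d1 X.1))] /\
  [/\ idl s (d0 (d0 X.2)), idl s (d1 (d0 X.2)) & idl s (d1 (d1 X.2))].
Proof.
move=> kX; have e00 := kX (frame0 G) (frame0 G).
have e01 := kX (frame0 G) (frame1 G); have e11 := kX (frame1 G) (frame1 G).
case: X {kX} e00 e01 e11 => x1 x2 e00 e01 e11 s.
case: C e00 e01 e11 => [[c1 c2] [c3 c4] [c5 c6] [c7 c8]] e00 e01 e11.
have g1 := congr1 fst e00; have g2 := congr1 snd e00; have e1 := congr1 fst e01.
have e2 := congr1 snd e01; have f1 := congr1 fst e11; have f2 := congr1 snd e11.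
rewrite /lie_nab /nab /br /der /frame0 /frame1 /= {e00 e01 e11} in g1 g2 e1 e2 f1 f2.
rewrite ?dE in g1; rewrite ?dE in g2; rewrite ?dE in e1.
rewrite ?dE in e2; rewrite ?dE in f1; rewrite ?dE in f2.
have sol (u c1' a1 c2' a2 c3' a3 c4' a4 c5' a5 c6' a6 : A) :
    a1 \in s -> a2 \in s -> a3 \in s -> a4 \in s -> a5 \in s -> a6 \in s ->
    u = c1' * a1 + c2' * a2 + c3' * a3 + c4' * a4 + c5' * a5 + c6' * a6 -> idl s u.
  by move=> *; subst u; repeat apply: idl_add; apply: idl_mul; apply: idl_mem.
have m1 : x1 \in s by rewrite !inE eqxx.
have m2 : x2 \in s by rewrite !inE eqxx ?orbT.
have m3 : d0 x1 \in s by rewrite !inE eqxx ?orbT.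
have m4 : d1 x1 \in s by rewrite !inE eqxx ?orbT.
have m5 : d0 x2 \in s by rewrite !inE eqxx ?orbT.
have m6 : d1 x2 \in s by rewrite !inE eqxx ?orbT.
split; split.
- apply: (sol _ (- d0 c1) _ (- d1 c1) _ (- c1) _ c2 _ (- c3 - c5) _ 0 _ m1 m2 m3 m4 m5 m6).
  by ring_from g1.
- apply: (sol _ (- d0 c3) _ (- d1 c3) _ 0 _ (c4 - c1) _ (- c7) _ (- c3) _ m1 m2 m3 m4 m5 m6).
  by ring_from e1.
- apply: (sol _ (- d0 c7) _ (- d1 c7) _ c7 _ (c8 - c3 - c5) _ 0 _ (- c7 - c7) _ m1 m2 m3 m4 m5 m6).
  by ring_from f1.
- apply: (sol _ (- d0 c2) _ (- d1 c2) _ (- c2 - c2) _ 0 _ (c1 - c4 - c6) _ c2 _ m1 m2 m3 m4 m5 m6).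
  by ring_from g2.
- apply: (sol _ (- d0 c4) _ (- d1 c4) _ (- c4) _ (- c2) _ (c3 - c8) _ 0 _ m1 m2 m3 m4 m5 m6).
  by ring_from e2.
- apply: (sol _ (- d0 c8) _ (- d1 c8) _ 0 _ (- c4 - c6) _ c7 _ (- c8) _ m1 m2 m3 m4 m5 m6).
  by ring_from f2.
Qed.

Definition jet X : R * R * R * R := (ev (d0 X.1), ev (d1 X.1), ev (d0 X.2), ev (d1 X.2)).

(** The components of [X] and their first derivatives form a closed linear system. *)
Lemma kil_jet0 C X : kil C X -> evv X = 0 -> jet X = 0 -> X = 0.
Proof.
move=> kX [x1 x2] [j11 j12 j21 j22]; have [[a1 a2 a3] [b1 b2 b3]] := kil_second_derivatives kX.
set s := [:: _; _; _; _; _; _] in a1 a2 a3 b1 b2 b3.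
have H : {in s, forall f, f = 0}.
  apply: idl_vanish => f; rewrite !inE.
  by move=> /or4P[|||/or3P[]] /eqP ->; rewrite ?ga_dC; split=> //;
    apply: idl_mem; rewrite !inE eqxx ?orbT.
by apply: vecP; apply: H; rewrite !inE eqxx ?orbT.
Qed.

Definition isot C Z := kil C Z /\ evv Z = 0.

Lemma ev_der0 Z f : evv Z = 0 -> ev (der Z f) = 0.
Proof. by case=> z1 z2; rewrite /der rmorphD !rmorphM z1 z2 !mul0r addr0. Qed.

(** Where [Z] vanishes, bracketing with [Z] acts on values by minus the linear part of [Z]; this
    sign recurs in all later eigenvector computations. *)
Lemma evv_br Z X : evv Z = 0 -> evv (br Z X) =
  (- (ev (d0 Z.1) * ev X.1 + ev (d1 Z.1) * ev X.2),
   - (ev (d0 Z.2) * ev X.1 + ev (d1 Z.2) * ev X.2)).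
Proof.
move=> z0; rewrite /evv /br /= !rmorphB !(ev_der0 _ z0) !sub0r /der !rmorphD !rmorphM.
by congr (- _, - _); rewrite ![ev X.1 * _]mulrC ![ev X.2 * _]mulrC.
Qed.

Lemma evvD X Y : evv (X + Y) = evv X + evv Y.
Proof. by rewrite /evv /= !rmorphD. Qed.
Lemma evvN X : evv (- X) = - evv X.
Proof. by rewrite /evv /= !rmorphN. Qed.
Lemma evvZ r X : evv (vscale (cst r) X) = (r * ev X.1, r * ev X.2).
Proof. by rewrite /evv /= !rmorphM !ga_evC. Qed.

Lemma jetD X Y : jet (X + Y) = jet X + jet Y.
Proof. by rewrite /jet /= !dE !rmorphD. Qed.
Lemma jetN X : jet (- X) = - jet X.
Proof. by rewrite /jet /= !dE !rmorphN. Qed.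
Lemma jetZ r X : jet (vscale (cst r) X) =
  (r * ev (d0 X.1), r * ev (d1 X.1), r * ev (d0 X.2), r * ev (d1 X.2)).
Proof. by rewrite /jet /= !dE !mul0r !add0r !rmorphM !ga_evC. Qed.

Lemma isot_eq C V W : isot C V -> isot C W -> jet V = jet W -> V = W.
Proof.
move=> [kV v0] [kW w0] j; apply: subr0_eq; apply: (kil_jet0 (kil_add kV (kil_opp kW))).
  by rewrite evvD evvN v0 w0 subrr.
by rewrite jetD jetN j subrr.
Qed.

Lemma isot_add C V W : isot C V -> isot C W -> isot C (V + W).
Proof.
by move=> [kV v0] [kW w0]; split; [exact: kil_add|rewrite evvD v0 w0 addr0].
Qed.

Lemma isot_cst C r V : isot C V -> isot C (vscale (cst r) V).
Proof.
move=> [kV [v1 v2]]; split; first exact: kil_cst.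
by rewrite evvZ v1 v2 !mulr0.
Qed.

(* The conditions for the matrix [a b; c d] to preserve a torsion vector and a
   curvature endomorphism. *)
Definition fix_tau (a b c d t1 t2 : R) :=
  t1 * a + t2 * b = (a + d) * t1 /\ t1 * c + t2 * d = (a + d) * t2.
Definition fix_rho (a b c d r1 r2 r3 r4 : R) :=
  [/\ r2 * b - c * r3 = (a + d) * r1, c * (r1 - r4) + (d - a) * r2 = (a + d) * r2,
      b * (r4 - r1) + (a - d) * r3 = (a + d) * r3 & c * r3 - b * r2 = (a + d) * r4].

(** At a zero of [Z] the derivatives along [Z] drop out of the Lie derivative formulas, and
    algebraic conditions on the linear part remain. *)
Lemma isot_fix C Z : isot C Z ->
  fix_tau (ev (d0 Z.1)) (ev (d1 Z.1)) (ev (d0 Z.2)) (ev (d1 Z.2))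
    (ev (tau C).1) (ev (tau C).2) /\
  fix_rho (ev (d0 Z.1)) (ev (d1 Z.1)) (ev (d0 Z.2)) (ev (d1 Z.2))
    (ev (rho C (frame0 G)).1) (ev (rho C (frame0 G)).2)
    (ev (rho C (frame1 G)).1) (ev (rho C (frame1 G)).2).
Proof.
move=> [kZ z0]; have [t1 t2] := kil_tau_coord kZ; have [r1 r2 r3 r4] := kil_rho_coord kZ.
have E f g : der Z f = g -> ev g = 0 by move=> <-; exact: ev_der0.
move: (E _ _ t1) (E _ _ t2) (E _ _ r1) (E _ _ r2) (E _ _ r3) (E _ _ r4).
rewrite /diver; move: (d0 Z.1) (d1 Z.1) (d0 Z.2) (d1 Z.2) => a b c d.
move: (tau C) (rho C (frame0 G)) (rho C (frame1 G)) => [p1 p2] [q1 q2] [s1 s2] /=.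
rewrite !(rmorphD, rmorphB, rmorphN, rmorphM).
move: (ev a) (ev b) (ev c) (ev d) (ev p1) (ev p2) (ev q1) (ev q2) (ev s1) (ev s2).
move=> {}a {}b {}c {}d {}p1 {}p2 {}q1 {}q2 {}s1 {}s2 e1 e2 e3 e4 e5 e6.
by split; split; [ring_from e1|ring_from e2|ring_from e3|ring_from e4|ring_from e5|ring_from e6].
Qed.

Lemma isot_mu C Z : isot C Z -> ev (diver Z) = 0 ->
  ev (d0 Z.1) * ev (mu0 C) + ev (d0 Z.2) * ev (mu1 C) = 0 /\
  ev (d1 Z.1) * ev (mu0 C) + ev (d1 Z.2) * ev (mu1 C) = 0.
Proof.
move=> [kZ z0] dz; have [m0 m1] := kil_mu kZ.
have := ev_der0 (mu0 C) z0; have := ev_der0 (mu1 C) z0; rewrite m0 m1.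
move: (diver Z) dz (mu0 C) (mu1 C) => v dz p q {m0 m1}.
rewrite !(rmorphD, rmorphN, rmorphM) dz !mul0r !addr0 => /eqP + /eqP.
by rewrite !oppr_eq0 => /eqP -> /eqP ->.
Qed.

Definition nonflat C := ~ flat_germ C.
Definition kil_frame C := exists X Y, [/\ kil C X, kil C Y & ev (wedge X Y) != 0].

Lemma nonflat_ev C : kil_frame C -> nonflat C ->
  evv (tau C) = 0 -> evv (rho C (frame0 G)) = 0 -> evv (rho C (frame1 G)) = 0 -> False.
Proof.
move=> [X [Y [kX kY w0]]] nf t0 r0 r1; apply: nf; apply: tau_rho_flat.
  exact: (tau_vanish kX kY).
exact: (rho_vanish kX kY w0).
Qed.

End Isotropy.

(** * Matrices preserving torsion and curvature at a point *)

Section RealMatrices.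
Context {R : realType}.
Implicit Types (a b c d t : R).

Lemma fix_nondegenerate a b c d t1 t2 r1 r2 r3 r4 : a + d != 0 -> a * d - b * c != 0 ->
  fix_tau a b c d t1 t2 -> fix_rho a b c d r1 r2 r3 r4 ->
  [/\ t1 = 0, t2 = 0, r1 = 0 & [/\ r2 = 0, r3 = 0 & r4 = 0]].
Proof.
move=> tr det [e1 e2] [f1 f2 f3 f4].
(* By Cayley-Hamilton, applying the matrix [L] to [L t - tr(L) t] gives [- det(L) t]. *)
have t1z : t1 = 0.
  apply: (mulfI det); rewrite mulr0.
  have -> : (a * d - b * c) * t1 = - a * (t1 * a + t2 * b - (a + d) * t1)
    - b * (t1 * c + t2 * d - (a + d) * t2) by ring.
  by rewrite e1 e2 !subrr !mulr0 subr0.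
have t2z : t2 = 0.
  apply: (mulfI det); rewrite mulr0.
  have -> : (a * d - b * c) * t2 = - c * (t1 * a + t2 * b - (a + d) * t1)
    - d * (t1 * c + t2 * d - (a + d) * t2) by ring.
  by rewrite e1 e2 !subrr !mulr0 subr0.
(* A commutator has trace zero, so [tr(L) tr(r) = 0]. *)
have r4z : r4 = - r1.
  apply: (mulfI tr); apply/eqP; rewrite -subr_eq0; apply/eqP.
  have -> : (a + d) * r4 - (a + d) * - r1 = (a + d) * r4 + (a + d) * r1 by ring.
  by rewrite -f1 -f4; ring.
have g2 : c * r1 = a * r2 by move: f2; rewrite r4z => f2; lra.
have g3 : b * r1 = - (d * r3) by move: f3; rewrite r4z => f3; lra.
have r1z : r1 = 0.
  apply: (mulfI tr); rewrite mulr0; apply: (mulfI det); rewrite mulr0.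
  have -> : (a * d - b * c) * ((a + d) * r1) =
     a * d * ((a + d) * r1 - (r2 * b - c * r3)) + d * b * (a * r2 - c * r1)
     - a * c * (b * r1 + d * r3) by ring.
  rewrite f1 g2 g3; ring.
move: g2 g3 f1; rewrite r1z !mulr0 => g2 g3 f1.
have ar2 : a * r2 = 0 by rewrite -g2.
have dr3 : d * r3 = 0 by apply/eqP; rewrite -oppr_eq0 -g3.
have {f1}br : b * r2 = c * r3 by move: f1; rewrite mulrC; lra.
suff [r2z r3z] : r2 = 0 /\ r3 = 0 by split=> //; split=> //; rewrite r4z r1z oppr0.
have [a0|a0] := eqVneq a 0.
  have d0 : d != 0 by move: tr; rewrite a0 add0r.
  have r3z : r3 = 0 by apply: (mulfI d0); rewrite mulr0.
  have b0 : b != 0 by apply: contraNneq det => ->; rewrite a0 !mul0r subrr.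
  by split=> //; apply: (mulfI b0); rewrite br r3z !mulr0.
have r2z : r2 = 0 by apply: (mulfI a0); rewrite mulr0.
split=> //; have [d0|d0] := eqVneq d 0; last by apply: (mulfI d0); rewrite mulr0.
have c0 : c != 0 by apply: contraNneq det => ->; rewrite d0 !mulr0 subrr.
by apply: (mulfI c0); rewrite -br r2z !mulr0.
Qed.

(* A traceless invertible matrix and a traceless endomorphism commuting with it
   are proportional, so that they have the same stabilizer. *)
Lemma fix_traceless a b c d r1 r2 r3 r4 a' b' c' d' : a + d = 0 ->
  a * d - b * c != 0 -> r4 = - r1 -> ~ (r1 = 0 /\ r2 = 0 /\ r3 = 0) ->
  fix_rho a b c d r1 r2 r3 r4 -> fix_rho a' b' c' d' r1 r2 r3 r4 ->
  exists t, [/\ a' = t * a, b' = t * b, c' = t * c & d' = t * d].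
Proof.
move=> tr det r4E r0 [e1 e2 e3 _] [f1 f2 f3 f4].
have dE : d = - a by lra.
have p1 : c * r1 = a * r2 by move: e2; rewrite r4E dE; lra.
have p2 : b * r1 = a * r3 by move: e3; rewrite r4E dE; lra.
have p3 : b * r2 = c * r3 by move: e1; rewrite dE subrr mul0r; lra.
have det' : a * a + b * c != 0.
  by apply: contraNneq det => e; rewrite dE -oppr0 -e; apply/eqP; ring.
have [k [k0 [q1 q2 q3]]] : exists k, k != 0 /\ [/\ r1 = k * a, r2 = k * c & r3 = k * b].
  have [a0|a0] := eqVneq a 0.
    have bc0 : b * c != 0 by move: det'; rewrite a0 mul0r add0r.
    have b0 : b != 0 by apply: contraNneq bc0 => ->; rewrite mul0r.
    have r1z : r1 = 0 by apply: (mulfI b0); rewrite p2 a0 mul0r mulr0.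
    have rE : r2 = r3 / b * c by apply: (mulfI b0); rewrite p3; field.
    have rE' : r3 = r3 / b * b by field.
    exists (r3 / b); split; last by split=> //; rewrite r1z a0 mulr0.
    by apply/eqP => k0; apply: r0; rewrite rE rE' k0 !mul0r.
  have rE : r2 = r1 / a * c by apply: (mulfI a0); rewrite -p1; field.
  have rE' : r3 = r1 / a * b by apply: (mulfI a0); rewrite -p2; field.
  have rE'' : r1 = r1 / a * a by field.
  exists (r1 / a); split=> //.
  by apply/eqP => k0; apply: r0; rewrite rE rE' rE'' k0 !mul0r.
have {}f1 : b' * c - c' * b = (a' + d') * a.
  by apply: (mulfI k0); have := f1; rewrite q1 q2 q3 => e; ring_from e.
have {}f2 : 2 * c' * a + (d' - a') * c = (a' + d') * c.
  by apply: (mulfI k0); have := f2; rewrite r4E q1 q2 => e; ring_from e.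
have {}f3 : - 2 * b' * a + (a' - d') * b = (a' + d') * b.
  by apply: (mulfI k0); have := f3; rewrite r4E q1 q3 => e; ring_from e.
(* Pairing [[L', L] = tr(L') L] with [L] under the trace form: a commutator with [L] is orthogonal
   to [L], and the trace of the square of [L] is twice [a * a + b * c]. *)
have T0 : a' + d' = 0.
  apply: (mulfI det'); rewrite mulr0.
  have : 2 * ((a * a + b * c) * (a' + d')) =
      - 2 * a * (b' * c - c' * b - (a' + d') * a)
      - c * (- 2 * b' * a + (a' - d') * b - (a' + d') * b)
      - b * (2 * c' * a + (d' - a') * c - (a' + d') * c) by ring.
  by rewrite f1 f2 f3 !subrr !mulr0 !subr0 => /eqP; rewrite mulf_eq0 pnatr_eq0 => /eqP.
have d'E : d' = - a' by lra.
move: f1 f2 f3; rewrite T0 !mul0r d'E => f1 f2 f3.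
have [a0|a0] := eqVneq a 0.
  have bc0 : b * c != 0 by move: det'; rewrite a0 mul0r add0r.
  have b0 : b != 0 by apply: contraNneq bc0 => ->; rewrite mul0r.
  have a'0 : a' = 0 by apply: (mulfI b0); move: f3; rewrite a0; lra.
  exists (b' / b); rewrite a'0 dE a0 oppr0 !mulr0; split=> //; first by field.
  by apply: (mulfI b0); have -> : b * (b' / b * c) = b' * c; [by field|lra].
exists (a' / a); split; [by field| | | by rewrite dE; field].
  by apply: (mulfI a0); have -> : a * (a' / a * b) = a' * b; [by field|lra].
by apply: (mulfI a0); have -> : a * (a' / a * c) = a' * c; [by field|lra].
Qed.

End RealMatrices.

(** * Change of commuting frame *)

Section FrameChange.
Context {R : realType} (G : germ_algebra R).
Local Notation A := (ga_ring G).
Local Notation ev := (ga_ev G).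
Local Notation cst := (ga_cst G).
Local Notation vec := (A * A)%type.
Implicit Types (X Y Z W U V : vec) (f g x y : A) (r s : R) (C : christoffel G).

Variables (D E : vec).
Hypotheses (brDE : br D E = 0) (wDE : ev (wedge D E) != 0).

Lemma frame_dC f : der D (der E f) = der E (der D f).
Proof. by apply: subr0_eq; rewrite -der_br brDE /der !mul0r addr0. Qed.

Lemma frame_uniq n (u : 'I_n -> A) :
  (forall a, exists c, der D (u a) = \sum_b c b * u b) ->
  (forall a, exists c, der E (u a) = \sum_b c b * u b) ->
  (forall a, ev (u a) = 0) -> forall a, u a = 0.
Proof.
have [w ww] := ga_inv wDE; move=> eD eE; apply: ga_uniq => a.
  have [[c ec] [e ee]] := (eD a, eE a).
  exists (fun b => w * E.2 * c b - w * D.2 * e b).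
  under eq_bigr do rewrite mulrBl -!mulrA.
  rewrite sumrB -!mulr_sumr -ec -ee -[LHS]mul1r -ww /wedge /der; ring.
have [[c ec] [e ee]] := (eD a, eE a).
exists (fun b => - (w * E.1) * c b + w * D.1 * e b).
under eq_bigr do rewrite mulrDl -!mulrA mulNr -!mulrA.
rewrite big_split /= sumrN -!mulr_sumr -ec -ee -[LHS]mul1r -ww /wedge /der; ring.
Qed.

Lemma frame_poincare f g : der E f = der D g ->
  exists h, [/\ der D h = f, der E h = g & ev h = 0].
Proof.
move=> e; apply: (@poincare_frame _ _ D E 0 f g wDE).
  by rewrite brDE vscale0.
by rewrite e subrr mul0r.
Qed.

Definition frame_alg : germ_algebra R := {|
  ga_ring := A; ga_cst := cst; ga_ev := ev; ga_d0 := der D; ga_d1 := der E;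
  ga_comp := @ga_comp R G; ga_evC := @ga_evC R G;
  ga_d0D := derD D; ga_d1D := derD E; ga_d0M := derM D; ga_d1M := derM E;
  ga_d0C := derC D; ga_d1C := derC E; ga_dC := frame_dC; ga_inv := @ga_inv R G;
  ga_uniq := frame_uniq; ga_poincare := frame_poincare;
  ga_d0comp := fun alpha beta h x => @der_comp R G D alpha beta h x;
  ga_d1comp := fun alpha beta h x => @der_comp R G E alpha beta h x;
  ga_compode := @ga_compode R G; ga_evcomp := @ga_evcomp R G |}.
Local Notation F := frame_alg.

(** A pair of germs is read over [frame_alg] as components along [D] and [E], and over [G] as
    components along the coordinate fields; [push] passes from the first reading to the second. *)
Definition push (u : vec) : vec := vscale u.1 D + vscale u.2 E.

Lemma push_surj V : exists u, push u = V.
Proof. by have [f [g ->]] := frame_decomp V wDE; exists (f, g). Qed.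

Definition pull V : vec := projT1 (cid (push_surj V)).
Lemma pullK V : push (pull V) = V. Proof. exact: (projT2 (cid (push_surj V))). Qed.

Lemma push_eq0 u : push u = 0 -> u = 0.
Proof.
move=> e; have e1 := congr1 fst e; have e2 := congr1 snd e; move: e1 e2.
rewrite /push /vscale /= => e1 e2; apply: vecP; apply: (unit_cancel wDE).
  have -> : wedge D E * u.1 = E.2 * (u.1 * D.1 + u.2 * E.1) - E.1 * (u.1 * D.2 + u.2 * E.2).
    by rewrite /wedge; ring.
  by rewrite e1 e2 !mulr0 subr0.
have -> : wedge D E * u.2 = D.1 * (u.1 * D.2 + u.2 * E.2) - D.2 * (u.1 * D.1 + u.2 * E.1).
  by rewrite /wedge; ring.
by rewrite e1 e2 !mulr0 subr0.
Qed.

Lemma pushD u v : push (u + v) = push u + push v.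
Proof. by rewrite /push; vring. Qed.
Lemma pushN u : push (- u) = - push u.
Proof. by rewrite /push; vring. Qed.
Lemma push_scale f u : push (vscale f u) = vscale f (push u).
Proof. by rewrite /push; vring. Qed.

Lemma push_inj u v : push u = push v -> u = v.
Proof.
by move=> e; apply/subr0_eq/push_eq0; rewrite pushD pushN e subrr.
Qed.

Lemma push_br u v : push (br (G := F) u v) = br (push u) (push v).
Proof.
rewrite /push !(br_add_l, br_add_r, br_scale_l, br_scale_r) !br_self (br_anti E) brDE.
by rewrite /br /der /= /der /=; vring.
Qed.

Definition frame_conn C : christoffel F :=
  @Christoffel R F (pull (nab C D D)) (pull (nab C D E)) (pull (nab C E D)) (pull (nab C E E)).

Lemma push_nab C u v : push (nab (G := F) (frame_conn C) u v) = nab C (push u) (push v).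
Proof.
have e : push (nab (G := F) (frame_conn C) u v) =
  vscale (der (push u) v.1) D + vscale (der (push u) v.2) E +
  (vscale (u.1 * v.1) (push (pull (nab C D D))) + vscale (u.1 * v.2) (push (pull (nab C D E))) +
   vscale (u.2 * v.1) (push (pull (nab C E D))) + vscale (u.2 * v.2) (push (pull (nab C E E)))).
  rewrite /frame_conn /nab; move: (pull _) (pull _) (pull _) (pull _) => p1 p2 p3 p4 /=.
  by rewrite /push /der /= /der /=; vring.
rewrite e !pullK /push !(nab_add_l, nab_add_r, nab_scale_l, nab_scale_r).
move: (nab C D D) (nab C D E) (nab C E D) (nab C E E) => q1 q2 q3 q4.
by rewrite /der /=; vring.
Qed.

Lemma push_lie_nab C u v w : push (lie_nab (G := F) (frame_conn C) u v w) =
  lie_nab C (push u) (push v) (push w).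
Proof. by rewrite /lie_nab !pushD !pushN push_br !push_nab !push_br. Qed.

Lemma kil_push C u : kil (G := F) (frame_conn C) u <-> kil C (push u).
Proof.
split=> [k Y Z|k v w].
  by rewrite -(pullK Y) -(pullK Z) -push_lie_nab k /push !vscale0 addr0.
by apply: push_eq0; rewrite push_lie_nab k.
Qed.

Lemma flat_push C : flat_germ (G := F) (frame_conn C) -> flat_germ C.
Proof.
have push0 : push 0 = 0 by rewrite /push !vscale0 addr0.
have et u v : push (tors (G := F) (frame_conn C) u v) = tors C (push u) (push v).
  by rewrite /tors !pushD !pushN push_br !push_nab.
have ec u v w : push (curv (G := F) (frame_conn C) u v w) = curv C (push u) (push v) (push w).
  by rewrite /curv !pushD !pushN !push_nab push_br.
move=> [t0 c0]; split=> [X Y|X Y Z].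
  by rewrite -(pullK X) -(pullK Y) -et t0.
by rewrite -(pullK X) -(pullK Y) -(pullK Z) -ec c0.
Qed.

End FrameChange.

(** * Isotropy without eigenvalue zero *)

Section ConstantCombinations.
Context {R : realType} (G : germ_algebra R).
Local Notation A := (ga_ring G).
Local Notation d0 := (ga_d0 (g := G)).
Local Notation d1 := (ga_d1 (g := G)).
Local Notation ev := (ga_ev G).
Local Notation cst := (ga_cst G).
Local Notation vec := (A * A)%type.
Implicit Types (X Y Z W U V : vec) (f g x y : A) (r s : R) (C : christoffel G).

Local Notation "r *v X" := (vscale (cst r) X) (at level 40).

Lemma vcstA r s X : r *v (s *v X) = (r * s) *v X.
Proof. by rewrite vscaleA rmorphM. Qed.
Lemma vcst1 X : 1 *v X = X. Proof. by rewrite rmorph1 vscale1. Qed.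
Lemma vcst0 X : 0 *v X = 0. Proof. by rewrite rmorph0 vscale0. Qed.
Lemma vcstN r X : (- r) *v X = - (r *v X). Proof. by rewrite rmorphN vscaleN. Qed.

Lemma kil_decomp C X Y V : kil C X -> kil C Y -> ev (wedge X Y) != 0 -> kil C V ->
  exists p q, isot C (V - (p *v X + q *v Y)).
Proof.
move=> kX kY; rewrite /wedge rmorphB !rmorphM => w0 kV.
exists ((ev V.1 * ev Y.2 - ev V.2 * ev Y.1) / (ev X.1 * ev Y.2 - ev X.2 * ev Y.1)).
exists ((ev X.1 * ev V.2 - ev X.2 * ev V.1) / (ev X.1 * ev Y.2 - ev X.2 * ev Y.1)).
split; first by apply: kil_add => //; apply/kil_opp/kil_add; exact: kil_cst.
rewrite evvD evvN evvD !evvZ; move: w0; rewrite /evv.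
move: (ev X.1) (ev X.2) (ev Y.1) (ev Y.2) (ev V.1) (ev V.2) => *.
by congr (_, _); rewrite /=; field.
Qed.

Lemma kil_value C (v1 v2 : R) : kil_frame C -> exists u, [/\ kil C u, ev u.1 = v1 & ev u.2 = v2].
Proof.
move=> [X [Y [kX kY]]]; rewrite /wedge rmorphB !rmorphM => w0.
pose w := ev X.1 * ev Y.2 - ev X.2 * ev Y.1.
exists (((v1 * ev Y.2 - v2 * ev Y.1) / w) *v X + ((ev X.1 * v2 - ev X.2 * v1) / w) *v Y).
split; first by apply: kil_add; exact: kil_cst.
  rewrite /= rmorphD !rmorphM !ga_evC /w; move: w0.
  by move: (ev X.1) (ev X.2) (ev Y.1) (ev Y.2) => *; field.
rewrite /= rmorphD !rmorphM !ga_evC /w; move: w0.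
by move: (ev X.1) (ev X.2) (ev Y.1) (ev Y.2) => *; field.
Qed.

(** A matrix for which (1, 0), (0, 1) and (1, 1) are all eigenvectors is scalar. *)
Lemma kil_noneigen C (a b c d : R) : kil_frame C -> ~ (b = 0 /\ c = 0 /\ a = d) ->
  exists u, kil C u /\
    ev u.1 * (c * ev u.1 + d * ev u.2) - ev u.2 * (a * ev u.1 + b * ev u.2) != 0.
Proof.
move=> tC ns; have [c0|c0] := eqVneq c 0; last first.
  have [u [ku u1 u2]] := kil_value 1 0 tC; exists u; split=> //; rewrite u1 u2.
  by rewrite (_ : _ - _ = c)//; ring.
have [b0|b0] := eqVneq b 0; last first.
  have [u [ku u1 u2]] := kil_value 0 1 tC; exists u; split=> //; rewrite u1 u2.
  by rewrite (_ : _ - _ = - b) ?oppr_eq0//; ring.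
have [u [ku u1 u2]] := kil_value 1 1 tC; exists u; split=> //; rewrite u1 u2 b0 c0.
rewrite (_ : _ - _ = d - a); last by ring.
by rewrite subr_eq0; apply/eqP => da; apply: ns.
Qed.

Lemma vcst_eq0 r X : r *v X = 0 -> X <> 0 -> r = 0.
Proof.
move=> rX X0; apply/eqP/negP => /negP r0; apply: X0.
by rewrite -[X]vcst1 -(mulVf r0) -vcstA rX vscaler0.
Qed.

Lemma frame_indep X Y p q : ev (wedge X Y) != 0 -> evv (p *v X + q *v Y) = 0 ->
  p = 0 /\ q = 0.
Proof.
rewrite /wedge rmorphB !rmorphM evvD !evvZ => w0 [e1 e2].
exact: linear_system2 w0 e1 e2.
Qed.

Lemma frame_isot_indep X Y Z p q r : ev (wedge X Y) != 0 -> evv Z = 0 -> Z <> 0 ->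
  p *v X + q *v Y + r *v Z = 0 -> [/\ p = 0, q = 0 & r = 0].
Proof.
move=> w0 z0 Z0 e; have [p0 q0] : p = 0 /\ q = 0.
  apply: (frame_indep w0); rewrite (_ : _ + _ = - (r *v Z)).
    by rewrite evvN evvZ; case: z0 => -> ->; rewrite !mulr0 oppr0.
  by apply/eqP; rewrite -addr_eq0 e.
split=> //; apply: (vcst_eq0 _ Z0); by move: e; rewrite p0 q0 !vcst0 !add0r.
Qed.

(* A basis of a copy of o(3) if al, be and ga have the same sign, of sl(2) if not. *)
Definition simple_basis C e1 e2 e3 (al be ga : R) :=
  [/\ [/\ kil C e1, kil C e2 & kil C e3], [/\ al != 0, be != 0 & ga != 0],
      [/\ br e1 e2 = ga *v e3, br e2 e3 = al *v e1 & br e3 e1 = be *v e2],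
      forall p q r, p *v e1 + q *v e2 + r *v e3 = 0 -> [/\ p = 0, q = 0 & r = 0] &
      forall V, kil C V -> exists p q r, V = p *v e1 + q *v e2 + r *v e3].

Lemma nab_zero_l C X : nab C 0 X = 0.
Proof. by rewrite -(vscale0 0) nab_scale_l !vscale0. Qed.
Lemma nab_zero_r C X : nab C X 0 = 0.
Proof. by rewrite -(vscale0 0) nab_scale_r vscale0 /der ?dE !mulr0 addr0 vscale0 addr0. Qed.

Lemma br_eq0 X Y : br X Y = 0 -> der X Y.1 = der Y X.1 /\ der X Y.2 = der Y X.2.
Proof. by move=> e; split; apply: subr0_eq; [have := congr1 fst e|have := congr1 snd e]. Qed.

(** The Christoffel symbols are constant, and [Z] acts on them through a matrix with eigenvalues [l]
    and [- l], the square of [l] being [- de]. The symbols have three indices, so the weights of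
    this action are [l], [- l], [3 l] and [- 3 l], none of them zero, and invariance makes the
    symbols vanish. *)
Lemma coordinate_flat C Z (de : R) : de != 0 ->
  kil C (frame0 G) -> kil C (frame1 G) -> kil C Z -> evv Z = 0 ->
  br Z (frame0 G) = frame1 G -> br Z (frame1 G) = - de *v frame0 G -> flat_germ C.
Proof.
move=> de0 k0 k1 kZ z0 b0 b1.
have n00 : nab C (frame0 G) (frame0 G) = ch00 C by rewrite /nab /der; vring.
have n01 : nab C (frame0 G) (frame1 G) = ch01 C by rewrite /nab /der; vring.
have n10 : nab C (frame1 G) (frame0 G) = ch10 C by rewrite /nab /der; vring.
have n11 : nab C (frame1 G) (frame1 G) = ch11 C by rewrite /nab /der; vring.
have f01 : br (frame0 G) (frame1 G) = 0 by rewrite /br /der; vring.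
(* A field that commutes with both coordinate fields has constant components. *)
have const V : br (frame0 G) V = 0 -> br (frame1 G) V = 0 -> evv V = 0 -> V = 0.
  move=> e0 e1 [v1 v2].
  have c0 : der V 0 = 0 by rewrite /der !dE !mulr0 addr0.
  have c1 : der V 1 = 0 by rewrite /der !dE !mulr0 addr0.
  have [g1 g2] := br_eq0 e0; have [g3 g4] := br_eq0 e1.
  rewrite /= ?c0 ?c1 in g1 g2 g3 g4.
  by apply: vecP; apply: (der_eq0_frame (@wedge_frame _ G)).
have comm V i j : kil C V -> br V (frame0 G) = 0 -> br V (frame1 G) = 0 ->
    i \in [:: frame0 G; frame1 G] -> j \in [:: frame0 G; frame1 G] -> br V (nab C i j) = 0.
  move=> kV v0 v1 mi mj; rewrite (kilE _ _ kV).
  have vi : br V i = 0 by move: mi; rewrite !inE => /orP[] /eqP ->.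
  have vj : br V j = 0 by move: mj; rewrite !inE => /orP[] /eqP ->.
  by rewrite vi vj nab_zero_l nab_zero_r addr0.
have m0 : frame0 G \in [:: frame0 G; frame1 G] by rewrite !inE eqxx.
have m1 : frame1 G \in [:: frame0 G; frame1 G] by rewrite !inE eqxx orbT.
have f10 : br (frame1 G) (frame0 G) = 0 by rewrite br_anti f01 oppr0.
have chz i j : i \in [:: frame0 G; frame1 G] -> j \in [:: frame0 G; frame1 G] ->
    evv (nab C i j) = 0 -> nab C i j = 0.
  by move=> mi mj; apply: const; apply: comm; rewrite ?br_self.
have [e00 e01 e10 e11] : [/\ br Z (ch00 C) = ch10 C + ch01 C,
    br Z (ch01 C) = ch11 C - de *v ch00 C, br Z (ch10 C) = ch11 C - de *v ch00 C &
    br Z (ch11 C) = - (de *v (ch01 C + ch10 C))].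
  have nZ X Y := kilE X Y kZ; rewrite -!n00 -!n01 -!n10 -!n11 !nZ b0 b1.
  rewrite !nab_scale_l !nab_scale_r !derC.
  by move: (nab C (frame0 G) (frame0 G)) (nab C (frame0 G) (frame1 G))
    (nab C (frame1 G) (frame0 G)) (nab C (frame1 G) (frame1 G)) => *; split;
    rewrite ?rmorphN; vring.
have [z11 z12 z21 z22] : [/\ ev (d0 Z.1) = 0, ev (d1 Z.1) = de, ev (d0 Z.2) = - 1 & ev (d1 Z.2) = 0].
  have := congr1 fst b0; have := congr1 snd b0; have := congr1 fst b1; have := congr1 snd b1.
  rewrite /br /der /= ?dE => g4 g3 g2 g1.
  have {}g1 : d0 Z.1 = 0 by apply: oppr_inj; ring_from g1.
  have {}g2 : d0 Z.2 = - 1 by apply: oppr_inj; ring_from g2.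
  have {}g3 : d1 Z.1 = cst de by move: g3; rewrite rmorphN => g3; apply: oppr_inj; ring_from g3.
  have {}g4 : d1 Z.2 = 0 by apply: oppr_inj; ring_from g4.
  by rewrite g1 g2 g3 g4 rmorph0 rmorphN rmorph1 ga_evC.
have evZ V W : br Z V = W -> - (de * ev V.2) = ev W.1 /\ ev V.1 = ev W.2.
  move=> <-; have [-> ->] := evv_br V z0; rewrite z11 z12 z21 z22.
  by split; ring.
move: (evZ _ _ e00) (evZ _ _ e01) (evZ _ _ e10) (evZ _ _ e11) => /=.
rewrite !(rmorphD, rmorphN, rmorphM) !ga_evC => -[a1 a2] [a3 a4] [a5 a6] [a7 a8].
have a2' := congr1 ( *%R de) a2.
have p1 : ev (ch00 C).1 = 0 by apply: (mulfI de0); lra.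
have q2s : ev (ch11 C).2 = ev (ch01 C).1 + ev (ch10 C).1 by apply: (mulfI de0); lra.
have p2 : ev (ch00 C).2 = 0 by apply: (mulfI de0); lra.
have s2 : ev (ch01 C).2 = 0 by apply: (mulfI de0); lra.
have u2 : ev (ch10 C).2 = 0 by apply: (mulfI de0); lra.
move: a1 a2 a3 a4 a5 a6 a7 a8; rewrite p1 p2 s2 u2 => a1 a2 a3 a4 a5 a6 a7 a8.
have q1 : ev (ch11 C).1 = 0 by lra.
have s1 : ev (ch01 C).1 = 0 by lra.
have u1 : ev (ch10 C).1 = 0 by lra.
have q2 : ev (ch11 C).2 = 0 by lra.
have c00 := chz _ _ m0 m0; have c01 := chz _ _ m0 m1.
have c10 := chz _ _ m1 m0; have c11 := chz _ _ m1 m1.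
rewrite n00 /evv p1 p2 in c00; rewrite n01 /evv s1 s2 in c01.
rewrite n10 /evv u1 u2 in c10; rewrite n11 /evv q1 q2 in c11.
have {}c00 := c00 erefl; have {}c01 := c01 erefl.
have {}c10 := c10 erefl; have {}c11 := c11 erefl.
rewrite -n00 in c00; rewrite -n01 in c01; rewrite -n10 in c10; rewrite -n11 in c11.
by apply: (flat_germ_frame (@wedge_frame _ G));
  rewrite /tors /curv f01 ?c00 ?c01 ?c10 ?c11 ?nab_zero_l ?nab_zero_r !subr0.
Qed.

End ConstantCombinations.

(** * Invertible traceless isotropy *)

Section TracelessIsotropy.
Context {R : realType} (G : germ_algebra R).
Local Notation A := (ga_ring G).
Local Notation d0 := (ga_d0 (g := G)).
Local Notation d1 := (ga_d1 (g := G)).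
Local Notation ev := (ga_ev G).
Local Notation cst := (ga_cst G).
Local Notation vec := (A * A)%type.
Implicit Types (X Y Z W U V : vec) (f g x y : A) (r s : R) (C : christoffel G).

Local Notation "r *v X" := (vscale (cst r) X) (at level 40).

(* Two commuting Killing fields make the Christoffel symbols constant, and the
   remaining Killing field, an invertible traceless rotation or boost, leaves
   only zero Christoffel symbols. *)
Lemma commuting_flat C X Y Z (de : R) : de != 0 -> kil C X -> kil C Y -> kil C Z ->
  ev (wedge X Y) != 0 -> evv Z = 0 -> br X Y = 0 -> br Z X = Y -> br Z Y = - de *v X ->
  flat_germ C.
Proof.
move=> de0 kX kY kZ w0 z0 bXY bZX bZY; apply: (@flat_push _ _ X Y bXY w0).
pose F := frame_alg bXY w0; pose z := pull w0 Z.
have f0 : push X Y (frame0 F) = X by rewrite /push; vring.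
have f1 : push X Y (frame1 F) = Y by rewrite /push; vring.
apply: (@coordinate_flat R F _ z de de0); rewrite ?kil_push ?f0 ?f1 ?pullK//.
- have e : push X Y z = Z := pullK w0 Z.
  have e1 := congr1 fst e; have e2 := congr1 snd e; case: z0; rewrite -e1 -e2 => z1 z2.
  have [p q] : ev z.1 = 0 /\ ev z.2 = 0.
    apply: (frame_indep w0); move: z1 z2; rewrite /push /evv /= !rmorphD !rmorphM !ga_evC.
    by move=> -> ->.
  by rewrite /evv /= p q.
- by apply: (push_inj w0); rewrite push_br f0 f1 pullK.
- apply: (push_inj w0); rewrite push_br f1 pullK.
  by rewrite [RHS](@push_scale R G X Y (cst (- de))) f0.
Qed.

(** The curvature endomorphism at the origin is nonzero, traceless and commutes with the matrix of
    [Z], so by [fix_traceless] every isotropy matrix is proportional to that of [Z]. *)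
Lemma traceless_case C Z : kil_frame C -> nonflat C -> isot C Z ->
  ev (d0 Z.1) + ev (d1 Z.2) = 0 ->
  ev (d0 Z.1) * ev (d1 Z.2) - ev (d1 Z.1) * ev (d0 Z.2) != 0 ->
  exists e1 e2 e3 al be ga, simple_basis C e1 e2 e3 al be ga.
Proof.
move=> tC nf iZ tr det; have [kZ z0] := iZ.
have [[t1 t2] rZ] := isot_fix iZ.
pose a := ev (d0 Z.1); pose b := ev (d1 Z.1); pose c := ev (d0 Z.2); pose d := ev (d1 Z.2).
rewrite -/a -/b -/c -/d in tr det t1 t2 rZ.
have cramer (u v : R) : a * u + b * v = 0 -> c * u + d * v = 0 -> u = 0 /\ v = 0.
  by rewrite ![_ * u]mulrC ![_ * v]mulrC; apply: linear_system2; rewrite [c * b]mulrC.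
have cramerT (u v : R) : a * u + c * v = 0 -> b * u + d * v = 0 -> u = 0 /\ v = 0.
  by rewrite ![_ * u]mulrC ![_ * v]mulrC; apply: linear_system2.
have tau0 : evv (tau C) = 0.
  have c1 : a * ev (tau C).1 + b * ev (tau C).2 = 0 by move: t1; rewrite tr mul0r; lra.
  have c2 : c * ev (tau C).1 + d * ev (tau C).2 = 0 by move: t2; rewrite tr mul0r; lra.
  by rewrite /evv; have [-> ->] := cramer _ _ c1 c2.
(* The value of the covector [mu] is killed by the transpose of an invertible matrix. *)
have ctr0 : ev (ctr C) = 0.
  have dz : ev (diver Z) = 0 by rewrite rmorphD.
  have [m0 m1] := isot_mu iZ dz; have [M0 M1] := cramerT _ _ m0 m1.
  by have [X [Y [kX kY w0]]] := tC; exact: (ctr_vanish kX kY w0).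
have r4E : ev (rho C (frame1 G)).2 = - ev (rho C (frame0 G)).1.
  by move: ctr0; rewrite rmorphD => /eqP; rewrite addrC addr_eq0 => /eqP.
have isotZ N : isot C N -> exists t, N = t *v Z.
  move=> iN; have [_ rN] := isot_fix iN.
  have nr : ~ (ev (rho C (frame0 G)).1 = 0 /\ ev (rho C (frame0 G)).2 = 0 /\
               ev (rho C (frame1 G)).1 = 0).
    move=> [r1 [r2 r3]]; apply: (nonflat_ev tC nf tau0); rewrite /evv.
      by rewrite r1 r2.
    by rewrite r4E r1 r3 oppr0.
  have [t [h1 h2 h3 h4]] := fix_traceless tr det r4E nr rZ rN.
  by exists t; apply: (isot_eq iN (isot_cst _ iZ)); rewrite jetZ /jet h1 h2 h3 h4.
have dNa : d = - a by lra.
have [u [ku q0]] : exists u, kil C u /\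
   ev u.1 * (c * ev u.1 + d * ev u.2) - ev u.2 * (a * ev u.1 + b * ev u.2) != 0.
  apply: (kil_noneigen tC) => -[b0 [c0 ad]]; move/eqP: det; apply.
  have a0 : a = 0 by lra.
  by rewrite a0 b0 !mul0r subrr.
(* Brackets with [Z] forget the component of [u] along [Z]; by Cayley-Hamilton, bracketing twice
   multiplies values at the origin by [- de]. *)
pose X := br Z u; pose Y := br Z X; pose de := a * d - b * c.
have kX : kil C X := kil_br kZ ku; have kY : kil C Y := kil_br kZ kX.
have [X1 X2] : ev X.1 = - (a * ev u.1 + b * ev u.2) /\ ev X.2 = - (c * ev u.1 + d * ev u.2).
  by have [-> ->] := evv_br u z0.
have [Y1 Y2] : ev Y.1 = - de * ev u.1 /\ ev Y.2 = - de * ev u.2.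
  have [-> ->] := evv_br X z0; rewrite -/a -/b -/c -/d X1 X2 /de dNa.
  by split; ring.
have wXY : ev (wedge X Y) != 0.
  rewrite /wedge rmorphB !rmorphM X1 X2 Y1 Y2.
  set q := _ - _ in q0; rewrite (_ : _ - _ = - de * q); last by rewrite /q; ring.
  by rewrite mulf_neq0// oppr_eq0.
(* [Y + de u] vanishes at the origin, hence is a multiple of [Z] and commutes with it. *)
have bZY : br Z Y = - de *v X.
  have [e eE] : exists e, Y + de *v u = e *v Z.
    apply: isotZ; split; first by apply: kil_add => //; exact: kil_cst.
    by rewrite evvD evvZ /evv Y1 Y2; congr (_, _); rewrite /=; ring.
  have := congr1 (br Z) eE; rewrite br_add_r !br_cst_r br_self vscaler0 -/X => /eqP.
  by rewrite addr_eq0 vcstN => /eqP.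
(* [[X, Y]] commutes with [Z], so its value at the origin is killed by an invertible matrix. *)
have [k bXY] : exists k, br X Y = k *v Z.
  apply: isotZ; split; first exact: kil_br.
  have b0 : br Z (br X Y) = 0.
    by rewrite jacobi -/Y bZY br_self br_cst_r br_self vscaler0 addr0.
  have [e1 e2] : evv (br Z (br X Y)) = 0 by rewrite b0 /evv !rmorph0.
  have := evv_br (br X Y) z0; rewrite /evv e1 e2 -/a -/b -/c -/d => -[/esym/eqP + /esym/eqP].
  by rewrite !oppr_eq0 => /eqP f1 /eqP f2; have [-> ->] := cramer _ _ f1 f2.
have k0 : k != 0.
  apply/eqP => k0; apply: nf; apply: (@commuting_flat C X Y Z de) => //.
  by rewrite bXY k0 vcst0.
have Z0 : Z <> 0.
  by move=> Z0; move: det; rewrite /a /b /c /d Z0 /= !dE !rmorph0 !mul0r subrr eqxx.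
exists Z, X, Y, k, de, 1; split.
- by split.
- by split=> //; exact: oner_neq0.
- by split; [rewrite vcst1| |rewrite br_anti bZY vcstN opprK].
- move=> p q r e; have e' : q *v X + r *v Y + p *v Z = 0 by rewrite -e addrC addrA.
  by have [q1 r1 p1] := frame_isot_indep wXY z0 Z0 e'.
move=> V kV; have [q [r iV]] := kil_decomp kX kY wXY kV.
have [p pE] := isotZ _ iV; exists p, q, r; rewrite -addrA -pE.
by rewrite subrK.
Qed.

End TracelessIsotropy.

(** * The model connections *)

Section OdeExists.
Context {R : realType}.
Implicit Types (al be a b m t : R).

Lemma ode_of_derive al be (h h1 : R -> R) : (forall t, is_derive t (1 : R) h (h1 t)) ->
  (forall t, is_derive t (1 : R) h1 (- al * h1 t - be * h t)) ->
  ode_solution al be h /\ h^`()%classic = h1.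
Proof.
move=> D D1.
have e : h^`()%classic = h1.
  by apply/funext => t; exact: (etrans (derive1E h t) (@derive_val _ _ _ _ _ _ _ (D t))).
split=> // t; split; first exact: (@ex_derive _ _ _ _ _ _ _ (D t)).
  by rewrite e; exact: (@ex_derive _ _ _ _ _ _ _ (D1 t)).
have e2 : h^`(2)%classic t = - al * h1 t - be * h t.
  have -> : h^`(2)%classic = h1^`()%classic by rewrite -e.
  exact: (etrans (derive1E h1 t) (@derive_val _ _ _ _ _ _ _ (D1 t))).
by rewrite e2 e; ring.
Qed.

Lemma is_derive_mulR1 m t : is_derive t (1 : R) (fun t => m * t) m.
Proof.
by have := @is_deriveZ R R R id m t 1 _ (is_derive_id t 1); rewrite /GRing.scale /= mulr1.
Qed.

Lemma is_derive_expM m t : is_derive t (1 : R) (fun t => expR (m * t)) (m * expR (m * t)).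
Proof.
have D := is_derive_mulR1 m t.
by have := @is_derive1_comp R expR (fun t => m * t) t _ _ (is_derive_expR _) D; rewrite mulrC.
Qed.

Lemma is_derive_cosM m t : is_derive t (1 : R) (fun t => cos (m * t)) (- (m * sin (m * t))).
Proof.
have D := is_derive_mulR1 m t.
have := @is_derive1_comp R cos (fun t => m * t) t _ _ (is_derive_cos _) D.
by rewrite mulrC mulrN.
Qed.

Lemma is_derive_sinM m t : is_derive t (1 : R) (fun t => sin (m * t)) (m * cos (m * t)).
Proof.
have D := is_derive_mulR1 m t.
by have := @is_derive1_comp R sin (fun t => m * t) t _ _ (is_derive_sin _) D; rewrite mulrC.
Qed.

Lemma is_derive_addR (f g : R -> R) f' g' t : is_derive t (1 : R) f f' ->
  is_derive t (1 : R) g g' -> is_derive t (1 : R) (fun t => f t + g t) (f' + g').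
Proof. by move=> ? ?; exact: is_deriveD. Qed.

Lemma is_derive_mulR (f g : R -> R) f' g' t : is_derive t (1 : R) f f' ->
  is_derive t (1 : R) g g' -> is_derive t (1 : R) (fun t => f t * g t) (f' * g t + f t * g').
Proof.
move=> Df Dg; have := @is_deriveM R R f g t 1 _ _ Df Dg.
by rewrite addrC /GRing.scale /= [g t * _]mulrC.
Qed.

Lemma is_derive_scaleR (f : R -> R) f' c t : is_derive t (1 : R) f f' ->
  is_derive t (1 : R) (fun t => c * f t) (c * f').
Proof. by move=> Df; exact: is_deriveZ. Qed.

Lemma spring_exists (de a b : R) : exists k k1 : R -> R,
  [/\ forall t, is_derive t (1 : R) k (k1 t), forall t, is_derive t (1 : R) k1 (de * k t),
      k 0 = a & k1 0 = b].
Proof.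
have [de0|de0|->] := ltgtP de 0.
- pose w := Num.sqrt (- de); have w0 : w != 0 by rewrite sqrtr_eq0 -ltNge oppr_gt0.
  have w2 : w * w = - de by rewrite -expr2 sqr_sqrtr// oppr_ge0 ltW.
  exists (fun t => a * cos (w * t) + b / w * sin (w * t)).
  exists (fun t => b * cos (w * t) + (- (a * w)) * sin (w * t)).
  split=> [t|t||].
  + apply: (is_derive_eq (is_derive_addR (is_derive_scaleR _ (is_derive_cosM w t))
      (is_derive_scaleR _ (is_derive_sinM w t)))).
    by field.
  + apply: (is_derive_eq (is_derive_addR (is_derive_scaleR _ (is_derive_cosM w t))
      (is_derive_scaleR _ (is_derive_sinM w t)))).
    rewrite (_ : de = - (w * w)); last by rewrite w2 opprK.
    by field.
  + by rewrite mulr0 cos0 sin0; ring.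
  + by rewrite mulr0 cos0 sin0; ring.
- pose w := Num.sqrt de; have w0 : w != 0 by rewrite sqrtr_eq0 -ltNge.
  have w2 : w * w = de by rewrite -expr2 sqr_sqrtr// ltW.
  exists (fun t => (a + b / w) / 2 * expR (w * t) + (a - b / w) / 2 * expR (- w * t)).
  exists (fun t => (a * w + b) / 2 * expR (w * t) + (- (a * w - b) / 2) * expR (- w * t)).
  split=> [t|t||].
  + apply: (is_derive_eq (is_derive_addR (is_derive_scaleR _ (is_derive_expM w t))
      (is_derive_scaleR _ (is_derive_expM (- w) t)))).
    by field.
  + apply: (is_derive_eq (is_derive_addR (is_derive_scaleR _ (is_derive_expM w t))
      (is_derive_scaleR _ (is_derive_expM (- w) t)))).
    by rewrite -w2; field.
  + by rewrite !mulr0 expR0; field.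
  + by rewrite !mulr0 expR0; field.
exists (fun t => a + b * t), (fun=> b); split=> [t|t||].
- by apply: (is_derive_eq (is_derive_addR (is_derive_cst a t 1) (is_derive_mulR1 b t))); rewrite add0r.
- by rewrite mul0r; exact: is_derive_cst.
- by rewrite mulr0 addr0.
- by [].
Qed.

(** For [h = exp(m t) k] with [m = - al / 2] the first-order term disappears, and
    [k'' = (m * m - be) k] remains. *)
Lemma ode_exists al be a b : exists h, [/\ ode_solution al be h, h 0 = a & h^`()%classic 0 = b].
Proof.
pose m := - al / 2; have [k [k1 [D D1 k0 k10]]] := spring_exists (m * m - be) a (b - m * a).
have [] := @ode_of_derive al be (fun t => expR (m * t) * k t)
  (fun t => expR (m * t) * (m * k t + k1 t)).
- move=> t; apply: (is_derive_eq (is_derive_mulR (is_derive_expM m t) (D t))).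
  by ring.
- move=> t; apply: (is_derive_eq (is_derive_mulR (is_derive_expM m t)
    (is_derive_addR (is_derive_scaleR m (D t)) (D1 t)))).
  by rewrite (_ : al = - (2 * m)); [ring|rewrite /m; field].
move=> s e; exists (fun t => expR (m * t) * k t); split=> //.
  by rewrite mulr0 expR0 k0 mul1r.
by rewrite e mulr0 expR0 k0 k10; ring.
Qed.

End OdeExists.

(** * Connections with horizontal Killing fields *)

Section Model.
Context {R : realType} (G : germ_algebra R).
Local Notation A := (ga_ring G).
Local Notation d0 := (ga_d0 (g := G)).
Local Notation d1 := (ga_d1 (g := G)).
Local Notation ev := (ga_ev G).
Local Notation cst := (ga_cst G).
Local Notation vec := (A * A)%type.
Implicit Types (X Y Z W U V : vec) (f g x y : A) (r s : R) (C : christoffel G).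

(** The hypothesis on [u] means [u = s x + f(y)], which covers [h(y) d/dx] with [s = 0], and
    [x d/dx] and [(x + f(y)) d/dx] with [s = 1]. *)
Lemma kil_horizontal (a b c d c' d' e g u : A) s : d0 u = cst s ->
  kil (Christoffel (a, b) (c, d) (c', d') (e, g)) (u, 0) <->
  [/\ u * d0 a + cst s * a - b * d1 u = 0 /\ u * d0 b + 2%:R * cst s * b = 0,
      u * d0 c + d1 u * (a - d) = 0 /\ u * d0 d + cst s * d + d1 u * b = 0,
      u * d0 c' + d1 u * (a - d') = 0 /\ u * d0 d' + cst s * d' + d1 u * b = 0 &
      u * d0 e - cst s * e - g * d1 u + d1 u * (c + c') + d1 (d1 u) = 0 /\
      u * d0 g + d1 u * (d + d') = 0].
Proof.
move=> u0; have u01 : d0 (d1 u) = 0 by rewrite ga_dC u0 ga_d1C.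
set C := Christoffel _ _ _ _.
have e00 : lie_nab C (u, 0) (frame0 G) (frame0 G) =
    (u * d0 a + cst s * a - b * d1 u, u * d0 b + 2%:R * cst s * b).
  by rewrite /lie_nab /nab /br /der; apply: vecP; rewrite /= ?dE ?u01 ?u0 ?dE; ring.
have e01 : lie_nab C (u, 0) (frame0 G) (frame1 G) =
    (u * d0 c + d1 u * (a - d), u * d0 d + cst s * d + d1 u * b).
  by rewrite /lie_nab /nab /br /der; apply: vecP; rewrite /= ?dE ?u01 ?u0 ?dE; ring.
have e10 : lie_nab C (u, 0) (frame1 G) (frame0 G) =
    (u * d0 c' + d1 u * (a - d'), u * d0 d' + cst s * d' + d1 u * b).
  by rewrite /lie_nab /nab /br /der; apply: vecP; rewrite /= ?dE ?u01 ?u0 ?dE; ring.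
have e11 : lie_nab C (u, 0) (frame1 G) (frame1 G) =
    (u * d0 e - cst s * e - g * d1 u + d1 u * (c + c') + d1 (d1 u),
     u * d0 g + d1 u * (d + d')).
  by rewrite /lie_nab /nab /br /der; apply: vecP; rewrite /= ?dE ?u01 ?u0 ?dE; ring.
split=> [/kilP[]|[[f1 f2] [f3 f4] [f5 f6] [f7 f8]]].
  by rewrite e00 e01 e10 e11 => -[f1 f2] [f3 f4] [f5 f6] [f7 f8].
by apply/kilP; rewrite e00 e01 e10 e11 f1 f2 f3 f4 f5 f6 f7 f8.
Qed.

Lemma kil_coordinate C : kil C (frame1 G) ->
  [/\ d1 (ch00 C).1 = 0 /\ d1 (ch00 C).2 = 0, d1 (ch01 C).1 = 0 /\ d1 (ch01 C).2 = 0,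
      d1 (ch10 C).1 = 0 /\ d1 (ch10 C).2 = 0 & d1 (ch11 C).1 = 0 /\ d1 (ch11 C).2 = 0].
Proof.
case: C => [[a b] [c d] [c' d'] [e g]] /kilP; set C := Christoffel _ _ _ _.
have e00 : lie_nab C (frame1 G) (frame0 G) (frame0 G) = (d1 a, d1 b).
  by rewrite /lie_nab /nab /br /der; vring.
have e01 : lie_nab C (frame1 G) (frame0 G) (frame1 G) = (d1 c, d1 d).
  by rewrite /lie_nab /nab /br /der; vring.
have e10 : lie_nab C (frame1 G) (frame1 G) (frame0 G) = (d1 c', d1 d').
  by rewrite /lie_nab /nab /br /der; vring.
have e11 : lie_nab C (frame1 G) (frame1 G) (frame1 G) = (d1 e, d1 g).
  by rewrite /lie_nab /nab /br /der; vring.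
by rewrite e00 e01 e10 e11 => -[[? ?] [? ?] [? ?] [? ?]].
Qed.

Lemma d_constant f : d0 f = 0 -> d1 f = 0 -> f = cst (ev f).
Proof.
by move=> f0 f1; apply: (constant_frame (@wedge_frame _ G)); rewrite /der ?f0 ?f1; ring.
Qed.

(** The normal form reached in [model_connection], where moreover [e] is a constant minus [r] times
    the first coordinate. *)
Definition model_chr (c c' g : R) (e : A) : christoffel G :=
  Christoffel (0, 0) (cst c, 0) (cst c', 0) (e, cst g).

Lemma kil_model (c c' g r s : R) e u : d0 e = - cst r -> d0 u = cst s ->
  d1 (d1 u) + cst (c + c' - g) * d1 u = cst r * u + cst s * e -> kil (model_chr c c' g e) (u, 0).
Proof.
move=> e0 u0 eq; apply/(kil_horizontal _ _ _ _ _ _ _ _ u0).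
rewrite !ga_d0C e0 d00; move: eq; rewrite rmorphB rmorphD => eq.
split; split; try ring.
by ring_from eq.
Qed.

(** Once the second derivative is eliminated, each Killing equation for [h d/dx] is linear in [h]
    and its derivative, with the same coefficients for [h1] and [h2]; a unit Wronskian makes both
    coefficients vanish. *)
Lemma model_connection C h1 h2 p r : kil C (frame1 G) -> kil C (h1, 0) -> kil C (h2, 0) ->
  d0 h1 = 0 -> d0 h2 = 0 -> d1 h1 = - (cst p * h1 + cst r * h2) -> d1 h2 = - h1 ->
  ev h1 = 1 -> ev h2 = 0 ->
  exists (c c' g : R) e, [/\ C = model_chr c c' g e, d0 e = - cst r, d1 e = 0 & p = c + c' - g].
Proof.
move=> k1 kh1 kh2 h10 h20 h11 h21 v1 v2; have := kil_coordinate k1.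
case: C k1 kh1 kh2 => [[a b] [c d] [c' d'] [e g]] _ kh1 kh2 /= [[ya yb] [yc yd] [yc' yd'] [ye yg]].
have c0 h : d0 h = 0 -> d0 h = cst 0 by rewrite rmorph0.
move/(kil_horizontal _ _ _ _ _ _ _ _ (c0 _ h10)): kh1.
move/(kil_horizontal _ _ _ _ _ _ _ _ (c0 _ h20)): kh2.
rewrite !rmorph0 !mulr0 !mul0r !addr0 !subr0.
rewrite h21 d1N h11 => -[[f1 f2] [f3 f4] [f5 f6] [f7 f8]] [[g1 g2] [g3 g4] [g5 g6] [g7 g8]].
have [i1 hi1] : exists i, h1 * i = 1 by apply: ga_inv; rewrite v1 oner_neq0.
(* The Wronskian of h1 and h2 is a unit. *)
pose P := cst p * h1 + cst r * h2; pose w := h1 * h1 - h2 * P.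
have w0 : ev w != 0.
  by rewrite /w rmorphB !rmorphM v1 v2 mul0r mulr1 subr0 oner_neq0.
have wP q q' : h1 * q + P * q' = 0 -> h2 * q + h1 * q' = 0 -> q = 0 /\ q' = 0.
  move=> r1 r2; split; apply: (unit_cancel w0).
    have -> : w * q = h1 * (h1 * q + P * q') - P * (h2 * q + h1 * q') by rewrite /w; ring.
    by rewrite r1 r2; ring.
  have -> : w * q' = h1 * (h2 * q + h1 * q') - h2 * (h1 * q + P * q') by rewrite /w; ring.
  by rewrite r1 r2; ring.
have [xa b0] : d0 a = 0 /\ b = 0 by apply: wP; rewrite /P; [ring_from g1|ring_from f1].
have [xc ad] : d0 c = 0 /\ - (a - d) = 0 by apply: wP; rewrite /P; [ring_from g3|ring_from f3].
have [xd _] : d0 d = 0 /\ - b = 0 by apply: wP; rewrite /P; [ring_from g4|ring_from f4].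
have [xc' ad'] : d0 c' = 0 /\ - (a - d') = 0 by apply: wP; rewrite /P; [ring_from g5|ring_from f5].
have [xd' _] : d0 d' = 0 /\ - b = 0 by apply: wP; rewrite /P; [ring_from g6|ring_from f6].
have [xe pe] : d0 e + cst r = 0 /\ g - c - c' + cst p = 0.
  apply: wP; rewrite /P.
    by move: g7; rewrite !dE h11 h21 => g7; ring_from g7.
  by ring_from f7.
have [xg dd'] : d0 g = 0 /\ - (d + d') = 0 by apply: wP; rewrite /P; [ring_from g8|ring_from f8].
have a0 : a = 0.
  have n2 : ev 2%:R != 0 by rewrite rmorph_nat pnatr_eq0.
  apply: (unit_cancel n2); rewrite (_ : _ * a = - ((- (a - d)) + (- (a - d')) + (- (d + d')))); last by ring.
  by rewrite ad ad' dd'; ring.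
have d0' : d = 0 by move: ad; rewrite a0 sub0r opprK.
have d'0 : d' = 0 by move: ad'; rewrite a0 sub0r opprK.
exists (ev c), (ev c'), (ev g), e; split=> //.
- by rewrite /model_chr -(d_constant xc yc) -(d_constant xc' yc') -(d_constant xg yg) a0 b0 d0' d'0.
- by apply/eqP; rewrite -addr_eq0 xe.
have := congr1 ev pe; rewrite rmorphD !rmorphB ga_evC rmorph0.
by move: (ev c) (ev c') (ev g) => *; lra.
Qed.
End Model.

Section ModelFields.
Context {R : realType} (G : germ_algebra R).
Local Notation A := (ga_ring G).
Local Notation d0 := (ga_d0 (g := G)).
Local Notation d1 := (ga_d1 (g := G)).
Local Notation ev := (ga_ev G).
Local Notation cst := (ga_cst G).
Local Notation vec := (A * A)%type.
Implicit Types (X Y Z W U V : vec) (f g x y : A) (r s : R) (C : christoffel G).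

Local Notation "r *v X" := (vscale (cst r) X) (at level 40).

Lemma d0_comp al be (h : R -> R) y : ode_solution al be h -> d0 y = 0 -> d0 (ga_comp h y) = 0.
Proof. by move=> hs y0; rewrite (ga_d0comp _ hs) y0 mulr0. Qed.

Lemma d1_comp al be (h : R -> R) y : ode_solution al be h -> d1 y = 1 ->
  d1 (ga_comp h y) = ga_comp h^`()%classic y.
Proof. by move=> hs y1; rewrite (ga_d1comp _ hs) y1 mulr1. Qed.

Lemma kil_comp (c c' g r : R) e y (h : R -> R) : d0 e = - cst r -> d0 y = 0 -> d1 y = 1 ->
  ode_solution (c + c' - g) (- r) h -> kil (model_chr c c' g e) (ga_comp h y, 0).
Proof.
move=> e0 y0 y1 hs; apply: (@kil_model _ _ _ _ _ r 0) => //.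
  by rewrite rmorph0; exact: (d0_comp hs).
rewrite (d1_comp hs y1) (d1_comp (ode_solution_derive hs) y1) rmorph0 mul0r addr0.
have := ga_compode y hs; rewrite rmorphN mulNr => eq.
change (ga_comp h^`(2)%classic y + cst (c + c' - g) * ga_comp h^`()%classic y = cst r * ga_comp h y).
by ring_from eq.
Qed.

Lemma coordinates_exist : exists x y, [/\ d0 x = 1, d1 x = 0 & ev x = 0] /\ [/\ d0 y = 0, d1 y = 1 & ev y = 0].
Proof.
have [x xP] := @ga_poincare _ G 1 0 (etrans (d11 _) (esym (d00 _))).
have [y yP] := @ga_poincare _ G 0 1 (etrans (d10 _) (esym (d01 _))).
by exists x, y.
Qed.

Lemma nil_contradiction C h1 h2 p r : kil C (frame1 G) -> kil C (h1, 0) -> kil C (h2, 0) ->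
  d0 h1 = 0 -> d0 h2 = 0 -> d1 h1 = - (cst p * h1 + cst r * h2) -> d1 h2 = - h1 ->
  ev h1 = 1 -> ev h2 = 0 ->
  (forall u, kil C (u, 0) -> exists a b, u = cst a * h1 + cst b * h2) -> False.
Proof.
move=> k1 kh1 kh2 h10 h20 h11 h21 v1 v2 span.
have [c [c' [g [e [CE e0 e1 pE]]]]] := model_connection k1 kh1 kh2 h10 h20 h11 h21 v1 v2.
have [x [y [[x0 x1 _] [y0 y1 _]]]] := coordinates_exist.
have eE : e = cst (ev (e + cst r * x)) - cst r * x.
  rewrite -d_constant ?addrK// !dE ?e0 ?e1 ?x0 ?x1; ring.
move: (ev _) eE => ep eE.
(* [(x + f) d/dx] is Killing as soon as [f'' + p f' = r f + ep]; a constant, linear or quadratic [f]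
   in [y] solves this, according to which of [r] and [p] vanish. *)
have [f [f0 fE]] : exists f, d0 f = 0 /\ d1 (d1 f) + cst p * d1 f = cst r * f + cst ep.
  have [r0|r0] := eqVneq r 0; last first.
    exists (cst (- ep / r)); rewrite !dE; split=> //.
    by rewrite -rmorphM mulr0 add0r -rmorphD (_ : _ + _ = 0) ?rmorph0//; field.
  have [p0|p0] := eqVneq p 0; last first.
    have pp : cst p * cst (ep / p) = cst ep.
      by rewrite -rmorphM (_ : p * _ = ep)//; field.
    exists (cst (ep / p) * y); rewrite !dE ?y0 ?y1 ?dE ?d11 r0 ?rmorph0 -pp; split; ring.
  have hh : cst (ep / 2%:R) + cst (ep / 2%:R) = cst ep.
    by rewrite -rmorphD (_ : _ + _ = ep)//; field.
  exists (cst (ep / 2%:R) * (y * y)); rewrite !dE ?y0 ?y1 ?dE ?y1 p0 r0 ?rmorph0 -hh; split; ring.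
have kxf : kil C (x + f, 0).
  rewrite CE; apply: (@kil_model _ _ _ _ _ r 1) => //.
    by rewrite !dE x0 f0 addr0 rmorph1.
  rewrite !dE x1 !dE -pE rmorph1 mul1r eE; ring_from fE.
have [a [b uE]] := span _ kxf.
have := congr1 d0 uE; rewrite !dE x0 f0 h10 h20 !mulr0 !mul0r !addr0 => /(congr1 ev).
by rewrite rmorph1 rmorph0 => /eqP; rewrite oner_eq0.
Qed.

(** The three fields force [a], [b], [d], [d'] and [e] to vanish and the other symbols to be
    constant. Then [h(y) d/dx] is Killing for every solution of [h'' + (c + c' - g) h' = 0], and the
    solution with [h'(0) = 1] is outside the assumed span. *)
Lemma idem_contradiction C x : kil C (frame0 G) -> kil C (frame1 G) -> kil C (x, 0) ->
  d0 x = 1 -> d1 x = 0 ->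
  (forall u, kil C (u, 0) -> exists a b, u = cst a + cst b * x) -> False.
Proof.
move=> k0 k1 kx x0 x1 span; have := kil_coordinate k1.
case: C k0 k1 kx span => [[a b] [c d] [c' d'] [e g]] k0 _ kx span /= [[ya yb] [yc yd] [yc' yd'] [ye yg]].
have one0 : d0 (1 : A) = cst 0 by rewrite d01 rmorph0.
have x0' : d0 x = cst 1 by rewrite x0 rmorph1.
move/(kil_horizontal _ _ _ _ _ _ _ _ one0): k0; move/(kil_horizontal _ _ _ _ _ _ _ _ x0'): kx.
rewrite x1 d11 d10 rmorph0 rmorph1 !mulr0 !mul0r !addr0 !subr0 !mul1r.
move=> [[f1 f2] [f3 f4] [f5 f6] [f7 f8]] [[g1 g2] [g3 g4] [g5 g6] [g7 g8]].
have a0 : a = 0 by move: f1; rewrite g1 mulr0 add0r.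
have b0 : b = 0.
  have n2 : ev 2%:R != 0 by rewrite rmorph_nat pnatr_eq0.
  by apply: (unit_cancel n2); move: f2; rewrite g2 mulr0 add0r mulr1.
have z1 : d = 0 by move: f4; rewrite g4 mulr0 add0r.
have z2 : d' = 0 by move: f6; rewrite g6 mulr0 add0r.
have z3 : e = 0 by move: f7; rewrite g7 mulr0 sub0r => /eqP; rewrite oppr_eq0 => /eqP.
have [X0 [y [_ [y0 y1 y2]]]] := coordinates_exist.
have [h [hs h0 h1]] := ode_exists (ev c + ev c' - ev g) 0 0 1.
have kh : kil (Christoffel (a, b) (c, d) (c', d') (e, g)) (ga_comp h y, 0).
  rewrite a0 b0 z1 z2 z3 (d_constant g3 yc) (d_constant g5 yc') (d_constant g8 yg).
  apply: (@kil_comp (ev c) (ev c') (ev g) 0) => //; first by rewrite d00 rmorph0 oppr0.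
  by rewrite oppr0.
have [al [be uE]] := span _ kh.
have be0 : be = 0.
  have := congr1 d0 uE; rewrite (d0_comp hs y0) !dE x0 mulr1 mul0r !add0r => /esym.
  exact: cst_eq0.
have := congr1 d1 uE; rewrite be0 rmorph0 mul0r addr0 ga_d1C (d1_comp hs y1) => /(congr1 ev).
by rewrite (ga_evcomp _ (ode_solution_derive hs)) y2 h1 rmorph0 => /eqP; rewrite oner_eq0.
Qed.

(** A Killing field [h(y) d/dx] and a combination of [h1 d/dx] and [h2 d/dx] with the same 1-jet
    coincide, so the solutions of the equation account for both generators. *)
Lemma model_span C h1 h2 x p r : kil C (frame1 G) -> kil C (h1, 0) -> kil C (h2, 0) ->
  d0 h1 = 0 -> d0 h2 = 0 -> d1 h1 = - (cst p * h1 + cst r * h2) -> d1 h2 = - h1 ->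
  ev h1 = 1 -> ev h2 = 0 -> kil C (x, 0) ->
  (forall V, kil C V -> exists a b c d, V = (cst a * h1 + cst b * h2 + cst c * x, cst d)) ->
  exists y, [/\ d0 y = 0, d1 y = 1, ev y = 0 & forall V, kil C V <->
    exists a b h, ode_solution p (- r) h /\ V = (cst a * x + ga_comp h y, cst b)].
Proof.
move=> k1 kh1 kh2 h10 h20 h11 h21 v1 v2 kx span.
have [c [c' [g [e [CE e0 e1 pE]]]]] := model_connection k1 kh1 kh2 h10 h20 h11 h21 v1 v2.
have [_ [y [_ [y0 y1 y2]]]] := coordinates_exist; exists y; split=> // V.
have kcomp h : ode_solution p (- r) h -> kil C (ga_comp h y, 0).
  by rewrite CE pE; exact: kil_comp.
split=> [kV|[a [b [h [hs ->]]]]].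
  have [a [b [s [t VE]]]] := span _ kV.
  (* The initial values of [a h1 + b h2], by the equations for [d1 h1] and [d1 h2]. *)
  have [h [hs hv hd]] := ode_exists p (- r) a (- (a * p) - b).
  exists s, t, h; split; first exact: hs.
  suff hE : ga_comp h y - (cst a * h1 + cst b * h2) = 0.
    by rewrite VE (subr0_eq hE) addrC.
  set u := _ - _; suff : (u, 0 : A) = 0 by case.
  have uE : (u, 0 : A) = (ga_comp h y, 0) + (- (a *v (h1, 0)) - (b *v (h2, 0))).
    by rewrite /u; vring.
  have ev0 : evv (u, 0 : A) = 0.
    rewrite /evv /= rmorph0 /u rmorphB rmorphD !rmorphM !ga_evC (ga_evcomp _ hs) y2 hv v1 v2.
    by rewrite mulr1 mulr0 addr0 subrr.
  apply: (@kil_jet0 _ _ C _ _ ev0).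
    by rewrite uE; apply: kil_add; [exact: kcomp|apply: kil_add; apply/kil_opp/kil_cst].
  rewrite /jet /= d00 d10 rmorph0 /u !dE (d0_comp hs y0) (d1_comp hs y1) h10 h20 h11 h21.
  rewrite !rmorphD !rmorphN !rmorphD !rmorphM !rmorphN !rmorphD !rmorphM !ga_evC.
  rewrite (ga_evcomp _ (ode_solution_derive hs)) y2 hd v1 v2 !rmorph0.
  by congr (_, _, _, _); ring.
rewrite (_ : (_, _) = a *v (x, 0) + ((ga_comp h y, 0) + b *v (frame1 G))); last by vring.
by apply: kil_add; [exact: kil_cst|apply: kil_add; [exact: kcomp|exact: kil_cst]].
Qed.

End ModelFields.

(** * Coordinates adapted to a nilpotent isotropy field *)

Section NilpotentFrame.
Context {R : realType} (G : germ_algebra R).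
Local Notation A := (ga_ring G).
Local Notation ev := (ga_ev G).
Local Notation cst := (ga_cst G).
Local Notation vec := (A * A)%type.
Implicit Types (X Y Z W U V : vec) (f g x y : A) (r s : R) (C : christoffel G).

Local Notation "r *v X" := (vscale (cst r) X) (at level 40).

Lemma frame_indep_fun X Y f g : ev (wedge X Y) != 0 -> vscale f X + vscale g Y = 0 -> f = 0 /\ g = 0.
Proof. by move=> w0 e; have [] := push_eq0 w0 (e : push X Y (f, g) = 0). Qed.

(* N = f X, and D is the multiple of X which commutes with Y. *)
Lemma nilpotent_frame X Y N p r : ev (wedge X Y) != 0 -> evv N = 0 -> br N Y = X -> br N X = 0 ->
  br X Y = p *v X + r *v N ->
  exists D h1 h2, [/\ [/\ br D Y = 0, ev (wedge D Y) != 0, X = vscale h1 D & N = vscale h2 D],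
    der D h1 = 0 /\ der D h2 = 0,
    der Y h1 = - (cst p * h1 + cst r * h2) /\ der Y h2 = - h1 & ev h1 = 1 /\ ev h2 = 0].
Proof.
move=> w0 n0 bNY bNX bXY; have [f [g NE]] := frame_decomp N w0.
have [f0 g0] : ev f = 0 /\ ev g = 0.
  apply: (frame_indep w0); rewrite -n0 NE /evv /= !rmorphD !rmorphM !ga_evC //.
have bNY' : br (vscale f X + vscale g Y) Y - X = 0 by rewrite -NE bNY subrr.
have bNX' : br (vscale f X + vscale g Y) X = 0 by rewrite -NE.
have bXY' : br X Y = p *v X + r *v (vscale f X + vscale g Y) by rewrite -NE.
have bYX' : br Y X = - (p *v X + r *v (vscale f X + vscale g Y)) by rewrite br_anti bXY'.
rewrite br_add_l !br_scale_l bXY' br_self in bNY'; rewrite br_add_l !br_scale_l bYX' br_self in bNX'.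
have [e1 e2] : cst p * f + cst r * f * f - der Y f - 1 = 0 /\ cst r * g * f - der Y g = 0.
  apply: (frame_indep_fun w0); rewrite -bNY'.
  by move: (der Y f) (der Y g) => u v; vring.
have [e3 e4] : - der X f - g * (cst p + cst r * f) = 0 /\ - der X g - cst r * g * g = 0.
  apply: (frame_indep_fun w0); rewrite -bNX'.
  by move: (der X f) (der X g) => u v; vring.
(* Both derivatives of [g] are multiples of [g], which vanishes at the origin. *)
have g00 : g = 0.
  apply: (@idl_vanish_frame _ G [:: g] X Y w0 _ g (mem_head _ _)) => h; rewrite inE => /eqP ->.
  split=> //.
    have -> : der X g = - (cst r * g) * g.
      by ring_from (esym e4).
    by apply: idl_mul; apply: idl_mem; exact: mem_head.
  have -> : der Y g = (cst r * f) * g by ring_from (esym e2).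
  by apply: idl_mul; apply: idl_mem; exact: mem_head.
have Xf : der X f = 0 by move: e3; rewrite g00 mul0r subr0 => /eqP; rewrite oppr_eq0 => /eqP.
pose m := cst p + cst r * f.
have Yf : der Y f = f * m - 1 by rewrite /m; ring_from (esym e1).
have NX : N = vscale f X by rewrite NE g00; vring.
have bm : br X Y = vscale m X by rewrite bXY NX /m; vring.
have Xm : der X m = 0 by rewrite /m derD derM !derC Xf; ring.
(* With [Y l = m], the bracket [[exp(l) X, Y] = exp(l) (m - Y l) X] is zero. The germ [exp(l)] is
   available because the exponential solves [h'' - h' = 0]. *)
have [l [Xl Yl l0]] : exists l, [/\ der X l = 0, der Y l = m & ev l = 0].
  have [|l lP] := @poincare_frame _ G X Y m 0 m w0 bm; last by exists l.
  by rewrite Xm /der !dE; ring.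
have [Es E1] : ode_solution (-1) 0 (@expR R) /\ expR^`()%classic = expR :> (R -> R).
  apply: (ode_of_derive (fun t => is_derive_expR t)) => t.
  by apply: (is_derive_eq (is_derive_expR t)); ring.
pose e := ga_comp expR l.
have Xe : der X e = 0 by rewrite (der_comp _ _ Es) Xl mulr0.
have Ye : der Y e = e * m by rewrite (der_comp _ _ Es) Yl E1.
have e_1 : ev e = 1 by rewrite (ga_evcomp _ Es) l0 expR0.
have e_0 : ev e != 0 by rewrite e_1 oner_neq0.
have [i ei] := ga_inv e_0.
have i1 : ev i = 1 by move: (congr1 ev ei); rewrite rmorphM e_1 mul1r rmorph1.
have Xi : der X i = 0.
  apply: (unit_cancel e_0); have := congr1 (der X) ei; rewrite derM Xe mul0r add0r => ->.
  by rewrite /der !dE; ring.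
have Yi : der Y i = - (m * i).
  have : der Y (e * i) = 0 by rewrite ei /der !dE; ring.
  rewrite derM Ye => ye; apply: subr0_eq; apply: (unit_cancel e_0); ring_from ye.
have D0 g' : der (vscale e X) g' = e * der X g' by rewrite /der /=; ring.
exists (vscale e X), i, (f * i); split; [split|split|split|].
- by rewrite br_scale_l bm Ye vscaleA; vring.
- rewrite (_ : wedge _ _ = e * wedge X Y) ?rmorphM ?mulf_neq0//; by rewrite /wedge /=; ring.
- by rewrite vscaleA (mulrC i) ei vscale1.
- by rewrite vscaleA -mulrA (mulrC i) ei mulr1.
- by rewrite D0 Xi mulr0.
- by rewrite D0 derM Xf Xi; ring.
- by rewrite Yi /m; ring.
- rewrite derM Yf Yi; ring.
- by rewrite rmorphM f0 mul0r i1.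
Qed.
End NilpotentFrame.

Section SpanCases.
Context {R : realType} (G : germ_algebra R).
Local Notation A := (ga_ring G).
Local Notation ev := (ga_ev G).
Local Notation cst := (ga_cst G).
Local Notation vec := (A * A)%type.
Implicit Types (X Y Z W U V : vec) (f g x y : A) (r s : R) (C : christoffel G).

Local Notation "r *v X" := (vscale (cst r) X) (at level 40).

Lemma push_horizontal X Y f : push X Y (f, 0) = vscale f X.
Proof. by rewrite /push; vring. Qed.
Lemma push_frame1 X Y : push X Y (0, 1) = Y.
Proof. by rewrite /push; vring. Qed.
Lemma push_frame0 X Y : push X Y (1, 0) = X.
Proof. by rewrite /push; vring. Qed.

Lemma nil_span_false C X Y N p r : kil C X -> kil C Y -> kil C N ->
  ev (wedge X Y) != 0 -> evv N = 0 -> br N Y = X -> br N X = 0 -> br X Y = p *v X + r *v N ->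
  (forall V, kil C V -> exists a b c, V = a *v X + b *v Y + c *v N) -> False.
Proof.
move=> kX kY kN w0 n0 bNY bNX bXY span.
have [D [h1 [h2 [[bDY wDY XE NE] [dh1 dh2] [yh1 yh2] [v1 v2]]]]] := nilpotent_frame w0 n0 bNY bNX bXY.
apply: (@nil_contradiction _ (frame_alg bDY wDY) (frame_conn bDY wDY C) h1 h2 p r) => //.
- by apply/kil_push; rewrite push_frame1.
- by apply/kil_push; rewrite push_horizontal -XE.
- by apply/kil_push; rewrite push_horizontal -NE.
move=> u /kil_push; rewrite push_horizontal => ku; have [a [b [c e]]] := span _ ku.
exists a, c; have [/subr0_eq//] : u - (cst a * h1 + cst c * h2) = 0 /\ - cst b = 0.
by apply: (frame_indep_fun wDY); rewrite vscaleDl e XE NE; vring.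
Qed.

(** The relations make [W = x X] with [X x = 1] and [Y x = 0], so that [X], [Y], [W] are [d/dx],
    [d/dy], [x d/dx] over the frame algebra. *)
Lemma idem_span_false C X Y W : kil C X -> kil C Y -> kil C W ->
  ev (wedge X Y) != 0 -> evv W = 0 -> br X Y = 0 -> br W Y = 0 -> br W X = - X ->
  (forall V, kil C V -> exists a b c, V = a *v X + b *v Y + c *v W) -> False.
Proof.
move=> kX kY kW w0 z0 bXY bWY bWX span.
have [x [g WE]] := frame_decomp W w0.
have [x0 g0] : ev x = 0 /\ ev g = 0.
  apply: (frame_indep w0); rewrite -z0 WE /evv /= !rmorphD !rmorphM !ga_evC //.
have bYX : br Y X = 0 by rewrite br_anti bXY oppr0.
have b1 : br (vscale x X + vscale g Y) Y = 0 by rewrite -WE.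
have b2 : br (vscale x X + vscale g Y) X + X = 0 by rewrite -WE bWX addNr.
rewrite br_add_l !br_scale_l bXY br_self in b1; rewrite br_add_l !br_scale_l bYX br_self in b2.
have [e1 e2] : - der Y x = 0 /\ - der Y g = 0.
  by apply: (frame_indep_fun w0); rewrite -b1; move: (der Y x) (der Y g) => u v; vring.
have [e3 e4] : 1 - der X x = 0 /\ - der X g = 0.
  by apply: (frame_indep_fun w0); rewrite -b2; move: (der X x) (der X g) => u v; vring.
have gz : g = 0 by apply: (der_eq0_frame w0) => //; apply: oppr_inj; rewrite oppr0.
have WX : W = vscale x X by rewrite WE gz; vring.
apply: (@idem_contradiction _ (frame_alg bXY w0) (frame_conn bXY w0 C) x) => //.
- by apply/kil_push; rewrite push_frame0.
- by apply/kil_push; rewrite push_frame1.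
- by apply/kil_push; rewrite push_horizontal -WX.
- exact: (esym (subr0_eq e3)).
- by move/eqP: e1; rewrite oppr_eq0 => /eqP.
move=> u /kil_push; rewrite push_horizontal => ku; have [a [b [c e]]] := span _ ku.
exists a, c; have [/subr0_eq//] : u - (cst a + cst c * x) = 0 /\ - cst b = 0.
by apply: (frame_indep_fun w0); rewrite vscaleDl e WX; vring.
Qed.

(** [x] and [y] are dual to the commuting frame, so that [D] and [Y] play the roles of [d/dx] and
    [d/dy]: the fourth case of the theorem before any chart is constructed. *)
Definition coord_model C (D Y : vec) (x y : A) (al be : R) :=
  [/\ br D Y = 0 /\ ev (wedge D Y) != 0,
      [/\ der D x = 1, der Y x = 0, der D y = 0 & der Y y = 1], ev x = 0 /\ ev y = 0 &
      forall V, kil C V <-> exists a b h, ode_solution al be h /\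
        V = a *v vscale x D + b *v Y + vscale (ga_comp h y) D].

(** The brackets of [W] with [X = h1 D] and [Y] leave only [W = x D] with [D x = 1] and
    [Y x = 0]. *)
Lemma coord_model_span C X Y N W p r : kil C X -> kil C Y -> kil C N -> kil C W ->
  ev (wedge X Y) != 0 -> evv N = 0 -> evv W = 0 ->
  br N Y = X -> br N X = 0 -> br X Y = p *v X + r *v N ->
  br W X = - X -> br W Y = 0 ->
  (forall V, kil C V -> exists a b c d, V = a *v X + b *v Y + c *v N + d *v W) ->
  exists D x y, coord_model C D Y x y p (- r).
Proof.
move=> kX kY kN kW w0 n0 z0 bNY bNX bXY bWX bWY span.
have [D [h1 [h2 [[bDY wDY XE NE] [dh1 dh2] [yh1 yh2] [v1 v2]]]]] := nilpotent_frame w0 n0 bNY bNX bXY.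
have [x [g WE]] := frame_decomp W wDY.
have [x0 g0] : ev x = 0 /\ ev g = 0.
  apply: (frame_indep wDY); rewrite -z0 WE /evv /= !rmorphD !rmorphM !ga_evC //.
have bYD : br Y D = 0 by rewrite br_anti bDY oppr0.
have b1 : br (vscale x D + vscale g Y) Y = 0 by rewrite -WE.
have b2 : br (vscale x D + vscale g Y) (vscale h1 D) + vscale h1 D = 0 by rewrite -WE -XE bWX addNr.
have h1n : ev h1 != 0 by rewrite v1 oner_neq0.
rewrite br_add_l !br_scale_l bDY br_self in b1.
rewrite br_scale_r br_add_l !br_scale_l bYD br_self in b2.
have [e1 e2] : - der Y x = 0 /\ - der Y g = 0.
  by apply: (frame_indep_fun wDY); rewrite -b1; move: (der Y x) (der Y g) => u v; vring.
have dWh : der (vscale x D + vscale g Y) h1 = g * der Y h1.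
  transitivity (x * der D h1 + g * der Y h1); first by rewrite /der /=; ring.
  by rewrite dh1 mulr0 add0r.
rewrite dWh in b2.
have [e3 e4] : h1 * (1 - der D x) + g * der Y h1 = 0 /\ h1 * - der D g = 0.
  by apply: (frame_indep_fun wDY); rewrite -b2; move: (der D x) (der D g) (der Y h1) => u v w; vring.
have gz : g = 0.
  apply: (der_eq0_frame wDY) => //; apply: oppr_inj; rewrite oppr0//; exact: (unit_cancel h1n).
have WD : W = vscale x D by rewrite WE gz; vring.
have Yx : der Y x = 0 by apply: oppr_inj; rewrite oppr0.
have Dx : der D x = 1.
  move: e3; rewrite gz mul0r addr0 => /(unit_cancel h1n) /subr0_eq -> //.
pose F := frame_alg bDY wDY.
have [y [y0 y1 y2 yP]] : exists y, [/\ der D y = 0, der Y y = 1, ev y = 0 &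
    forall u, kil (G := F) (frame_conn bDY wDY C) u <->
    exists a b h, ode_solution p (- r) h /\ u = (cst a * x + ga_comp h y, cst b)].
  apply: (@model_span _ F _ h1 h2 x p r) => //.
- by apply/kil_push; rewrite push_frame1.
- by apply/kil_push; rewrite push_horizontal -XE.
- by apply/kil_push; rewrite push_horizontal -NE.
- by apply/kil_push; rewrite push_horizontal -WD.
- move=> V /kil_push kV; have [a [b [c [d e]]]] := span _ kV; exists a, c, d, b.
  apply: (push_inj wDY); rewrite e XE NE WD /push; vring.
exists D, x, y; split=> // V; rewrite -(pullK wDY V); split.
  move=> /kil_push/yP[a [b [h [hs ->]]]]; exists a, b, h; split=> //.
  by rewrite /push; vring.
move=> [a [b [h [hs e]]]]; apply/kil_push/yP; exists a, b, h; split=> //.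
by apply: (push_inj wDY); rewrite e /push; vring.
Qed.

End SpanCases.

(** * Nilpotent and idempotent isotropy *)

Section MatrixLemmas.
Context {R : realType}.
Implicit Types (a b c d k l m q r s t : R).

(* The image of an idempotent preserving a torsion vector or a curvature is a line
   determined by them, which the traceless matrices preserving them annihilate. *)
Lemma fix_idempotent a b c d k l m q t1 t2 r1 r2 r3 r4 :
  a + d = 1 -> a * d - b * c = 0 -> k + q = 0 ->
  fix_tau a b c d t1 t2 -> fix_rho a b c d r1 r2 r3 r4 ->
  fix_tau k l m q t1 t2 -> fix_rho k l m q r1 r2 r3 r4 ->
  ~ [/\ t1 = 0, t2 = 0, r1 = 0 & [/\ r2 = 0, r3 = 0 & r4 = 0]] ->
  [/\ k * a + l * c = 0, k * b + l * d = 0, m * a + q * c = 0 & m * b + q * d = 0].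
Proof.
move=> tr det trn [T1 T2] [P1 P2 P3 P4] [N1 N2] [M1 M2 M3 M4] nz.
have qE : q = - k by apply/eqP; rewrite -addr_eq0 addrC trn.
have dE' : d = 1 - a by rewrite -tr addrC addKr.
have bc : b * c = a * (1 - a) by rewrite -dE'; lra.
rewrite tr !mul1r in T1 T2 P1 P2 P3 P4; rewrite trn !mul0r qE in N1 N2 M1 M2 M3 M4.
subst q d; have r4E : r4 = - r1 by lra.
rewrite r4E in P2 P3 M2 M3; rewrite r4E in nz.
(* A nonzero [t] is fixed by the idempotent, whose image it spans, and is killed by the traceless
   matrix. *)
have [t10|t1n] := eqVneq t1 0; last first.
  have A1 : t1 * c = a * t2.
    have := congr1 ( *%R c) T1; have := congr1 ( *%R a) T2; have := congr1 ( *%R t2) bc.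
    by move=> *; lra.
  have A2 : t1 * (1 - a) = b * t2.
    have := congr1 ( *%R (1 - a)) T1; have := congr1 ( *%R b) T2; have := congr1 ( *%R t1) bc.
    by move=> *; lra.
  split; apply: (mulfI t1n); rewrite mulr0.
  - by have := congr1 ( *%R a) N1; have := congr1 ( *%R l) A1; move=> *; lra.
  - by have := congr1 ( *%R b) N1; have := congr1 ( *%R l) A2; move=> *; lra.
  - by have := congr1 ( *%R a) N2; have := congr1 ( *%R k) A1; move=> *; lra.
  - by have := congr1 ( *%R b) N2; have := congr1 ( *%R k) A2; move=> *; lra.
have [t20|t2n] := eqVneq t2 0; last first.
  rewrite t10 !mul0r !add0r in T1 T2 N1 N2.
  have l0 : l = 0 by apply: (mulfI t2n); rewrite mulr0.
  have k0 : k = 0 by apply: (mulfI t2n); rewrite mulr0; lra.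
  have b0 : b = 0 by apply: (mulfI t2n); rewrite mulr0.
  have a0 : a = 0 by apply: (mulfI t2n); lra.
  by rewrite l0 k0 b0 a0; split; ring.
(* Now [t = 0] and [r] is nonzero. For the idempotent [P], [[P, r] = r] means that [r] kills the
   image of [P] and maps its kernel onto the image; the traceless matrix commutes with [r], hence is
   a multiple of it. *)
have C1 : c * r1 = a * r2 by lra.
have C2 : r1 * b + r3 * (1 - a) = 0 by lra.
have C3 : r1 * a + r3 * c = 0.
  have := congr1 ( *%R a) P1; have := congr1 ( *%R b) C1; have := congr1 ( *%R c) C2.
  have := congr1 ( *%R r1) bc; by move=> *; lra.
have C4 : r2 * b - r1 * (1 - a) = 0 by lra.
have E1 : l * r1 = k * r3 by lra.
have E2 : m * r1 = k * r2 by lra.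
have [r10|r1n] := eqVneq r1 0; last first.
  split; apply: (mulfI r1n); rewrite mulr0.
  - by have := congr1 ( *%R k) C3; have := congr1 ( *%R c) E1; move=> *; lra.
  - by have := congr1 ( *%R k) C2; have := congr1 ( *%R (1 - a)) E1; move=> *; lra.
  - by have := congr1 ( *%R k) C1; have := congr1 ( *%R a) E2; move=> *; lra.
  - by have := congr1 ( *%R k) C4; have := congr1 ( *%R b) E2; move=> *; lra.
rewrite r10 in E1 E2 C1 C2 C3 C4 M1 nz; have [r30|r3n] := eqVneq r3 0; last first.
  have k0 : k = 0 by apply: (mulfI r3n); lra.
  have c0 : c = 0 by apply: (mulfI r3n); lra.
  have a1 : 1 - a = 0 by apply: (mulfI r3n); lra.
  have mr : m * r3 = l * r2 by lra.
  split; apply: (mulfI r3n); rewrite mulr0 ?k0 ?c0 ?a1.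
  - by ring.
  - by ring.
  - by have := congr1 ( *%R l) C1; have := congr1 ( *%R a) mr; rewrite c0; move=> *; lra.
  - by have := congr1 ( *%R l) C4; have := congr1 ( *%R b) mr; move=> *; lra.
rewrite r30 in E1 E2 C1 C2 C3 C4 M1 nz.
have r2n : r2 != 0 by apply/eqP => r20; apply: nz; rewrite t10 t20 r20 oppr0.
have k0 : k = 0 by apply: (mulfI r2n); lra.
have l0 : l = 0 by apply: (mulfI r2n); lra.
have a0 : a = 0 by apply: (mulfI r2n); lra.
have b0 : b = 0 by apply: (mulfI r2n); lra.
by rewrite k0 l0 a0 b0; split; ring.
Qed.

(** On traceless matrices the determinant is a nondegenerate quadratic form in three variables, and
    a subspace on which it vanishes has dimension at most one. [e3] says that its polar form
    vanishes. *)
Lemma nilpotent_line a b c d k l m q : a + d = 0 -> a * d - b * c = 0 ->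
  k + q = 0 -> k * q - l * m = 0 -> (a + k) * (d + q) - (b + l) * (c + m) = 0 ->
  ~ [/\ a = 0, b = 0, c = 0 & d = 0] ->
  exists t, [/\ k = t * a, l = t * b, m = t * c & q = t * d].
Proof.
move=> tr det tr' det' dets nz; have dE : d = - a by lra.
have qE : q = - k by lra.
subst d q; have e1 : b * c = - (a * a) by lra.
have e2 : l * m = - (k * k) by lra.
have e3 : 2%:R * (a * k) + b * m + c * l = 0 by lra.
have [b0|bn] := eqVneq b 0; last first.
  have kE : k * b - a * l = 0.
    apply/eqP; rewrite -sqrf_eq0; apply/eqP.
    have := congr1 ( *%R (b * b)) e2; have := congr1 ( *%R (l * l)) e1; have := congr1 ( *%R (b * l)) e3.
    by move=> *; lra.
  have mE : m * b - c * l = 0.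
    apply: (mulfI bn); have := congr1 ( *%R a) kE; have := congr1 ( *%R l) e1; have := congr1 ( *%R b) e3.
    by move=> *; lra.
  exists (l / b); split; apply: (mulIf bn); rewrite ?mulNr ?mulrN.
  - by rewrite (_ : l / b * a * b = a * l); [lra|field].
  - by field.
  - by rewrite (_ : l / b * c * b = c * l); [lra|field].
  - by rewrite mulNr (_ : l / b * a * b = a * l); [lra|field].
subst b; have a0 : a = 0 by apply/eqP; rewrite -sqrf_eq0; apply/eqP; lra.
subst a; have cn : c != 0 by apply/eqP => c0; apply: nz; rewrite c0 oppr0.
have l0 : l = 0 by apply: (mulfI cn); lra.
subst l; have k0 : k = 0 by apply/eqP; rewrite -sqrf_eq0; apply/eqP; lra.
subst k; exists (m / c); split; rewrite ?mulr0 ?oppr0 ?mulr0//; by field.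
Qed.

End MatrixLemmas.

(** * Nilpotent isotropy *)

Section NilpotentCase.
Context {R : realType} (G : germ_algebra R).
Local Notation A := (ga_ring G).
Local Notation d0 := (ga_d0 (g := G)).
Local Notation d1 := (ga_d1 (g := G)).
Local Notation ev := (ga_ev G).
Local Notation cst := (ga_cst G).
Local Notation vec := (A * A)%type.
Implicit Types (X Y Z W U V : vec) (f g x y : A) (r s : R) (C : christoffel G).

Local Notation "r *v X" := (vscale (cst r) X) (at level 40).

Lemma isot_frame0 C X Y Z : ev (wedge X Y) != 0 -> isot C Z ->
  evv (br Z X) = 0 -> evv (br Z Y) = 0 -> Z = 0.
Proof.
rewrite /wedge rmorphB !rmorphM => w0 [kZ z0]; rewrite !evv_br// => -[x1 x2] [y1 y2].
apply: (kil_jet0 kZ z0); rewrite /jet.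
move: (ev (d0 Z.1)) (ev (d1 Z.1)) (ev (d0 Z.2)) (ev (d1 Z.2)) x1 x2 y1 y2 => a b c d.
move: (ev X.1) (ev X.2) (ev Y.1) (ev Y.2) w0 => X1 X2 Y1 Y2 w0.
move=> /eqP; rewrite oppr_eq0 => /eqP x1 /eqP; rewrite oppr_eq0 => /eqP x2.
move=> /eqP; rewrite oppr_eq0 => /eqP y1 /eqP; rewrite oppr_eq0 => /eqP y2.
have {}w0 : X1 * Y2 - Y1 * X2 != 0 by rewrite [Y1 * _]mulrC.
by have [-> ->] := linear_system2 w0 x1 y1; have [-> ->] := linear_system2 w0 x2 y2.
Qed.

(* With X = [N, Y], Jacobi's identity leaves [N, X] = k N and [X, Y] = p X + k Y + r N,
   where p k = 0. *)
Lemma nil_case C N : kil_frame C -> isot C N -> N <> 0 ->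
  ev (d0 N.1) + ev (d1 N.2) = 0 ->
  ev (d0 N.1) * ev (d1 N.2) - ev (d1 N.1) * ev (d0 N.2) = 0 ->
  (forall Z, isot C Z -> exists t, Z = t *v N) ->
  exists e1 e2 e3 al be ga, simple_basis C e1 e2 e3 al be ga.
Proof.
move=> tC iN N0 tr det line; have [kN n0] := iN.
have nz : ~ jet N = 0 by move=> j; apply: N0; exact: (kil_jet0 kN n0 j).
have bE V := evv_br V n0; rewrite /jet in nz.
move: (ev (d0 N.1)) (ev (d1 N.1)) (ev (d0 N.2)) (ev (d1 N.2)) tr det nz bE => a b c d tr det nz bE.
have dNa : d = - a by lra.
have [Y [kY q0]] : exists u, kil C u /\
   ev u.1 * (c * ev u.1 + d * ev u.2) - ev u.2 * (a * ev u.1 + b * ev u.2) != 0.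
  apply: (kil_noneigen tC) => -[b0 [c0 ad]]; apply: nz.
  have a0 : a = 0 by lra.
  by rewrite dNa a0 b0 c0 oppr0.
pose X := br N Y; have kX : kil C X := kil_br kN kY.
have [X1 X2] := bE Y; rewrite -/X in X1 X2.
have w0 : ev (wedge X Y) != 0.
  rewrite /wedge rmorphB !rmorphM X1 X2; move: q0; congr (_ != 0); ring.
(* The linear part of [N] has square zero, so [[N, [N, Y]]] vanishes at the origin. *)
have [k bNX] : exists k, br N X = k *v N.
  apply: line; split; first exact: kil_br.
  rewrite bE X1 X2 dNa; move: det; rewrite dNa => det.
  move: (ev Y.1) (ev Y.2) => y1 y2; have := congr1 ( *%R y1) det; have := congr1 ( *%R y2) det.
  by move=> e1 e2; congr (_, _); lra.
have span V : kil C V -> exists p q r, V = p *v X + q *v Y + r *v N.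
  move=> kV; have [p [q iV]] := kil_decomp kX kY w0 kV; have [r rE] := line _ iV.
  by exists p, q, r; rewrite -rE addrC subrK.
have [p [q [r bXY]]] := span _ (kil_br kX kY).
have [qk _ pk] : [/\ q - k = 0, 0 = 0 :> R & p * k = 0].
  apply: (frame_isot_indep w0 n0 N0).
  have := jacobi N X Y; rewrite bNX br_cst_l -/X br_self addr0 bXY !br_add_r !br_cst_r bNX br_self -/X.
  by move=> e; rewrite -(subrr (k *v X)) -{1}e; vring.
have {}qk : q = k by apply: subr0_eq.
have [k0|k0] := eqVneq k 0.
  exfalso; apply: (@nil_span_false _ _ C X Y N p r) => //.
    by rewrite bNX k0 vcst0.
  by rewrite bXY qk k0 vcst0 addr0.
have p0 : p = 0 by apply: (mulIf k0); rewrite mul0r.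
(* Chosen so that [[X, Y + s N] = k (Y + s N)]: the coefficient [r - s k] of [N] must equal
   [k s]. *)
pose s := r / (2%:R * k); pose Y' := Y + s *v N; have Y'E : Y' = Y + s *v N by [].
have kY' : kil C Y' by apply: kil_add => //; exact: kil_cst.
have bNY' : br N Y' = X by rewrite /Y' br_add_r br_cst_r br_self vscaler0 addr0.
have bXN : br X N = - (k *v N) by rewrite br_anti bNX.
have bXY' : br X Y' = k *v Y'.
  rewrite /Y' br_add_r br_cst_r bXN bXY p0 qk.
  rewrite (_ : r = s * (2%:R * k)); last by rewrite /s; field.
  by vring.
have bYN' : br Y' N = - X by rewrite br_anti bNY'.
have bYX' : br Y' X = - (k *v Y') by rewrite br_anti bXY'.
(* [[X, N] = - k N], [[X, Y'] = k Y'] and [[N, Y'] = X] form an sl(2) triple up to scaling; the sum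
   and difference of [N] and [Y'] bring it to the cyclic form of [simple_basis]. *)
clearbody Y'; exists X, (N + Y'), (N - Y'), (- 2%:R), k, (- k); split.
- by split=> //; apply: kil_add => //; exact: kil_opp.
- by rewrite !oppr_eq0 pnatr_eq0; split.
- rewrite !(br_add_l, br_add_r, br_opp_l, br_opp_r) !br_self bXN bXY' bNY' bYN' bNX bYX'.
  by generalize X Y' N => ? ? ?; split; vring.
- move=> x y z e; have e' : x *v X + (y - z) *v Y + (y + z + (y - z) * s) *v N = 0.
    by rewrite -e Y'E; vring.
  have [-> yz yz'] := frame_isot_indep w0 n0 N0 e'; move: yz'; rewrite yz mul0r addr0 => yz'.
  by split=> //; lra.
move=> V /span[x [y [z ->]]]; pose z' := z - y * s.
exists x, ((z' + y) / 2%:R), ((z' - y) / 2%:R).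
have e1 : (z' + y) / 2%:R + (z' - y) / 2%:R = z' by field.
have e2 : (z' + y) / 2%:R - (z' - y) / 2%:R = y by field.
move: (_ / _) (_ / _) e1 e2 => n m e1 e2.
have zE : z = m + n + (m - n) * s by rewrite e1 e2 /z'; ring.
by rewrite zE -e2 Y'E; vring.
Qed.

End NilpotentCase.

(** * Isotropy with nonzero trace *)

Section IdempotentCase.
Context {R : realType} (G : germ_algebra R).
Local Notation A := (ga_ring G).
Local Notation ev := (ga_ev G).
Local Notation cst := (ga_cst G).
Local Notation vec := (A * A)%type.
Implicit Types (X Y Z W U V : vec) (f g x y : A) (r s : R) (C : christoffel G).

Local Notation "r *v X" := (vscale (cst r) X) (at level 40).

Lemma ev_wedge_isot X Y N N' : evv N = 0 -> evv N' = 0 ->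
  ev (wedge (X + N) (Y + N')) = ev (wedge X Y).
Proof.
by move=> [n1 n2] [m1 m2]; rewrite /wedge /= !rmorphB !rmorphM !rmorphD n1 n2 m1 m2 !addr0.
Qed.

(** Corrected by multiples of [W], the fields [X], [Y], [W] become [d/dx], [d/dy], [x d/dx], and any
    connection preserved by these has a further Killing field. *)
Lemma idem_line_false C X Y W : kil C X -> kil C Y -> ev (wedge X Y) != 0 -> isot C W -> W <> 0 ->
  (forall Z, isot C Z -> exists t, Z = t *v W) ->
  evv (br W X) = - evv X -> evv (br W Y) = 0 -> False.
Proof.
move=> kX kY w0 [kW z0] W0 line wX wY.
have span U V Z : kil C U -> kil C V -> ev (wedge U V) != 0 -> kil C Z ->
    exists p q r, Z = p *v U + q *v V + r *v W.
  move=> kU kV wUV kZ; have [p [q iZ]] := kil_decomp kU kV wUV kZ; have [r rE] := line _ iZ.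
  by exists p, q, r; rewrite -rE addrC subrK.
have [a bWY] : exists a, br W Y = a *v W by apply: line; split=> //; exact: kil_br.
have [b bWX] : exists b, br W X + X = b *v W.
  by apply: line; split; [exact: kil_add (kil_br kW kX) kX|rewrite evvD wX addNr].
have zW r : evv (r *v W) = 0 by rewrite evvZ; case: z0 => -> ->; rewrite !mulr0.
pose X' := X + (- b) *v W.
have kX' : kil C X' by apply: kil_add => //; exact: kil_cst.
have bWX' : br W X' = - X'.
  rewrite /X' br_add_r br_cst_r br_self vscaler0 addr0 vcstN opprD opprK -bWX.
  by rewrite addrC addrK.
have w0' : ev (wedge X' Y) != 0 by rewrite -[Y]addr0 ev_wedge_isot// /evv rmorph0.
clearbody X'; have [p [q [r bXY]]] := span _ _ _ kX' kY w0' (kil_br kX' kY).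
have bXW : br X' W = X' by rewrite br_anti bWX' opprK.
have [e1 e2 e3] : [/\ - a = 0, q = 0 & q * a + r = 0].
  apply: (frame_isot_indep w0' z0 W0).
  have := jacobi W X' Y; rewrite bWX' bWY br_opp_l br_cst_r bXW bXY !br_add_r !br_cst_r bWX' bWY br_self.
  move=> /eqP; rewrite -subr_eq0 => /eqP <-; vring.
have a0 : a = 0 by apply: oppr_inj; rewrite oppr0.
have r0 : r = 0 by move: e3; rewrite e2 mul0r add0r.
rewrite a0 vcst0 in bWY; rewrite e2 r0 !vcst0 !addr0 in bXY.
(* Since [[X', W] = X'], this multiple of [W] cancels [[X', Y] = p X']. *)
pose Y' := Y + (- p) *v W.
have w0'' : ev (wedge X' Y') != 0.
  have e0 : evv (0 : vec) = 0 by rewrite /evv !rmorph0.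
  by have := ev_wedge_isot X' Y e0 (zW (- p)); rewrite addr0 => ->.
apply: (@idem_span_false _ _ C X' Y' W) => //.
- by apply: kil_add => //; exact: kil_cst.
- by rewrite /Y' br_add_r br_cst_r bXW bXY vcstN subrr.
- by rewrite /Y' br_add_r br_cst_r bWY br_self vscaler0 addr0.
move=> V kV; apply: span => //; apply: kil_add => //; exact: kil_cst.
Qed.

(** The hypotheses fix the brackets of isotropy fields with [X] and [Y] only at the origin, that is
    up to isotropy; a change of [X] and [Y] and Jacobi's identity remove the remaining terms. *)
Lemma idem_plane C X Y N W : kil C X -> kil C Y -> ev (wedge X Y) != 0 ->
  isot C N -> isot C W -> N <> 0 ->
  (forall Z, isot C Z -> exists s t, Z = s *v N + t *v W) ->
  evv (br W X) = - evv X -> evv (br W Y) = 0 -> evv (br N X) = 0 ->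
  evv (br N Y) = evv X -> exists D Y x y al be, coord_model C D Y x y al be.
Proof.
move=> kX kY w0 [kN n0] [kW z0] N0 plane wX wY nX nY.
have bNact V : evv V = evv X -> evv (br N V) = 0.
  by move=> [v1 v2]; rewrite -nX !(evv_br _ n0) v1 v2.
have zW r : evv (r *v W) = 0 by rewrite evvZ; case: z0 => -> ->; rewrite !mulr0.
have zN r : evv (r *v N) = 0 by rewrite evvZ; case: n0 => -> ->; rewrite !mulr0.
(* Both sides are isotropy fields, so it suffices to compare their linear parts on the values of [X]
   and [Y]. *)
have bWN : br W N = - N.
  have i0 : isot C (br W N + N).
    split; first by apply: kil_add => //; exact: kil_br.
    by rewrite evvD n0 addr0 (evv_br _ z0); case: n0 => -> ->; rewrite !mulr0 addr0 oppr0.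
  apply/eqP; rewrite -addr_eq0; apply/eqP; apply: (isot_frame0 w0 i0).
    have e : br (br W N) X = br W (br N X) - br N (br W X) by rewrite [br W (br N X)]jacobi addrK.
    have e0 : evv (br N (br W X + X)) = 0.
      have v0 : evv (br W X + X) = 0 by rewrite evvD wX addNr.
      by rewrite (evv_br _ n0); case: v0 => -> ->; rewrite !mulr0 addr0 oppr0.
    rewrite br_add_r evvD nX addr0 in e0.
    rewrite br_add_l evvD nX addr0 e evvD evvN e0 subr0 (evv_br _ z0).
    by have [-> ->] := nX; rewrite !mulr0 addr0 oppr0.
  have e : br (br W N) Y = br W (br N Y) - br N (br W Y) by rewrite [br W (br N Y)]jacobi addrK.
  rewrite br_add_l evvD nY e evvD evvN (evv_br _ z0); have [-> ->] := nY.
  rewrite (evv_br _ n0); have [-> ->] := wY; rewrite !mulr0 addr0 oppr0.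
  by move: wX; rewrite (evv_br _ z0) => -> /=; rewrite subr0 addNr.
have bNW : br N W = N by rewrite br_anti bWN opprK.
have indWN s t : s *v W + t *v N = 0 -> s = 0 /\ t = 0.
  move=> e; have s0 : s = 0.
    have := congr1 (br N) e; rewrite br_add_r !br_cst_r bNW br_self br_zero_r vscaler0 addr0.
    by move=> /vcst_eq0; exact.
  by split=> //; move: e; rewrite s0 vcst0 add0r => /vcst_eq0; exact.
have [b [a bWY]] : exists b a, br W Y = b *v N + a *v W by apply: plane; split=> //; exact: kil_br.
(* Since [[W, N] = - N], this removes the component of [[W, Y]] along [N]. *)
pose Y' := Y + b *v N.
have kY' : kil C Y' by apply: kil_add => //; exact: kil_cst.
have bWY' : br W Y' = a *v W by rewrite /Y' br_add_r bWY br_cst_r bWN; vring.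
pose X' := br N Y'.
have kX' : kil C X' := kil_br kN kY'.
have vX' : evv X' = evv X by rewrite /X' /Y' br_add_r br_cst_r br_self vscaler0 addr0 nY.
have w0' : ev (wedge X' Y') != 0.
  rewrite (_ : ev _ = ev (wedge X Y))//.
  have vY' : evv Y' = evv Y by rewrite evvD zN addr0.
  by rewrite /wedge !rmorphB !rmorphM; case: vX' => -> ->; case: vY' => -> ->.
have bWX : br W X' = - X' + a *v N.
  by rewrite /X' jacobi bWN bWY' br_cst_r bNW br_opp_l.
have bNY : br N Y' = X' by [].
clearbody X' Y'.
have bNX : br N X' = 0.
  have [s [t e]] : exists s t, br N X' = s *v N + t *v W.
    by apply: plane; split; [exact: kil_br|exact: bNact].
  have := jacobi W N X'; rewrite bWN bWX br_opp_l br_add_r br_opp_r br_cst_r br_self vscaler0 addr0.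
  rewrite e br_add_r !br_cst_r bWN br_self => e'.
  have [] := @indWN (t + t) s.
    by move/eqP: e'; rewrite -subr_eq0 => /eqP <-; vring.
  by move=> tt s0; have t0 : t = 0 by [lra]; rewrite s0 t0 !vcst0 addr0.
have span V : kil C V -> exists p q r s, V = p *v X' + q *v Y' + r *v N + s *v W.
  move=> kV; have [p [q iV]] := kil_decomp kX' kY' w0' kV; have [r [s e]] := plane _ iV.
  by exists p, q, r, s; rewrite -addrA -e addrC subrK.
have bXN : br X' N = 0 by rewrite br_anti bNX oppr0.
have bXW : br X' W = X' - a *v N by rewrite br_anti bWX opprD opprK.
have bYW : br Y' W = - (a *v W) by rewrite br_anti bWY'.
have bYX : br Y' N = - X' by rewrite br_anti bNY.
have [p [q [r [s bXY]]]] := span _ (kil_br kX' kY').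
have [q0 _ s0] : [/\ q = 0, 0 = 0 :> R & s = 0].
  apply: (frame_isot_indep w0' n0 N0).
  have := jacobi N X' Y'; rewrite bNX br_zero_l bNY br_self add0r bXY.
  by rewrite !br_add_r !br_cst_r bNX bNY br_self bNW => <-; vring.
rewrite q0 s0 !vcst0 !addr0 in bXY.
(* In Jacobi's identity for [W], [X'], [Y'] the coefficient of [X'] is [- 2 a]. *)
have [a0 _ _] : [/\ - a - a = 0, 0 = 0 :> R & p * a + a * a = 0].
  apply: (frame_isot_indep w0' n0 N0).
  have := jacobi W X' Y'; rewrite bWX bWY' br_add_l br_opp_l br_cst_l br_cst_r bNY bXW bXY.
  rewrite br_add_r !br_cst_r bWX bWN => /eqP; rewrite -subr_eq0 => /eqP <-; vring.
have {}a0 : a = 0 by lra.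
rewrite a0 vcst0 addr0 in bWX; rewrite a0 vcst0 in bWY'.
have [D [x [y M]]] := @coord_model_span _ _ C X' Y' N W p r kX' kY' kN kW w0' n0 z0 bNY bNX bXY bWX bWY' span.
by exists D, Y', x, y, p, (- r).
Qed.

End IdempotentCase.

(** * Classification *)

Section Classification.
Context {R : realType} (G : germ_algebra R).
Local Notation A := (ga_ring G).
Local Notation d0 := (ga_d0 (g := G)).
Local Notation d1 := (ga_d1 (g := G)).
Local Notation ev := (ga_ev G).
Local Notation cst := (ga_cst G).
Local Notation vec := (A * A)%type.
Implicit Types (X Y Z W U V : vec) (f g x y : A) (r s : R) (C : christoffel G).

Local Notation "r *v X" := (vscale (cst r) X) (at level 40).

Definition jet_trace Z : R := ev (d0 Z.1) + ev (d1 Z.2).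
Definition jet_det Z : R := ev (d0 Z.1) * ev (d1 Z.2) - ev (d1 Z.1) * ev (d0 Z.2).

Lemma curvature_torsion_neq0 C : kil_frame C -> nonflat C ->
  ~ [/\ ev (tau C).1 = 0, ev (tau C).2 = 0, ev (rho C (frame0 G)).1 = 0 &
     [/\ ev (rho C (frame0 G)).2 = 0, ev (rho C (frame1 G)).1 = 0 & ev (rho C (frame1 G)).2 = 0]].
Proof.
by move=> tC nf [t1 t2 r1 [r2 r3 r4]]; apply: (nonflat_ev tC nf);
  rewrite /evv ?t1 ?t2 ?r1 ?r2 ?r3 ?r4.
Qed.

(** By [fix_idempotent], [N] kills the image of [W], which is the line of [X]; being traceless, it
    then maps every vector into that line. *)
Lemma idem_action C W N X Y : kil_frame C -> nonflat C -> isot C W -> isot C N ->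
  jet_trace W = 1 -> jet_det W = 0 -> jet_trace N = 0 -> ev (wedge X Y) != 0 ->
  evv (br W X) = - evv X ->
  evv (br N X) = 0 /\ exists s, evv (br N Y) = (s * ev X.1, s * ev X.2).
Proof.
move=> tC nf iW iN tW dW tN; rewrite /wedge rmorphB !rmorphM => w0 wX.
have [W1 W2] := isot_fix iW; have [N1 N2] := isot_fix iN.
have [n1 n2 n3 n4] := fix_idempotent tW dW tN W1 W2 N1 N2 (curvature_torsion_neq0 tC nf).
move: wX; rewrite (evv_br _ iW.2) !(evv_br _ iN.2) => -[/oppr_inj x1 /oppr_inj x2].
move: tN n1 n2 n3 n4 x1 x2 w0 {W1 W2 N1 N2 tW dW}; rewrite /jet_trace /evv.
move: (ev (d0 W.1)) (ev (d1 W.1)) (ev (d0 W.2)) (ev (d1 W.2)) => a b c d.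
move: (ev (d0 N.1)) (ev (d1 N.1)) (ev (d0 N.2)) (ev (d1 N.2)) => k l m q.
move: (ev X.1) (ev X.2) (ev Y.1) (ev Y.2) => X1 X2 Y1 Y2 tN n1 n2 n3 n4 x1 x2 w0.
have nX1 : k * X1 + l * X2 = 0.
  transitivity ((k * a + l * c) * X1 + (k * b + l * d) * X2); last by rewrite n1 n2 !mul0r addr0.
  by rewrite -[X in k * X]x1 -[X in l * X]x2; ring.
have nX2 : m * X1 + q * X2 = 0.
  transitivity ((m * a + q * c) * X1 + (m * b + q * d) * X2); last by rewrite n3 n4 !mul0r addr0.
  by rewrite -[X in m * X]x1 -[X in q * X]x2; ring.
split; first by rewrite nX1 nX2 oppr0.
pose z1 := k * Y1 + l * Y2; pose z2 := m * Y1 + q * Y2.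
(* [det(X, N Y) = tr(N) det(X, Y) - det(N X, Y)], and both terms on the right vanish. *)
have e : X1 * z2 = X2 * z1.
  have -> : X1 * z2 = X2 * z1 + (k + q) * (X1 * Y2 - X2 * Y1) - (k * X1 + l * X2) * Y2 +
    (m * X1 + q * X2) * Y1 by rewrite /z1 /z2; ring.
  by rewrite tN nX1 nX2 !mul0r addr0 subr0 addr0.
pose w := X1 * Y2 - X2 * Y1; rewrite -/z1 -/z2; clearbody z1 z2; exists (- (z1 * Y2 - z2 * Y1) / w).

congr (_, _); apply: (mulIf w0); rewrite -/w.
  rewrite (_ : _ / w * X1 * w = - (z1 * Y2 - z2 * Y1) * X1); last by rewrite /w; field.
  by have := congr1 ( *%R Y1) e; rewrite /w => /esym e'; ring_from e'.
rewrite (_ : _ / w * X2 * w = - (z1 * Y2 - z2 * Y1) * X2); last by rewrite /w; field.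
by have := congr1 ( *%R Y2) e; rewrite /w => /esym e'; ring_from e'.
Qed.

Lemma jet_traceD Z W : jet_trace (Z + W) = jet_trace Z + jet_trace W.
Proof. by rewrite /jet_trace /= !dE !rmorphD; ring. Qed.
Lemma jet_traceZ r Z : jet_trace (r *v Z) = r * jet_trace Z.
Proof. by rewrite /jet_trace /= !dE !mul0r !add0r !rmorphM !ga_evC; ring. Qed.

(** The image of an idempotent of rank one is spanned by a nonzero column, and its kernel by a
    vector orthogonal to a nonzero row; the case distinction on [a] selects them. *)
Lemma kil_eigenframe C W : kil_frame C -> isot C W -> jet_trace W = 1 -> jet_det W = 0 ->
  exists X Y, [/\ kil C X, kil C Y, ev (wedge X Y) != 0, evv (br W X) = - evv X & evv (br W Y) = 0].
Proof.
move=> tC [kW z0]; rewrite /jet_trace /jet_det.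
have bE V := evv_br V z0; move: bE.
move: (ev (d0 W.1)) (ev (d1 W.1)) (ev (d0 W.2)) (ev (d1 W.2)) => a b c d bE tr det.
have oppE (u v : R) : - (u, v) = (- u, - v) by [].
have [a0|a0] := eqVneq a 0.
  have d1' : d = 1 by lra.
  have bc0 : b * c = 0 by move: det; rewrite a0 d1' => det; lra.
  have [X [kX X1 X2]] := kil_value b d tC; have [Y [kY Y1 Y2]] := kil_value d (- c) tC.
  exists X, Y; split=> //.
  - rewrite /wedge rmorphB !rmorphM X1 X2 Y1 Y2 d1' mulrN bc0 oppr0 mulr1 sub0r.
    by rewrite oppr_eq0 oner_neq0.
  - by rewrite bE /evv X1 X2 oppE a0 d1'; congr (_, _); lra.
  - by rewrite bE Y1 Y2 a0 d1'; congr (_, _); lra.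
have [X [kX X1 X2]] := kil_value a c tC; have [Y [kY Y1 Y2]] := kil_value (- b) a tC.
have dE' : d = 1 - a by lra.
rewrite dE' in det bE; exists X, Y; split=> //.
- by rewrite /wedge rmorphB !rmorphM X1 X2 Y1 Y2 (_ : _ - _ = a)//; lra.
- by rewrite bE /evv X1 X2 oppE; congr (_, _); lra.
- by rewrite bE Y1 Y2; congr (_, _); lra.
Qed.

(** Subtracting a multiple of [W] makes any isotropy field traceless; by [idem_action] a traceless
    one is determined by a single number, so the isotropy is the line of [W], which is excluded, or
    a plane. *)
Lemma idem_case C W : kil_frame C -> nonflat C -> isot C W -> jet_trace W = 1 ->
  exists D Y x y al be, coord_model C D Y x y al be.
Proof.
move=> tC nf iW tW; have dW : jet_det W = 0.
  apply/eqP/negP => /negP dn; apply: (curvature_torsion_neq0 tC nf).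
  have [W1 W2] := isot_fix iW; apply: (fix_nondegenerate _ dn W1 W2).
  by move: tW; rewrite /jet_trace => ->; exact: oner_neq0.
have W0 : W <> 0.
  by move=> W0; move: tW; rewrite W0 /jet_trace /= !dE rmorph0 addr0 => /esym/eqP; rewrite oner_eq0.
have [X [Y [kX kY w0 wX wY]]] := kil_eigenframe tC iW tW dW.
have act N (iN : isot C N) (tN : jet_trace N = 0) := idem_action tC nf iW iN tW dW tN w0 wX.
have split_isot Z : isot C Z -> exists t (N : vec), [/\ Z = N + t *v W, isot C N & jet_trace N = 0].
  move=> iZ; exists (jet_trace Z), (Z + (- jet_trace Z) *v W); split.
  - by rewrite vcstN addrNK.
  - by apply: isot_add => //; exact: isot_cst.
  - by rewrite jet_traceD jet_traceZ tW mulr1 subrr.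
have [line|/existsNP[Z0]] := pselect (forall Z, isot C Z -> exists t, Z = t *v W).
  by exfalso; exact: (idem_line_false kX kY w0 iW W0 line wX wY).
move=> /not_implyP[iZ0 nl]; have [t0 [N0 [Z0E iN0 tN0]]] := split_isot _ iZ0.
have [n0X [s0 n0Y]] := act _ iN0 tN0.
have s00 : s0 != 0.
  apply/eqP => s00; apply: nl; exists t0; rewrite Z0E (_ : N0 = 0) ?add0r//.
  by apply: (isot_frame0 w0 iN0) => //; rewrite n0Y s00 !mul0r.
(* Normalized so that [[N, Y]] and [X] agree at the origin. *)
pose N := s0^-1 *v N0.
have iN : isot C N by exact: isot_cst.
have nX : evv (br N X) = 0.
  by rewrite /N br_cst_l evvZ; have [-> ->] := n0X; rewrite !mulr0.
have nY : evv (br N Y) = evv X.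
  by rewrite /N br_cst_l evvZ; have [-> ->] := n0Y; rewrite !mulrA mulVf// !mul1r.
have Nn0 : N <> 0.
  move=> Nz; move: nY; rewrite Nz br_zero_l /evv !rmorph0 => -[x1 x2].
  by move: w0; rewrite /wedge rmorphB !rmorphM -x1 -x2 !mul0r subrr eqxx.
apply: (@idem_plane _ _ C X Y N W) => // Z iZ.
have [t [M [-> iM tM]]] := split_isot _ iZ; have [mX [s mY]] := act _ iM tM.
exists s, t; congr (_ + _); apply: subr0_eq.
apply: (isot_frame0 w0 (isot_add iM _)).
- by rewrite -vcstN; exact: isot_cst.
- rewrite -vcstN br_add_l br_cst_l evvD evvZ mX; have [-> ->] := nX.
  by rewrite !mulr0 addr0.
rewrite -vcstN br_add_l br_cst_l evvD evvZ mY; have [-> ->] := nY.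
by rewrite !mulNr; exact: (subrr (s * ev X.1, s * ev X.2)).
Qed.

Theorem classification C : kil_frame C -> nonflat C ->
  [\/ exists X Y, [/\ kil C X, kil C Y, ev (wedge X Y) != 0 &
         forall V, kil C V -> exists a b, V = a *v X + b *v Y],
      exists e1 e2 e3 al be ga, simple_basis C e1 e2 e3 al be ga |
      exists D Y x y al be, coord_model C D Y x y al be].
Proof.
move=> tC nf.
have [[W [iW tW]]|noW] := pselect (exists W, isot C W /\ jet_trace W != 0).
  apply: Or33; apply: (@idem_case C ((jet_trace W)^-1 *v W)) => //; first exact: isot_cst.
  by rewrite jet_traceZ mulVf.
have tr0 Z : isot C Z -> jet_trace Z = 0.
  by move=> iZ; apply/eqP/negP => /negP nz; apply: noW; exists Z.
have [[Z [iZ dZ]]|noZ] := pselect (exists Z, isot C Z /\ jet_det Z != 0).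
  by apply: Or32; exact: (traceless_case tC nf iZ (tr0 _ iZ) dZ).
have det0 Z : isot C Z -> jet_det Z = 0.
  by move=> iZ; apply/eqP/negP => /negP nz; apply: noZ; exists Z.
have [[N [iN N0]]|noN] := pselect (exists N, isot C N /\ N <> 0).
  apply: Or32; apply: (nil_case tC iN N0 (tr0 _ iN) (det0 _ iN)) => Z iZ.
  have nz : ~ [/\ ev (d0 N.1) = 0, ev (d1 N.1) = 0, ev (d0 N.2) = 0 & ev (d1 N.2) = 0].
    by move=> [j1 j2 j3 j4]; apply: N0; apply: (kil_jet0 iN.1 iN.2); rewrite /jet j1 j2 j3 j4.
  (* Isotropy fields form a vector space, so the sum of two nilpotent matrices is singular too. *)
  have dd := det0 _ (isot_add iN iZ); rewrite /jet_det /= !dE !rmorphD in dd.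
  have [t [j1 j2 j3 j4]] := nilpotent_line (tr0 _ iN) (det0 _ iN) (tr0 _ iZ) (det0 _ iZ) dd nz.
  by exists t; apply: (isot_eq iZ (isot_cst _ iN)); rewrite jetZ /jet j1 j2 j3 j4.
have [X [Y [kX kY w0]]] := tC; apply: Or31; exists X, Y; split=> // V kV.
have [p [q iV]] := kil_decomp kX kY w0 kV; exists p, q; apply: subr0_eq.
by apply/not_notP => nz; apply: noN; exists (V - (p *v X + q *v Y)).
Qed.

End Classification.

(** * Germs of vector fields *)

Section VectorGerms.
Context {R : realType}.
Implicit Types (V W : set (plane R)) (p q : plane R) (i j : 'I_2) (X Y Z : vfield R).

#[local] Opaque partial derive.

Definition component i X : plane R -> R := fun q => X q 0 i.
Definition vsmooth_near p X := exists V, [/\ open V, V p & smooth V X].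
Definition vgerm p X : germ p * germ p := (germ_of p (component ix0 X), germ_of p (component ix1 X)).

Lemma smooth_coordP V X : open V -> smooth V X <-> forall j, smooth V (component j X).
Proof.
move=> oV; split=> [CX j k|CX k]; first by have /(Ck_coordP _ _ oV) := CX k; exact.
by apply/(Ck_coordP _ _ oV) => j; exact: CX.
Qed.

Lemma vsmooth_nearP p X : vsmooth_near p X <-> forall j, component j X \in smooth_near p.
Proof.
split=> [[V [oV Vp CX]] j|Cj].
  by apply/smooth_nearP; exists V; split=> //; exact: (smooth_coordP _ oV).1.
have [V [oV Vp CV]] := smooth_near_family Cj; exists V; split=> //.
by apply/(smooth_coordP _ oV).
Qed.

Lemma vsmooth_of p V X : open V -> V p -> smooth V X -> vsmooth_near p X.
Proof. by exists V. Qed.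

Lemma vgerm_eq p X Y : vsmooth_near p X -> vsmooth_near p Y ->
  vgerm p X = vgerm p Y <-> \forall q \near p, X q = Y q.
Proof.
move=> /vsmooth_nearP sX /vsmooth_nearP sY; split.
  move=> [/germ_of_eq e0 /germ_of_eq e1]; have Fp : Filter (nbhs p) := nbhs_filter p.
  have {}e0 := e0 (sX _) (sY _); have {}e1 := e1 (sX _) (sY _).
  apply: filterS2 e0 e1 => q; exact: planeP.
by move=> e; congr (_, _); apply/germ_of_eq => //; apply: filterS e => q; rewrite /component => ->.
Qed.

Lemma vgermP p (v : germ p * germ p) : exists2 X, vsmooth_near p X & vgerm p X = v.
Proof.
have [f0 s0 e0] := germP v.1; have [f1 s1 e1] := germP v.2.
pose X : vfield R := fun q => \row_j (if j == ix0 then f0 q else f1 q).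
have c0 : component ix0 X = f0 by apply/funext => q; rewrite /component mxE eqxx.
have c1 : component ix1 X = f1 by apply/funext => q; rewrite /component mxE ix1_neq0.
exists X; last by rewrite /vgerm c0 c1 -e0 -e1 -surjective_pairing.
by apply/vsmooth_nearP => j; case: (ord2 j) => ->; rewrite ?c0 ?c1.
Qed.

Lemma near_eq_vsmooth p X Y : (\forall q \near p, X q = Y q) -> vsmooth_near p X ->
  vsmooth_near p Y.
Proof.
move=> /open_near_set[V [oV Vp e]] [W [oW Wp CX]].
exists (V `&` W); split=> [|//|k]; first exact: openI.
apply: (@Ck_eq _ _ _ _ X); first exact: openI.
  by move=> q [Vq _]; exact: e.
by apply: Ck_sub (CX k); move=> q [].
Qed.

Lemma coordD i X Y : component i (X + Y) = component i X + component i Y.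
Proof. by apply/funext => q; rewrite /component !fctE mxE. Qed.
Lemma coordN i X : component i (- X) = - component i X.
Proof. by apply/funext => q; rewrite /component !fctE mxE. Qed.
Lemma coord_fscale i f X : component i (fscale f X) = f * component i X.
Proof. by apply/funext => q; rewrite /component /fscale !fctE mxE. Qed.

Lemma smooth_nearN p f : f \in smooth_near p -> - f \in smooth_near p.
Proof. by move=> sf; rewrite rpredN. Qed.

Lemma germ_ofN p f : f \in smooth_near p -> germ_of p (- f) = - germ_of p f.
Proof.
move=> sf; apply/eqP; rewrite -addr_eq0 -germ_ofD ?smooth_nearN// addNr.
by rewrite -(germ_of0 p).
Qed.

Lemma vsmoothD p X Y : vsmooth_near p X -> vsmooth_near p Y -> vsmooth_near p (X + Y).
Proof.
move=> /vsmooth_nearP sX /vsmooth_nearP sY; apply/vsmooth_nearP => j.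
by rewrite coordD smooth_nearD.
Qed.
Lemma vsmoothN p X : vsmooth_near p X -> vsmooth_near p (- X).
Proof. by move=> /vsmooth_nearP sX; apply/vsmooth_nearP => j; rewrite coordN smooth_nearN. Qed.
Lemma vsmooth_fscale p f X : f \in smooth_near p -> vsmooth_near p X -> vsmooth_near p (fscale f X).
Proof.
by move=> sf /vsmooth_nearP sX; apply/vsmooth_nearP => j; rewrite coord_fscale smooth_nearM.
Qed.

Lemma vgermD p X Y : vsmooth_near p X -> vsmooth_near p Y ->
  vgerm p (X + Y) = vgerm p X + vgerm p Y.
Proof.
by move=> /vsmooth_nearP sX /vsmooth_nearP sY; rewrite /vgerm !coordD !germ_ofD.
Qed.
Lemma vgermN p X : vsmooth_near p X -> vgerm p (- X) = - vgerm p X.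
Proof. by move=> /vsmooth_nearP sX; rewrite /vgerm !coordN !germ_ofN. Qed.
Lemma vgermB p X Y : vsmooth_near p X -> vsmooth_near p Y ->
  vgerm p (X - Y) = vgerm p X - vgerm p Y.
Proof. by move=> sX sY; rewrite vgermD ?vgermN//; exact: vsmoothN. Qed.
Lemma vgerm_fscale p f X : f \in smooth_near p -> vsmooth_near p X ->
  vgerm p (fscale f X) = vscale (G := germ_alg p) (germ_of p f) (vgerm p X).
Proof.
by move=> sf /vsmooth_nearP sX; rewrite /vgerm !coord_fscale !germ_ofM.
Qed.

Lemma vgerm_ev p X : vsmooth_near p X -> evv (G := germ_alg p) (vgerm p X) = (X p 0 ix0, X p 0 ix1).
Proof. by move=> /vsmooth_nearP sX; rewrite /evv /= !germ_ev_of. Qed.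

Definition der_coord X f : plane R -> R :=
  component ix0 X * partial ix0 f + component ix1 X * partial ix1 f.

Lemma deriv_along_near p X f : f \in smooth_near p ->
  \forall q \near p, deriv_along X f q = der_coord X f q.
Proof.
move=> /smooth_nearP[V [oV Vp Cf]]; apply: filterS (open_near oV Vp) => q Vq.
exact: (@derive_val _ _ _ _ _ _ _ (deriveE_partial (X q) oV (Cf 1) Vq)).
Qed.

Lemma smooth_der_coord p X f : vsmooth_near p X -> f \in smooth_near p ->
  der_coord X f \in smooth_near p.
Proof.
by move=> /vsmooth_nearP sX sf; apply: smooth_nearD; apply: smooth_nearM => //;
  exact: smooth_near_partial.
Qed.

Lemma germ_der_coord p X f : vsmooth_near p X -> f \in smooth_near p ->
  germ_of p (der_coord X f) = der (G := germ_alg p) (vgerm p X) (germ_of p f).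
Proof.
move=> /vsmooth_nearP sX sf.
have sp i : partial i f \in smooth_near p by exact: smooth_near_partial.
rewrite /der_coord germ_ofD; [|exact: smooth_nearM|exact: smooth_nearM].
by rewrite (germ_ofM (sX ix0) (sp ix0)) (germ_ofM (sX ix1) (sp ix1)) /der /= !(germ_diff_of _ sf).
Qed.

Lemma near_eq_smooth p f g : (\forall q \near p, f q = g q) -> f \in smooth_near p ->
  g \in smooth_near p.
Proof.
move=> /open_near_set[V [oV Vp e]] /smooth_nearP[W [oW Wp Cf]]; apply/smooth_nearP.
exists (V `&` W); split=> [|//|k]; first exact: openI.
apply: (@Ck_eq _ _ _ _ f); first exact: openI.
  by move=> q [Vq _]; exact: e.
by apply: Ck_sub (Cf k); move=> q [].
Qed.

Lemma germ_deriv_along p X f : vsmooth_near p X -> f \in smooth_near p ->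
  deriv_along X f \in smooth_near p /\
  germ_of p (deriv_along X f) = der (G := germ_alg p) (vgerm p X) (germ_of p f).
Proof.
move=> sX sf; have sd := smooth_der_coord sX sf.
have e : \forall q \near p, der_coord X f q = deriv_along X f q.
  by apply: filterS (deriv_along_near X sf) => q ->.
have sa := near_eq_smooth e sd; split=> //.
by rewrite -germ_der_coord//; apply/germ_of_eq => //; exact: deriv_along_near.
Qed.

Lemma lie_bracket_near p X Y i : vsmooth_near p X -> vsmooth_near p Y ->
  \forall q \near p, component i (lie_bracket X Y) q =
    (deriv_along X (component i Y) - deriv_along Y (component i X)) q.
Proof.
move=> [V [oV Vp CX]] [W [oW Wp CY]]; apply: filterS (open_near (openI oV oW) (conj Vp Wp)).
move=> q [Vq Wq]; rewrite /component /lie_bracket /deriv_along !mxE.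
have dm U (Z : vfield R) v : open U -> smooth U Z -> U q -> derivable Z q v.
  move=> oU CZ Uq; apply/derivable_mxP => a j; rewrite ord1.
  have C1 := (smooth_coordP Z oU).1 CZ j 1%N.
  exact: (@ex_derive _ _ _ _ _ _ _ (deriveE_partial v oU C1 Uq)).
rewrite derive_mx; last exact: dm oW CY Wq.
rewrite derive_mx; last exact: dm oV CX Vq.
by rewrite !mxE.
Qed.

Lemma vgerm_bracket p X Y : vsmooth_near p X -> vsmooth_near p Y ->
  vsmooth_near p (lie_bracket X Y) /\
  vgerm p (lie_bracket X Y) = br (G := germ_alg p) (vgerm p X) (vgerm p Y).
Proof.
move=> sX sY; have cX := (vsmooth_nearP p X).1 sX; have cY := (vsmooth_nearP p Y).1 sY.
have sd i : deriv_along X (component i Y) - deriv_along Y (component i X) \in smooth_near p.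
  by apply: smooth_nearD; [|apply: smooth_nearN]; exact: (germ_deriv_along _ _).1.
have e i := lie_bracket_near i sX sY.
have sc i : component i (lie_bracket X Y) \in smooth_near p.
  by apply: near_eq_smooth (sd i); apply: filterS (e i) => q ->.
have ge i : germ_of p (component i (lie_bracket X Y)) =
    der (G := germ_alg p) (vgerm p X) (germ_of p (component i Y)) -
    der (G := germ_alg p) (vgerm p Y) (germ_of p (component i X)).
  have [a1 a2] := germ_deriv_along sX (cY i); have [b1 b2] := germ_deriv_along sY (cX i).
  rewrite -a2 -b2 -germ_ofN// -germ_ofD//; last exact: smooth_nearN.
  by apply/germ_of_eq.
by split; [apply/vsmooth_nearP|rewrite /vgerm !ge].
Qed.

End VectorGerms.

(** * Germs of an affine connection *)

Section ConnectionGerms.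
Context {R : realType} (U : set (plane R)) (nabla : vfield R -> vfield R -> vfield R).
Hypotheses (oU : open U) (cn : affine_connection U nabla).
Implicit Types (V W : set (plane R)) (p q : plane R) (i j : 'I_2) (X Y Z : vfield R).

#[local] Opaque partial derive.

Definition efield i : vfield R := fun=> 'e_i.

Lemma smooth_efield V i : smooth V (efield i).
Proof. by move=> k; exact: Ck_cst. Qed.

Lemma vsmooth_efield p i : vsmooth_near p (efield i).
Proof. by exists setT; split; [exact: openT| |exact: smooth_efield]. Qed.

Lemma vgerm_efield0 p : vgerm p (efield ix0) = frame0 (germ_alg p).
Proof.
rewrite /vgerm /frame0 (_ : component _ _ = fun=> 1); last first.
  by apply/funext => q; rewrite /component /efield mxE !eqxx.
rewrite (_ : component _ _ = fun=> 0) ?germ_of0 ?germ_of1//.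
by apply/funext => q; rewrite /component /efield mxE eqxx ix1_neq0.
Qed.

Lemma vgerm_efield1 p : vgerm p (efield ix1) = frame1 (germ_alg p).
Proof.
rewrite /vgerm /frame1 (_ : component _ _ = fun=> 0); last first.
  by apply/funext => q; rewrite /component /efield mxE eqxx ix0_neq1.
rewrite (_ : component _ _ = fun=> 1) ?germ_of0 ?germ_of1//.
by apply/funext => q; rewrite /component /efield mxE !eqxx.
Qed.

Lemma field_decomp X :
  X = fscale (component ix0 X) (efield ix0) + fscale (component ix1 X) (efield ix1).
Proof.
apply/funext => q; apply: planeP; rewrite /component /fscale /efield !fctE !mxE !eqxx ?ix0_neq1 ?ix1_neq0.
  by rewrite mulr1 mulr0 addr0.
by rewrite mulr1 mulr0 add0r.
Qed.

(** Defined at every point [p], since a Killing germ must be shown to satisfy its equation on a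
    whole neighborhood of the origin. *)
Definition christoffel_at p : christoffel (germ_alg p) :=
  Christoffel (G := germ_alg p) (vgerm p (nabla (efield ix0) (efield ix0)))
    (vgerm p (nabla (efield ix0) (efield ix1))) (vgerm p (nabla (efield ix1) (efield ix0)))
    (vgerm p (nabla (efield ix1) (efield ix1))).

Lemma vsmooth_near2 p X Y : U p -> vsmooth_near p X -> vsmooth_near p Y ->
  exists V, [/\ open V, V p, V `<=` U & smooth V X /\ smooth V Y].
Proof.
move=> Up [V [oV Vp CX]] [W [oW Wp CY]]; exists (U `&` (V `&` W)); split.
- by apply: openI => //; exact: openI.
- by split.
- by move=> q [].
- by split=> k; [apply: Ck_sub (CX k)|apply: Ck_sub (CY k)]; move=> q [_ []].
Qed.

Lemma vsmooth_nabla p X Y : U p -> vsmooth_near p X -> vsmooth_near p Y ->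
  vsmooth_near p (nabla X Y).
Proof.
move=> Up sX sY; have [V [oV Vp VU [CX CY]]] := vsmooth_near2 Up sX sY.
by exists V; split=> //; exact: (conn_smooth cn).
Qed.

Lemma smooth_fscale V (f : plane R -> R) X : open V -> smooth V f -> smooth V X -> smooth V (fscale f X).
Proof.
move=> oV Cf CX; apply/(smooth_coordP _ oV) => j k; rewrite coord_fscale.
by apply: CkM => //; exact: (smooth_coordP _ oV).1.
Qed.

Lemma vgerm_nabla_eq p V X X' : open V -> V p -> smooth V X -> smooth V X' ->
  {in V, X =1 X'} -> vgerm p X = vgerm p X'.
Proof.
move=> oV Vp CX CX' e; apply/(vgerm_eq (vsmooth_of oV Vp CX) (vsmooth_of oV Vp CX')).
by apply: filterS (open_near oV Vp) => q Vq; apply: e; rewrite inE.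
Qed.

(** In the constant frame, additivity and the Leibniz rule reduce [nabla] to its values on frame
    fields. *)
Lemma vgerm_nabla p X Y : U p -> vsmooth_near p X -> vsmooth_near p Y ->
  vgerm p (nabla X Y) = nab (christoffel_at p) (vgerm p X) (vgerm p Y).
Proof.
move=> Up sX sY; have [V [oV Vp VU [CX CY]]] := vsmooth_near2 Up sX sY.
have cX j := (smooth_coordP X oV).1 CX j; have cY j := (smooth_coordP Y oV).1 CY j.
have ce i := @smooth_efield V i.
have E := field_decomp.
have nadd Z Z' T : smooth V Z -> smooth V Z' -> smooth V T ->
    vgerm p (nabla (Z + Z') T) = vgerm p (nabla Z T) + vgerm p (nabla Z' T).
  move=> a b c; have s1 := conn_smooth cn oV VU a c; have s2 := conn_smooth cn oV VU b c.
  have s3 : smooth V (Z + Z') by move=> k; exact: CkD.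
  rewrite -vgermD; [|exact: vsmooth_of s1|exact: vsmooth_of s2].
  have s4 : smooth V (nabla Z T + nabla Z' T) by move=> k; exact: CkD.
  exact: (vgerm_nabla_eq oV Vp (conn_smooth cn oV VU s3 c) s4 (conn_addl cn oV VU a b c)).
have naddr Z T T' : smooth V Z -> smooth V T -> smooth V T' ->
    vgerm p (nabla Z (T + T')) = vgerm p (nabla Z T) + vgerm p (nabla Z T').
  move=> a b c; have s1 := conn_smooth cn oV VU a b; have s2 := conn_smooth cn oV VU a c.
  have s3 : smooth V (T + T') by move=> k; exact: CkD.
  rewrite -vgermD; [|exact: vsmooth_of s1|exact: vsmooth_of s2].
  have s4 : smooth V (nabla Z T + nabla Z T') by move=> k; exact: CkD.
  exact: (vgerm_nabla_eq oV Vp (conn_smooth cn oV VU a s3) s4 (conn_addr cn oV VU a b c)).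
have nsc f g i j : smooth V f -> smooth V g -> vgerm p (nabla (fscale f (efield i)) (fscale g (efield j))) =
   vscale (G := germ_alg p) (germ_of p f * germ_of p g) (vgerm p (nabla (efield i) (efield j))) +
   vscale (G := germ_alg p) (germ_of p f * germ_diff i (germ_of p g)) (vgerm p (efield j)).
  move=> Cf Cg; have sf : f \in smooth_near p by apply/smooth_nearP; exists V.
  have sg : g \in smooth_near p by apply/smooth_nearP; exists V.
  have sdg : partial i g \in smooth_near p := smooth_near_partial i sg.
  have sn : smooth V (nabla (efield i) (efield j)) by exact: (conn_smooth cn).
  have Cfg : smooth V (f * g) by move=> k; exact: CkM.
  have Cfd : smooth V (f * partial i g).
    by move=> k; apply: CkM => //; exact: (Ck_partial i (Cg k.+1)).
  have a1 : smooth V (fscale f (efield i)) by exact: smooth_fscale.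
  have a2 : smooth V (fscale g (efield j)) by exact: smooth_fscale.
  have b1 : smooth V (fscale (f * g) (nabla (efield i) (efield j))) by exact: smooth_fscale.
  have b2 : smooth V (fscale (f * partial i g) (efield j)) by exact: smooth_fscale.
  have b3 : smooth V (fscale (f * g) (nabla (efield i) (efield j)) + fscale (f * partial i g) (efield j)).
    by move=> k; exact: CkD.
  rewrite (vgerm_nabla_eq oV Vp (conn_smooth cn oV VU a1 a2) b3
    (conn_leibniz cn oV VU Cf Cg (ce i) (ce j))).
  rewrite vgermD; [|exact: vsmooth_of b1|exact: vsmooth_of b2].
  rewrite vgerm_fscale; [|by apply/smooth_nearP; exists V|exact: vsmooth_of sn].
  rewrite vgerm_fscale; [|by apply/smooth_nearP; exists V|exact: vsmooth_efield].
  by rewrite (germ_ofM sf sg) (germ_ofM sf sdg) (germ_diff_of i sg).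
have sc (Z : vfield R) i j : smooth V Z -> smooth V (fscale (component i Z) (efield j)).
  by move=> CZ; apply: smooth_fscale => //; exact: (smooth_coordP Z oV).1.
have sX' : smooth V (fscale (component ix0 X) (efield ix0) + fscale (component ix1 X) (efield ix1)).
  by rewrite -E.
have sX0 := sc X ix0 ix0 CX; have sX1 := sc X ix1 ix1 CX.
have sY0 := sc Y ix0 ix0 CY; have sY1 := sc Y ix1 ix1 CY.
have -> : vgerm p (nabla X Y) =
    vgerm p (nabla (fscale (component ix0 X) (efield ix0) + fscale (component ix1 X) (efield ix1))
      (fscale (component ix0 Y) (efield ix0) + fscale (component ix1 Y) (efield ix1))).
  by rewrite -!E.
rewrite (naddr _ _ _ sX' sY0 sY1) (nadd _ _ _ sX0 sX1 sY0) (nadd _ _ _ sX0 sX1 sY1).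
rewrite !(nsc _ _ _ _ (cX _) (cY _)) vgerm_efield0 vgerm_efield1 /nab /christoffel_at /der.
rewrite [vgerm p X]/vgerm [vgerm p Y]/vgerm.
move: (vgerm p (nabla (efield ix0) (efield ix0))) (vgerm p (nabla (efield ix0) (efield ix1)))
  (vgerm p (nabla (efield ix1) (efield ix0))) (vgerm p (nabla (efield ix1) (efield ix1))) => c00 c01 c10 c11.
rewrite /=.
move: (germ_of p (component ix0 X)) (germ_of p (component ix1 X))
  (germ_of p (component ix0 Y)) (germ_of p (component ix1 Y)) => x0 x1 y0 y1.
move: (germ_diff ix0 y0) (germ_diff ix1 y0) (germ_diff ix0 y1) (germ_diff ix1 y1) => a b c d.
by apply: (@vecP R (germ_alg p)); rewrite /=; ring.
Qed.

End ConnectionGerms.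

(** * Killing fields and their germs *)

Section KillingGerms.
Context {R : realType} (U : set (plane R)) (nabla : vfield R -> vfield R -> vfield R).
Hypotheses (oU : open U) (cn : affine_connection U nabla).
Implicit Types (V W : set (plane R)) (p q : plane R) (i j : 'I_2) (X Y Z : vfield R).
Local Notation chr p := (christoffel_at nabla p).

#[local] Opaque partial derive.

Lemma vsmooth0 p : vsmooth_near p (0 : vfield R).
Proof. by exists setT; split=> //; [exact: openT|move=> k; exact: Ck_cst]. Qed.

Lemma vgerm0 p : vgerm p (0 : vfield R) = 0.
Proof.
have s0 := vsmooth0 p; have := vgermB s0 s0; rewrite subrr => ->.
exact: (subrr (vgerm p (0 : vfield R))).
Qed.

Lemma vgerm_eq0 p X : vsmooth_near p X -> vgerm p X = 0 <-> \forall q \near p, X q = 0.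
Proof. by move=> sX; rewrite -(vgerm0 p) (vgerm_eq sX (vsmooth0 p)). Qed.

Lemma vgerm_point p X : vsmooth_near p X -> vgerm p X = 0 -> X p = 0.
Proof.
by move=> sX /(vgerm_eq0 sX) e; have Fp : ProperFilter (nbhs p) := nbhs_pfilter p; exact: nbhs_singleton e.
Qed.

Definition killing_defect X Y Z : vfield R :=
  lie_bracket X (nabla Y Z) - nabla (lie_bracket X Y) Z - nabla Y (lie_bracket X Z).

Lemma vgerm_killing_defect p X Y Z : U p -> vsmooth_near p X -> vsmooth_near p Y ->
  vsmooth_near p Z -> vsmooth_near p (killing_defect X Y Z) /\
  vgerm p (killing_defect X Y Z) = lie_nab (chr p) (vgerm p X) (vgerm p Y) (vgerm p Z).
Proof.
move=> Up sX sY sZ; have [sXY eXY] := vgerm_bracket sX sY; have [sXZ eXZ] := vgerm_bracket sX sZ.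
have sn := vsmooth_nabla oU cn Up sY sZ; have [sb eb] := vgerm_bracket sX sn.
have s1 := vsmooth_nabla oU cn Up sXY sZ; have s2 := vsmooth_nabla oU cn Up sY sXZ.
have s3 : vsmooth_near p (lie_bracket X (nabla Y Z) - nabla (lie_bracket X Y) Z).
  by apply: vsmoothD => //; exact: vsmoothN.
split; first by apply: vsmoothD => //; exact: vsmoothN.
have e1 := vgerm_nabla oU cn Up sXY sZ; have e2 := vgerm_nabla oU cn Up sY sXZ.
rewrite eXY in e1; rewrite eXZ in e2; rewrite (vgerm_nabla oU cn Up sY sZ) in eb.
by rewrite /killing_defect (vgermB s3 s2) (vgermB sb s1) eb e1 e2.
Qed.

Lemma vgerm_torsion p X Y : U p -> vsmooth_near p X -> vsmooth_near p Y ->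
  vsmooth_near p (torsion nabla X Y) /\
  vgerm p (torsion nabla X Y) = tors (chr p) (vgerm p X) (vgerm p Y).
Proof.
move=> Up sX sY; have [sXY eXY] := vgerm_bracket sX sY.
have s1 := vsmooth_nabla oU cn Up sX sY; have s2 := vsmooth_nabla oU cn Up sY sX.
have s3 : vsmooth_near p (nabla X Y - nabla Y X) by apply: vsmoothD => //; exact: vsmoothN.
split; first by apply: vsmoothD => //; exact: vsmoothN.
rewrite /torsion (vgermB s3 sXY) (vgermB s1 s2) eXY.
by rewrite (vgerm_nabla oU cn Up sX sY) (vgerm_nabla oU cn Up sY sX).
Qed.

Lemma vgerm_curvature p X Y Z : U p -> vsmooth_near p X -> vsmooth_near p Y ->
  vsmooth_near p Z -> vsmooth_near p (curvature nabla X Y Z) /\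
  vgerm p (curvature nabla X Y Z) = curv (chr p) (vgerm p X) (vgerm p Y) (vgerm p Z).
Proof.
move=> Up sX sY sZ; have [sXY eXY] := vgerm_bracket sX sY.
have sYZ := vsmooth_nabla oU cn Up sY sZ; have sXZ := vsmooth_nabla oU cn Up sX sZ.
have s1 := vsmooth_nabla oU cn Up sX sYZ; have s2 := vsmooth_nabla oU cn Up sY sXZ.
have s4 := vsmooth_nabla oU cn Up sXY sZ.
have s3 : vsmooth_near p (nabla X (nabla Y Z) - nabla Y (nabla X Z)).
  by apply: vsmoothD => //; exact: vsmoothN.
split; first by apply: vsmoothD => //; exact: vsmoothN.
rewrite /curvature (vgermB s3 s4) (vgermB s1 s2) (vgerm_nabla oU cn Up sX sYZ).
rewrite (vgerm_nabla oU cn Up sY sXZ) (vgerm_nabla oU cn Up sXY sZ) eXY.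
by rewrite (vgerm_nabla oU cn Up sY sZ) (vgerm_nabla oU cn Up sX sZ).
Qed.

Lemma defect_killing X Y Z q : killing_defect X Y Z q = 0 <->
  (lie_bracket X (nabla Y Z) - nabla Y (lie_bracket X Z)) q = nabla (lie_bracket X Y) Z q.
Proof.
rewrite /killing_defect !fctE addrAC; split=> [/subr0_eq//|->]; by rewrite subrr.
Qed.

Lemma killing_at V p X : open V -> V `<=` U -> V p -> killing V nabla X ->
  kil (chr p) (vgerm p X).
Proof.
move=> oV VU Vp [CX K] y z; have Up := VU _ Vp.
have sX : vsmooth_near p X := vsmooth_of oV Vp CX.
have [Y sY <-] := vgermP y; have [Z sZ <-] := vgermP z.
have [sF <-] := vgerm_killing_defect Up sX sY sZ; apply/(vgerm_eq0 sF).
have [W [oW Wp WV [CY CZ]]] := vsmooth_near2 oV Vp sY sZ.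
apply: filterS (open_near oW Wp) => q Wq; apply/defect_killing.
by apply: (K W) => //; rewrite inE.
Qed.

(** The equation for germs at the origin makes the defect vanish near the origin on constant fields;
    being tensorial, the defect then vanishes at each nearby point on all fields, including those
    defined only around that point. *)
Lemma kil_spread X : U 0 -> vsmooth_near 0 X -> kil (chr 0) (vgerm 0 X) ->
  exists V, [/\ open V, V 0, V `<=` U & killing V nabla X].
Proof.
move=> U0 sX k0.
have D i j : \forall q \near (0 : plane R), killing_defect X (efield i) (efield j) q = 0.
  have [sF eF] := vgerm_killing_defect U0 sX (vsmooth_efield 0 i) (vsmooth_efield 0 j).
  by apply/(vgerm_eq0 sF); rewrite eF k0.
have [V0 [oV0 V00 CX]] := sX.
have F0 : Filter (nbhs (0 : plane R)) := nbhs_filter (0 : plane R).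
have [V1 [oV1 V10 D1]] := open_near_set
  (filterI (filterI (D ix0 ix0) (D ix0 ix1)) (filterI (D ix1 ix0) (D ix1 ix1))).
exists (U `&` (V0 `&` V1)); split.
- by apply: openI => //; exact: openI.
- by split.
- by move=> q [].
split=> [k|]; first by apply: Ck_sub (CX k); move=> q [_ []].
move=> W Y Z oW WV CY CZ q; rewrite inE => Wq; apply/defect_killing.
have [Uq [V0q V1q]] := WV _ Wq.
have sXq := vsmooth_of oV0 V0q CX; have sYq := vsmooth_of oW Wq CY; have sZq := vsmooth_of oW Wq CZ.
have [sF eF] := vgerm_killing_defect Uq sXq sYq sZq; apply: (vgerm_point sF); rewrite eF.
have Fq : Filter (nbhs q) := nbhs_filter q.
have Dq i j : lie_nab (chr q) (vgerm q X) (vgerm q (efield i)) (vgerm q (efield j)) = 0.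
  have [sG <-] := vgerm_killing_defect Uq sXq (vsmooth_efield q i) (vsmooth_efield q j).
  apply/(vgerm_eq0 sG); apply: filterS (open_near oV1 V1q) => r /D1 [[D00 D01] [D10 D11]].
  by case: (ord2 i) => ->; case: (ord2 j) => ->.
suff kq : kil (chr q) (vgerm q X) by exact: kq.
apply/kilP; rewrite -vgerm_efield0 -vgerm_efield1; split; exact: Dq.
Qed.

Lemma killing_germP X : U 0 -> killing_germ U nabla X <->
  vsmooth_near 0 X /\ kil (chr 0) (vgerm 0 X).
Proof.
move=> U0; split=> [[V [oV V0 VU K]]|[sX kX]]; last exact: kil_spread.
by split; [exact: vsmooth_of oV V0 K.1|exact: killing_at K].
Qed.

Lemma flat_spread : U 0 -> flat_germ (chr 0) ->
  exists V, [/\ open V, V 0, V `<=` U, torsion_free V nabla & flat V nabla].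
Proof.
move=> U0 [t0 c0]; have F0 : Filter (nbhs (0 : plane R)) := nbhs_filter (0 : plane R).
have T : \forall q \near (0 : plane R), torsion nabla (efield ix0) (efield ix1) q = 0.
  have [sF eF] := vgerm_torsion U0 (vsmooth_efield 0 ix0) (vsmooth_efield 0 ix1).
  by apply/(vgerm_eq0 sF); rewrite eF t0.
have K i : \forall q \near (0 : plane R), curvature nabla (efield ix0) (efield ix1) (efield i) q = 0.
  have [sF eF] := vgerm_curvature U0 (vsmooth_efield 0 ix0) (vsmooth_efield 0 ix1) (vsmooth_efield 0 i).
  by apply/(vgerm_eq0 sF); rewrite eF c0.
have [V1 [oV1 V10 D1]] := open_near_set (filterI T (filterI (K ix0) (K ix1))).
have fl q : U q -> V1 q -> flat_germ (chr q).
  move=> Uq V1q; have Fq : Filter (nbhs q) := nbhs_filter q.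
  have s0 := vsmooth_efield q ix0; have s1 := vsmooth_efield q ix1.
  apply: (flat_germ_frame (@wedge_frame _ (germ_alg q))); rewrite -vgerm_efield0 -vgerm_efield1.
  - have [sG eG] := vgerm_torsion Uq s0 s1; apply: etrans (esym eG) _.
    by apply/(vgerm_eq0 sG); apply: filterS (open_near oV1 V1q) => r /D1 [].
  - have [sG eG] := vgerm_curvature Uq s0 s1 s0; apply: etrans (esym eG) _.
    by apply/(vgerm_eq0 sG); apply: filterS (open_near oV1 V1q) => r /D1 [_ []].
  - have [sG eG] := vgerm_curvature Uq s0 s1 s1; apply: etrans (esym eG) _.
    by apply/(vgerm_eq0 sG); apply: filterS (open_near oV1 V1q) => r /D1 [_ []].
exists (U `&` V1); split=> //.
- exact: openI.
- move=> W X Y oW WV CX CY q; rewrite inE => Wq; have [Uq V1q] := WV _ Wq.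
  have [sG eG] := vgerm_torsion Uq (vsmooth_of oW Wq CX) (vsmooth_of oW Wq CY).
  by apply: (vgerm_point sG); rewrite eG; exact: (fl q Uq V1q).1.
- move=> W X Y Z oW WV CX CY CZ q; rewrite inE => Wq; have [Uq V1q] := WV _ Wq.
  have [sG eG] := vgerm_curvature Uq (vsmooth_of oW Wq CX) (vsmooth_of oW Wq CY) (vsmooth_of oW Wq CZ).
  by apply: (vgerm_point sG); rewrite eG; exact: (fl q Uq V1q).2.
Qed.

End KillingGerms.

Section OrdinalCases.

Lemma ordinal2_cases (P : 'I_2 -> Prop) : P ord0 -> P (lift ord0 ord0) -> forall i, P i.
Proof.
move=> p0 p1 [[|[|//]] lt]; first by rewrite (_ : Ordinal lt = ord0)//; apply: val_inj.
by rewrite (_ : Ordinal lt = lift ord0 ord0)//; apply: val_inj.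
Qed.

Lemma ordinal3_cases (P : 'I_3 -> Prop) :
  P ord0 -> P (lift ord0 ord0) -> P (lift ord0 (lift ord0 ord0)) -> forall i, P i.
Proof.
move=> p0 p1 p2 [[|[|[|//]]] lt]; first by rewrite (_ : Ordinal lt = ord0)//; apply: val_inj.
  by rewrite (_ : Ordinal lt = lift ord0 ord0)//; apply: val_inj.
by rewrite (_ : Ordinal lt = lift ord0 (lift ord0 ord0))//; apply: val_inj.
Qed.

Lemma ordinal4_cases (P : 'I_4 -> Prop) : P ord0 -> P (lift ord0 ord0) ->
  P (lift ord0 (lift ord0 ord0)) -> P (lift ord0 (lift ord0 (lift ord0 ord0))) -> forall i, P i.
Proof.
move=> p0 p1 p2 p3 [[|[|[|[|//]]]] lt]; first by rewrite (_ : Ordinal lt = ord0)//; apply: val_inj.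
- by rewrite (_ : Ordinal lt = lift ord0 ord0)//; apply: val_inj.
- by rewrite (_ : Ordinal lt = lift ord0 (lift ord0 ord0))//; apply: val_inj.
by rewrite (_ : Ordinal lt = lift ord0 (lift ord0 (lift ord0 ord0)))//; apply: val_inj.
Qed.

End OrdinalCases.

(** * Bases and dimension of the Killing algebra *)

Section Dimension.
Context {R : realType} (U : set (plane R)) (nabla : vfield R -> vfield R -> vfield R).
Hypotheses (oU : open U) (cn : affine_connection U nabla) (U0 : U 0).
Implicit Types (X Y Z : vfield R).
Local Notation K := (killing_germ U nabla).
Local Notation G := (germ_alg (0 : plane R)).
Local Notation C := (christoffel_at nabla 0).
Local Notation vec := (ga_ring G * ga_ring G)%type.
Local Notation "r *v X" := (vscale (G := G) (ga_cst G r) X) (at level 40).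
Local Notation KP := (fun X => killing_germP oU cn X U0).

#[local] Opaque partial derive.

Lemma kil_frame_of : (exists X1 X2, [/\ K X1, K X2 & free [:: X1 0; X2 0]]) -> kil_frame C.
Proof.
move=> [X [Y [/KP[sX kX] /KP[sY kY] fr]]]; exists (vgerm 0 X), (vgerm 0 Y); split=> //.
have x0 : ga_ev G (vgerm 0 X).1 = X 0 0 ix0 := congr1 fst (vgerm_ev sX).
have x1 : ga_ev G (vgerm 0 X).2 = X 0 0 ix1 := congr1 snd (vgerm_ev sX).
have y0 : ga_ev G (vgerm 0 Y).1 = Y 0 0 ix0 := congr1 fst (vgerm_ev sY).
have y1 : ga_ev G (vgerm 0 Y).2 = Y 0 0 ix1 := congr1 snd (vgerm_ev sY).
rewrite /wedge rmorphB !rmorphM x0 x1 y0 y1.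
move: fr; rewrite free_cons span_seq1 seq1_free; move: (X 0) (Y 0) => v w /andP[vw w0].
apply: contraNneq vw => det; apply/vlineP.
have [w00|w00] := eqVneq (w 0 ix0) 0; last first.
  exists (v 0 ix0 / w 0 ix0); apply: planeP; rewrite !mxE; first by field.
  apply: (mulIf w00); rewrite (_ : _ / _ * _ * _ = v 0 ix0 * w 0 ix1); last by field.
  by move/subr0_eq: det => ->; rewrite mulrC.
have [w10|w10] := eqVneq (w 0 ix1) 0.
  by case/eqP: w0; apply: planeP; rewrite mxE.
exists (v 0 ix1 / w 0 ix1); apply: planeP; rewrite !mxE; last by field.
rewrite w00 mulr0; apply: (mulIf w10); rewrite mul0r.
by move/subr0_eq: det => ->; rewrite w00 mulr0.
Qed.

Lemma killing_eq X Y : germ_eq X Y -> K Y -> K X.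
Proof.
move=> e /KP[sY kY]; have e' : \forall q \near (0 : plane R), Y q = X q.
  by apply: filterS e => q ->.
have sX := near_eq_vsmooth e' sY; apply/KP; split; first exact: sX.
by rewrite ((vgerm_eq sX sY).2 e).
Qed.

Lemma fscale_cst (c : R) X : c *: X = fscale (fun=> c) X. Proof. by []. Qed.

Lemma vsmooth_scale c X : vsmooth_near 0 X -> vsmooth_near 0 (c *: X).
Proof. by move=> sX; rewrite fscale_cst; apply: vsmooth_fscale => //; exact: smooth_near_cst. Qed.

Lemma vgerm_scale c X : vsmooth_near 0 X -> vgerm 0 (c *: X) = c *v vgerm 0 X.
Proof. by move=> sX; rewrite fscale_cst vgerm_fscale//; exact: smooth_near_cst. Qed.

Lemma vgerm_sum m (c : 'I_m -> R) (F : 'I_m -> vfield R) : (forall i, vsmooth_near 0 (F i)) ->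
  vsmooth_near 0 (\sum_i c i *: F i) /\
  vgerm 0 (\sum_i c i *: F i) = \sum_i (c i *v vgerm 0 (F i)).
Proof.
move=> sF; elim/big_rec2: _ => [|i y X _ [sX eX]]; first by split; [exact: vsmooth0|rewrite vgerm0].
have sFi := vsmooth_scale (c i) (sF i).
by split; [exact: vsmoothD|rewrite vgermD// vgerm_scale// eX].
Qed.

Lemma kil_sum m (c : 'I_m -> R) (v : 'I_m -> vec) : (forall i, kil C (v i)) ->
  kil C (\sum_i (c i *v v i)).
Proof.
move=> kv; have k0 : kil C 0.
  by move=> Y Z; rewrite /lie_nab !br_zero_l nab_zero_l nab_zero_r !subr0.
apply: (big_ind (kil C) k0 (fun x y => @kil_add _ _ C x y)) => i _.
exact: kil_cst (kv i).
Qed.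

Lemma killing_span S : S `<=` K -> (forall v : vec, kil C v -> exists m (c : 'I_m -> R) F,
    (forall i, S (F i)) /\ v = \sum_i (c i *v vgerm 0 (F i))) -> K = germ_span S.
Proof.
move=> SK H; apply/seteqP; split=> X.
  move=> /KP[sX kX]; have [m [c [F [SF e]]]] := H _ kX; exists m, c, F; split=> //.
  have sF i : vsmooth_near 0 (F i) by have /KP[] := SK _ (SF i).
  have [sS eS] := vgerm_sum c sF.
  by apply/(vgerm_eq sX sS); rewrite eS.
move=> [m [c [F [SF e]]]]; apply: (killing_eq e); apply/KP.
have sF i : vsmooth_near 0 (F i) by have /KP[] := SK _ (SF i).
have [sS eS] := vgerm_sum c sF; split=> //; rewrite eS; apply: kil_sum => i.
by have /KP[] := SK _ (SF i).
Qed.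

Lemma germ_dim_basis n (v : 'I_n -> vec) : (forall i, kil C (v i)) ->
  (forall c : 'I_n -> R, \sum_i (c i *v v i) = 0 -> forall i, c i = 0) ->
  (forall V, kil C V -> exists c : 'I_n -> R, V = \sum_i (c i *v v i)) -> germ_dim K n.
Proof.
move=> kv indep span.
have ex i : exists X, vsmooth_near 0 X /\ vgerm 0 X = v i.
  by have [X sX e] := vgermP (v i); exists X.
have [b bP] := choice ex.
have sb i := (bP i).1; exists b; split=> [c e|].
  have [sS eS] := vgerm_sum c sb; apply: indep.
  have := (vgerm_eq sS (vsmooth0 0)).2 e; rewrite vgerm0 eS => e'.
  by rewrite -[RHS]e'; apply: eq_bigr => i _; rewrite (bP i).2.
apply: killing_span => [X [i _ <-]|V /span[c ->]].
  by apply/KP; split; [exact: sb|rewrite (bP i).2; exact: kv].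
exists n, c, b; split=> [i|]; first by exists i.
by apply: eq_bigr => i _; rewrite (bP i).2.
Qed.

Lemma germ_dim2 (X Y : vec) : kil C X -> kil C Y -> ga_ev G (wedge X Y) != 0 ->
  (forall V, kil C V -> exists a b, V = a *v X + b *v Y) -> germ_dim K 2.
Proof.
move=> kX kY w0 span; pose v (i : 'I_2) := [:: X; Y]`_i.
have sumE (c : 'I_2 -> R) : \sum_i (c i *v v i) = c ord0 *v X + c (lift ord0 ord0) *v Y.
  rewrite !big_ord_recl big_ord0 addr0; reflexivity.
apply: (@germ_dim_basis _ v) => [|c|V /span[a [b ->]]].
- exact: (ordinal2_cases kX kY).
- rewrite sumE => e; have [c0 c1] : c ord0 = 0 /\ c (lift ord0 ord0) = 0.
    by apply: (frame_indep w0); rewrite e /evv !rmorph0.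
  exact: ordinal2_cases.
exists (fun i => [:: a; b]`_i); rewrite sumE; reflexivity.
Qed.

Lemma germ_dim3 (e1 e2 e3 : vec) : kil C e1 -> kil C e2 -> kil C e3 ->
  (forall p q r, p *v e1 + q *v e2 + r *v e3 = 0 -> [/\ p = 0, q = 0 & r = 0]) ->
  (forall V, kil C V -> exists p q r, V = p *v e1 + q *v e2 + r *v e3) -> germ_dim K 3.
Proof.
move=> k1 k2 k3 indep span; pose v (i : 'I_3) := [:: e1; e2; e3]`_i.
have sumE (c : 'I_3 -> R) : \sum_i (c i *v v i) =
    c ord0 *v e1 + c (lift ord0 ord0) *v e2 + c (lift ord0 (lift ord0 ord0)) *v e3.
  rewrite !big_ord_recl big_ord0 addr0 addrA; reflexivity.
apply: (@germ_dim_basis _ v) => [|c|V /span[a [b [d ->]]]].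
- exact: (ordinal3_cases k1 k2 k3).
- rewrite sumE => /indep[c0 c1 c2]; exact: ordinal3_cases.
exists (fun i => [:: a; b; d]`_i); rewrite sumE; reflexivity.
Qed.

Lemma germ_dim4 (e1 e2 e3 e4 : vec) : kil C e1 -> kil C e2 -> kil C e3 -> kil C e4 ->
  (forall p q r s, p *v e1 + q *v e2 + r *v e3 + s *v e4 = 0 ->
     [/\ p = 0, q = 0, r = 0 & s = 0]) ->
  (forall V, kil C V -> exists p q r s, V = p *v e1 + q *v e2 + r *v e3 + s *v e4) ->
  germ_dim K 4.
Proof.
move=> k1 k2 k3 k4 indep span; pose v (i : 'I_4) := [:: e1; e2; e3; e4]`_i.
have sumE (c : 'I_4 -> R) : \sum_i (c i *v v i) =
    c ord0 *v e1 + c (lift ord0 ord0) *v e2 + c (lift ord0 (lift ord0 ord0)) *v e3 +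
    c (lift ord0 (lift ord0 (lift ord0 ord0))) *v e4.
  rewrite !big_ord_recl big_ord0 addr0 !addrA; reflexivity.
apply: (@germ_dim_basis _ v) => [|c|V /span[a [b [d [f ->]]]]].
- exact: (ordinal4_cases k1 k2 k3 k4).
- rewrite sumE => /indep[c0 c1 c2 c3]; exact: ordinal4_cases.
exists (fun i => [:: a; b; d; f]`_i); rewrite sumE; reflexivity.
Qed.

End Dimension.

(** * Lie algebras of dimension three *)

Section NormalForm.
Context {R : realType} (G : germ_algebra R).
Local Notation A := (ga_ring G).
Local Notation cst := (ga_cst G).
Local Notation vec := (A * A)%type.
Implicit Types (X Y Z W U V : vec) (f g x y : A) (r s : R) (C : christoffel G).

Local Notation "r *v X" := (vscale (cst r) X) (at level 40).

Lemma simple_basis_rotate C e1 e2 e3 (al be ga : R) :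
  simple_basis C e1 e2 e3 al be ga -> simple_basis C e2 e3 e1 be ga al.
Proof.
move=> [[k1 k2 k3] [a0 b0 c0] [b12 b23 b31] indep span]; split; [by split|by split|by split| |].
  move=> p q r e; have [] // : [/\ r = 0, p = 0 & q = 0].
    by apply: indep; rewrite -e -addrA addrC.
move=> V /span[p [q [r ->]]]; exists q, r, p; by rewrite -addrA addrC.
Qed.

Lemma simple_basis_scale C e1 e2 e3 (al be ga l1 l2 l3 : R) : l1 != 0 -> l2 != 0 -> l3 != 0 ->
  simple_basis C e1 e2 e3 al be ga ->
  simple_basis C (l1 *v e1) (l2 *v e2) (l3 *v e3)
    (l2 * l3 * al / l1) (l3 * l1 * be / l2) (l1 * l2 * ga / l3).
Proof.
move=> n1 n2 n3 [[k1 k2 k3] [a0 b0 c0] [b12 b23 b31] indep span]; split.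
- by split; exact: kil_cst.
- by rewrite !mulf_neq0 ?invr_eq0.
- rewrite !br_cst_l !br_cst_r b12 b23 b31 !vcstA.
  by split; congr (vscale (ga_cst G _) _); field.
- move=> p q r; rewrite !vcstA => /indep[/eqP + /eqP + /eqP]; rewrite !mulf_eq0.
  by rewrite (negPf n1) (negPf n2) (negPf n3) !orbF => /eqP -> /eqP -> /eqP ->.
move=> V /span[p [q [r ->]]]; exists (p / l1), (q / l2), (r / l3).
by rewrite !vcstA !divfK.
Qed.

Lemma signed_square (al : R) : al != 0 -> exists s (x : R), [/\ (s == 1) || (s == - 1), x != 0 & al = s * (x * x)].
Proof.
move=> a0; exists (Num.sg al), (Num.sqrt `|al|); split.
- by case: sgrP a0; rewrite ?eqxx ?orbT.
- by rewrite sqrtr_eq0 -ltNge normr_gt0.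
by rewrite -expr2 sqr_sqrtr// -numEsg.
Qed.

(** Rescaling reduces the three coefficients to signs, and only their agreement matters: three equal
    signs give the first form, and otherwise a reversal and rotations give the second. *)
Lemma simple_basis_normal C e1 e2 e3 (al be ga : R) : simple_basis C e1 e2 e3 al be ga ->
  exists f1 f2 f3 : vec, simple_basis C f1 f2 f3 1 1 1 \/ simple_basis C f1 f2 f3 (- 1) (- 1) 1.
Proof.
move=> B; have [_ [a0 b0 c0] _ _ _] := B.
have [s [x [sP x0 aE]]] := signed_square a0; have [t [y [tP y0 bE]]] := signed_square b0.
have [u [z [uP z0 cE]]] := signed_square c0.
have u0 : u != 0 by case/orP: uP => /eqP ->; rewrite ?oppr_eq0 oner_neq0.
(* With [al = s x x], [be = t y y] and [ga = u z z], these factors make the coefficients [s u],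
   [t u] and 1. *)
have l1 : (y * z)^-1 != 0 by rewrite invr_eq0 mulf_neq0.
have l2 : (x * z)^-1 != 0 by rewrite invr_eq0 mulf_neq0.
have l3 : u / (x * y) != 0 by rewrite mulf_neq0// invr_eq0 mulf_neq0.
have := simple_basis_scale l1 l2 l3 B; rewrite aE bE cE.
rewrite (_ : _ * _ * _ / (y * z)^-1 = s * u); last by field; rewrite x0 y0 z0.
rewrite (_ : _ * _ * _ / (x * z)^-1 = t * u); last by field; rewrite x0 y0 z0.
rewrite (_ : _ * _ * _ / (u / _) = 1); last by field; rewrite x0 y0 z0 u0.
move: (_ *v e1) (_ *v e2) (_ *v e3) => f1 f2 f3 {}B.
have o0 : (1 : R) != 0 by exact: oner_neq0.
have m0 : (- 1 : R) != 0 by rewrite oppr_eq0.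
have [] : s * u = 1 \/ s * u = - 1.
  by case/orP: sP => /eqP ->; case/orP: uP => /eqP ->; rewrite ?mulrNN !(mulr1, mul1r); [left|right|right|left].
all: have [] : t * u = 1 \/ t * u = - 1.
- by case/orP: tP => /eqP ->; case/orP: uP => /eqP ->; rewrite ?mulrNN !(mulr1, mul1r); [left|right|right|left].
- by move=> e e'; rewrite e e' in B; exists f1, f2, f3; left.
(* Signs (1, -1, 1): reversing the third vector gives (-1, 1, -1), and two rotations give (-1, -1,
   1). *)
- move=> e e'; rewrite e e' in B; have := simple_basis_scale o0 o0 m0 B.
  rewrite (_ : 1 * -1 * 1 / 1 = - 1); last by field.
  rewrite (_ : -1 * 1 * -1 / 1 = 1); last by field.
  rewrite (_ : 1 * 1 * 1 / -1 = - 1); last by field.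
  by move=> /simple_basis_rotate/simple_basis_rotate B'; do 3 eexists; right; exact: B'.
- by case/orP: tP => /eqP ->; case/orP: uP => /eqP ->; rewrite ?mulrNN !(mulr1, mul1r); [left|right|right|left].
(* Signs (-1, 1, 1): reversing the third vector gives (1, -1, -1), and one rotation gives (-1, -1,
   1). *)
- move=> e e'; rewrite e e' in B; have := simple_basis_scale o0 o0 m0 B.
  rewrite (_ : 1 * -1 * -1 / 1 = 1); last by field.
  rewrite (_ : -1 * 1 * 1 / 1 = - 1); last by field.
  rewrite (_ : 1 * 1 * 1 / -1 = - 1); last by field.
  by move=> /simple_basis_rotate B'; do 3 eexists; right; exact: B'.
by move=> e e'; rewrite e e' in B; exists f1, f2, f3; right.
Qed.

End NormalForm.

(** * Isomorphisms with o(3) and sl(2) *)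

Section LieIsomorphism.
Context {R : realType} (U : set (plane R)) (nabla : vfield R -> vfield R -> vfield R).
Hypotheses (oU : open U) (cn : affine_connection U nabla) (U0 : U 0).
Implicit Types (X Y Z : vfield R).
Local Notation K := (killing_germ U nabla).
Local Notation G := (germ_alg (0 : plane R)).
Local Notation C := (christoffel_at nabla 0).
Local Notation vec := (ga_ring G * ga_ring G)%type.
Local Notation "r *v X" := (vscale (G := G) (ga_cst G r) X) (at level 40).
Local Notation KP := (fun X => killing_germP oU cn X U0).

#[local] Opaque partial derive.

(** [k1], [k2], [k3] are linear coordinates on [g] in which the commutator has the structure
    constants of the basis; the isomorphism reads them as coefficients of [f1], [f2], [f3]. *)
Lemma lie_iso_coordinates n (g : set 'M[R]_n) (k1 k2 k3 : 'M[R]_n -> R) (f1 f2 f3 : vec) al be ga :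
  simple_basis C f1 f2 f3 al be ga ->
  (forall k, k \in [:: k1; k2; k3] -> forall a A B, k (a *: A + B) = a * k A + k B) ->
  (forall A B, g A -> g B -> [/\
     k1 (A *m B - B *m A) = al * (k2 A * k3 B - k3 A * k2 B),
     k2 (A *m B - B *m A) = be * (k3 A * k1 B - k1 A * k3 B) &
     k3 (A *m B - B *m A) = ga * (k1 A * k2 B - k2 A * k1 B)]) ->
  (forall A, g A -> k1 A = 0 -> k2 A = 0 -> k3 A = 0 -> A = 0) ->
  (forall p q r, exists A, [/\ g A, k1 A = p, k2 A = q & k3 A = r]) ->
  germ_lie_iso K g.
Proof.
move=> [[kf1 kf2 kf3] _ [b12 b23 b31] indep span] lin brk inj surj.
have [b1 s1 e1] := vgermP f1; have [b2 s2 e2] := vgermP f2; have [b3 s3 e3] := vgermP f3.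
pose theta A : vfield R := k1 A *: b1 + k2 A *: b2 + k3 A *: b3.
have sT A : vsmooth_near 0 (theta A).
  by apply: vsmoothD; [apply: vsmoothD|]; exact: vsmooth_scale.
have eT A : vgerm 0 (theta A) = k1 A *v f1 + k2 A *v f2 + k3 A *v f3.
  have t1 := vsmooth_scale (k1 A) s1; have t2 := vsmooth_scale (k2 A) s2.
  have t3 := vsmooth_scale (k3 A) s3; have t12 := vsmoothD t1 t2.
  by rewrite (vgermD t12 t3) (vgermD t1 t2) !vgerm_scale// e1 e2 e3.
have kT A : kil C (vgerm 0 (theta A)).
  by rewrite eT; apply: kil_add; [apply: kil_add|]; exact: kil_cst.
exists theta; split.
- by move=> A _; apply/KP; split; [exact: sT|exact: kT].
- move=> a A B _ _.
  have l1 : k1 (a *: A + B) = a * k1 A + k1 B by apply: lin; rewrite !inE eqxx.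
  have l2 : k2 (a *: A + B) = a * k2 A + k2 B by apply: lin; rewrite !inE eqxx orbT.
  have l3 : k3 (a *: A + B) = a * k3 A + k3 B by apply: lin; rewrite !inE eqxx !orbT.
  have sa := vsmooth_scale a (sT A).
  apply/(vgerm_eq (sT _) (vsmoothD sa (sT B))).
  rewrite (vgermD sa (sT B)) (vgerm_scale _ (sT A)) !eT l1 l2 l3.
  by generalize f1 f2 f3 => ? ? ?; apply: (@vecP R G); rewrite /= !rmorphD !rmorphM; ring.
- move=> A B gA gB; have [sB eB] := vgerm_bracket (sT A) (sT B).
  apply/(vgerm_eq (sT _) sB); rewrite eB !eT; have [-> -> ->] := brk _ _ gA gB.
  rewrite !(br_add_l, br_add_r) !br_cst_l !br_cst_r !br_self b12 b23 b31.
  rewrite (br_anti f2 f1) (br_anti f3 f2) (br_anti f1 f3) b12 b23 b31.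
  move: (k1 A) (k2 A) (k3 A) (k1 B) (k2 B) (k3 B) => x y z x' y' z'.
  by generalize f1 f2 f3 => ? ? ?; apply: (@vecP R G); rewrite /=; ring.
- move=> A gA /(vgerm_eq (sT A) (vsmooth0 0)); rewrite eT vgerm0 => /indep[x y z].
  exact: inj.
move=> X /KP[sX /span[p [q [r e]]]]; have [A [gA x y z]] := surj p q r.
by exists A => //; apply/(vgerm_eq sX (sT A)); rewrite eT x y z.
Qed.

(** A skew matrix is the cross product with a vector, whose entries are the chosen coordinates;
    commutators then become cross products. *)
Lemma killing_o3 (f1 f2 f3 : vec) : simple_basis C f1 f2 f3 1 1 1 -> germ_lie_iso K (o3 R).
Proof.
move=> B; pose i0 : 'I_3 := ord0; pose i1 : 'I_3 := lift ord0 ord0.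
pose i2 : 'I_3 := lift ord0 (lift ord0 ord0).
have anti (A : 'M[R]_3) : o3 R A -> forall i j, A j i = - A i j.
  by move=> oA i j; have := congr1 (fun M : 'M[R]_3 => M i j) oA; rewrite !mxE.
have diag (A : 'M[R]_3) : o3 R A -> forall i, A i i = 0.
  by move=> oA i; have := anti _ oA i i; move: (A i i) => x; lra.
have mulE (A A' : 'M[R]_3) i j : (A *m A') i j = A i i0 * A' i0 j + A i i1 * A' i1 j + A i i2 * A' i2 j.
  by rewrite mxE !big_ord_recl big_ord0 addr0 addrA.
apply: (@lie_iso_coordinates 3 _ (fun A => A i2 i1) (fun A => A i0 i2) (fun A => A i1 i0) f1 f2 f3 1 1 1 B).
- by move=> k; rewrite !inE => /or3P[] /eqP -> a A A'; rewrite !mxE.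
- move=> A A' gA gA'; rewrite !(mulE, mxE) !(diag _ gA) !(diag _ gA').
  rewrite (anti _ gA i1 i0) (anti _ gA i2 i1) (anti _ gA i0 i2).
  rewrite (anti _ gA' i1 i0) (anti _ gA' i2 i1) (anti _ gA' i0 i2).
  by split; ring.
- move=> A gA x y z; apply/matrixP; apply: ordinal3_cases; apply: ordinal3_cases;
    rewrite mxE ?(diag _ gA) -/i0 -/i1 -/i2 ?x ?y ?z// (anti _ gA) ?x ?y ?z ?oppr0//.
move=> p q r; pose a (i j : 'I_3) : R :=
  nth 0 (nth [::] [:: [:: 0; - r; q]; [:: r; 0; - p]; [:: - q; p; 0]] i) j.
exists (\matrix_(i, j) a i j); split; rewrite ?mxE//.
by apply/matrixP; apply: ordinal3_cases; apply: ordinal3_cases; rewrite !mxE /a /= ?oppr0 ?opprK.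
Qed.

(* The coordinates in the basis diag(1, -1)/2, (E12 + E21)/2, (E12 - E21)/2. *)
Lemma killing_sl2 (f1 f2 f3 : vec) : simple_basis C f1 f2 f3 (- 1) (- 1) 1 ->
  germ_lie_iso K (sl2 R).
Proof.
move=> B; pose i0 : 'I_2 := ord0; pose i1 : 'I_2 := lift ord0 ord0.
have trE (A : 'M[R]_2) : sl2 R A -> A i1 i1 = - A i0 i0.
  rewrite /sl2 /= /mxtrace !big_ord_recl big_ord0 addr0 => /eqP; rewrite addrC addr_eq0.
  by move/eqP.
have mulE (A A' : 'M[R]_2) i j : (A *m A') i j = A i i0 * A' i0 j + A i i1 * A' i1 j.
  by rewrite mxE !big_ord_recl big_ord0 addr0.
apply: (@lie_iso_coordinates 2 _ (fun A => 2 * A i0 i0) (fun A => A i0 i1 + A i1 i0)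
  (fun A => A i0 i1 - A i1 i0) f1 f2 f3 (- 1) (- 1) 1 B).
- by move=> k; rewrite !inE => /or3P[] /eqP -> a A A'; rewrite !mxE; ring.
- move=> A A' gA gA'; rewrite !(mulE, mxE) (trE _ gA) (trE _ gA').
  by split; ring.
- move=> A gA x y z; have x' : A i0 i0 = 0 by lra.
  apply/matrixP; apply: ordinal2_cases; apply: ordinal2_cases; rewrite mxE -/i0 -/i1 ?(trE _ gA) ?x' ?oppr0//; lra.
move=> p q r; pose a (i j : 'I_2) : R :=
  nth 0 (nth [::] [:: [:: p / 2; (q + r) / 2]; [:: (q - r) / 2; - (p / 2)]] i) j.
exists (\matrix_(i, j) a i j); split; rewrite ?mxE /a /=; try lra.
by rewrite /sl2 /= /mxtrace !big_ord_recl big_ord0 addr0 !mxE /a /= subrr.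
Qed.

End LieIsomorphism.

(** * The model coordinates *)

Section ModelBasis.
Context {R : realType} (G : germ_algebra R).
Local Notation A := (ga_ring G).
Local Notation d0 := (ga_d0 (g := G)).
Local Notation d1 := (ga_d1 (g := G)).
Local Notation ev := (ga_ev G).
Local Notation cst := (ga_cst G).
Local Notation vec := (A * A)%type.
Implicit Types (X Y Z W U V : vec) (f g x y : A) (r s : R) (C : christoffel G).

Local Notation "r *v X" := (vscale (cst r) X) (at level 40).

Lemma coord_model_kil C D Y x y al be : coord_model C D Y x y al be ->
  [/\ kil C (vscale x D), kil C Y & forall h, ode_solution al be h -> kil C (vscale (ga_comp h y) D)].
Proof.
move=> [_ _ _ kP]; have kh h : ode_solution al be h -> kil C (vscale (ga_comp h y) D).
  by move=> hs; apply/kP; exists 0, 0, h; split=> //; rewrite !vcst0 !add0r.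
(* The description [kP] always includes the field of a solution [h], which is subtracted again. *)
have [h [hs _ _]] := ode_exists al be 0 0.
have kd a b : kil C (a *v vscale x D + b *v Y).
  rewrite -[_ + _](addrK (vscale (ga_comp h y) D)); apply: kil_add; last exact: kil_opp (kh _ hs).
  by apply/kP; exists a, b, h.
split=> //; first by have := kd 1 0; rewrite vcst1 vcst0 addr0.
by have := kd 0 1; rewrite vcst1 vcst0 add0r.
Qed.

(** Uniqueness of the Cauchy problem, read on germs: [u] and its derivative [u1] along [Y] form a
    closed linear system that vanishes at the origin. *)
Lemma comp_initial_values D Y y al be (h k l : R -> R) : ev (wedge D Y) != 0 ->
  der D y = 0 -> der Y y = 1 -> ev y = 0 ->
  ode_solution al be h -> ode_solution al be k -> ode_solution al be l ->
  k 0 = 1 -> k^`()%classic 0 = 0 -> l 0 = 0 -> l^`()%classic 0 = 1 ->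
  ga_comp h y = cst (h 0) * ga_comp k y + cst (h^`()%classic 0) * ga_comp l y.
Proof.
move=> w0 Dy Yy y0 hs ks ls k0 k1 l0 l1.
pose u := ga_comp h y - (cst (h 0) * ga_comp k y + cst (h^`()%classic 0) * ga_comp l y).
pose u1 := ga_comp h^`()%classic y - (cst (h 0) * ga_comp k^`()%classic y +
  cst (h^`()%classic 0) * ga_comp l^`()%classic y).
have Dc m : ode_solution al be m -> der D (ga_comp m y) = 0.
  by move=> ms; rewrite (der_comp _ _ ms) Dy mulr0.
have Yc m : ode_solution al be m -> der Y (ga_comp m y) = ga_comp m^`()%classic y.
  by move=> ms; rewrite (der_comp _ _ ms) Yy mulr1.
have s1 m : ode_solution al be m -> ode_solution al be m^`()%classic := @ode_solution_derive _ al be m.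
have Yc' m : ode_solution al be m -> der Y (ga_comp m^`()%classic y) =
    - cst al * ga_comp m^`()%classic y - cst be * ga_comp m y.
  move=> ms; rewrite (Yc _ (s1 _ ms)); have e := ga_compode y ms.
  change (ga_comp m^`(2)%classic y = - cst al * ga_comp m^`()%classic y - cst be * ga_comp m y).
  by ring_from e.
have ec m : ode_solution al be m -> ev (ga_comp m y) = m 0 by move=> ms; rewrite (ga_evcomp _ ms) y0.
have Du : der D u = 0 by rewrite /u !(derD, derN, derM, derC) !Dc//; ring.
have Du1 : der D u1 = 0.
  by rewrite /u1 !(derD, derN, derM, derC) !Dc; [ring|exact: s1|exact: s1|exact: s1].
have Yu : der Y u = u1 by rewrite /u !(derD, derN, derM, derC) !Yc// /u1; ring.
have Yu1 : der Y u1 = - cst al * u1 - cst be * u.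
  by rewrite /u1 !(derD, derN, derM, derC) !Yc'// /u /u1; ring.
have i0 : idl [:: u; u1] u by apply: idl_mem; exact: mem_head.
have i1 : idl [:: u; u1] u1 by apply: idl_mem; rewrite !inE eqxx orbT.
apply: subr0_eq; apply: (@idl_vanish_frame _ G [:: u; u1] D Y w0 _ u (mem_head _ _)) => f.
rewrite !inE => /orP[] /eqP ->.
  rewrite Du Yu; split; [exact: idl0|exact: i1|].
  by rewrite /u rmorphB rmorphD !rmorphM !ga_evC !ec// k0 l0; ring.
rewrite Du1 Yu1; split; first exact: idl0.
  by apply: idl_add; rewrite -?mulNr; [exact: idl_mul i1|exact: idl_mul i0].
by rewrite /u1 rmorphB rmorphD !rmorphM !ga_evC !ec; [rewrite k1 l1; ring|exact: s1|exact: s1|exact: s1].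
Qed.

(** A fundamental system [k], [l] of the differential equation supplies the last two basis
    vectors. *)
Lemma coord_model_basis C D Y x y al be : coord_model C D Y x y al be ->
  exists e1 e2 e3 e4 : vec, [/\ [/\ kil C e1, kil C e2, kil C e3 & kil C e4],
    forall p q r s, p *v e1 + q *v e2 + r *v e3 + s *v e4 = 0 ->
      [/\ p = 0, q = 0, r = 0 & s = 0] &
    forall V, kil C V -> exists p q r s, V = p *v e1 + q *v e2 + r *v e3 + s *v e4].
Proof.
move=> M; have [kx kY kh] := coord_model_kil M.
have [[bDY w0] [Dx Yx Dy Yy] [x0 y0] kP] := M.
have [k [ks k0 k1]] := ode_exists al be 1 0; have [l [ls l0 l1]] := ode_exists al be 0 1.
have ks' := ode_solution_derive ks; have ls' := ode_solution_derive ls.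
exists (vscale x D), Y, (vscale (ga_comp k y) D), (vscale (ga_comp l y) D); split.
- by split=> //; exact: kh.
- move=> p q r s e.
  have [e1 e2] : cst p * x + cst r * ga_comp k y + cst s * ga_comp l y = 0 /\ cst q = 0.
    by apply: (frame_indep_fun w0); rewrite -e; vring.
  have r0 : r = 0.
    have := congr1 ev e1; rewrite !rmorphD !rmorphM !ga_evC (ga_evcomp _ ks) (ga_evcomp _ ls).
    by rewrite x0 y0 k0 l0 rmorph0 !mulr0 addr0 add0r mulr1.
  rewrite r0 rmorph0 mul0r addr0 in e1.
  have s0 : s = 0.
    have := congr1 (der Y) e1; rewrite derD !derM !derC Yx (der_comp _ _ ls) Yy => /(congr1 ev).
    rewrite (_ : der Y 0 = 0); last by rewrite /der !dE; ring.
    rewrite !rmorphD !rmorphM !rmorph0 !ga_evC (ga_evcomp _ ls') y0 l1 rmorph1; lra.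
  rewrite s0 rmorph0 mul0r addr0 in e1.
  have p0 : p = 0.
    apply: (@cst_eq0 _ G); have := congr1 (der D) e1; rewrite derM derC Dx mul0r add0r mulr1 => ->.
    by rewrite /der !dE; ring.
  by split=> //; exact: cst_eq0 e2.
move=> V /kP[a [b [h [hs ->]]]]; exists a, b, (h 0), (h^`()%classic 0).
rewrite (comp_initial_values w0 Dy Yy y0 hs ks ls k0 k1 l0 l1); vring.
Qed.

Lemma dual_frame D Y x y V : ev (wedge D Y) != 0 ->
  der D x = 1 -> der Y x = 0 -> der D y = 0 -> der Y y = 1 ->
  V = vscale (der V x) D + vscale (der V y) Y.
Proof.
move=> w0 Dx Yx Dy Yy; have [f [g ->]] := frame_decomp V w0.
have dE' z : der (vscale f D + vscale g Y) z = f * der D z + g * der Y z by rewrite /der /=; ring.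
by rewrite !dE' Dx Yx Dy Yy !mulr1 !mulr0 addr0 add0r.
Qed.

(** The Jacobian matrix of [(x, y)] and the matrix of the frame are inverse to each other. *)
Lemma dual_frame_det D Y x y : der D x = 1 -> der Y x = 0 -> der D y = 0 -> der Y y = 1 ->
  ev (d0 x) * ev (d1 y) - ev (d1 x) * ev (d0 y) != 0.
Proof.
move=> e1 e2 e3 e4; have := congr1 ev e1; have := congr1 ev e2.
have := congr1 ev e3; have := congr1 ev e4.
rewrite /der !rmorphD !rmorphM rmorph0 rmorph1.
move: (ev (d0 x)) (ev (d1 x)) (ev (d0 y)) (ev (d1 y)) => a b c d.
move: (ev D.1) (ev D.2) (ev Y.1) (ev Y.2) => p q r s f4 f3 f2 f1.
apply/eqP => det; have : (p * a + q * b) * (r * c + s * d) - (p * c + q * d) * (r * a + s * b) = 0.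
  by transitivity ((a * d - b * c) * (p * s - q * r)); [ring|rewrite det mul0r].
by rewrite f1 f2 f3 f4 mul0r subr0 mulr1 => /eqP; rewrite oner_eq0.
Qed.

End ModelBasis.

(** * From germs of coordinates to a chart *)

Section Chart.
Context {R : realType} (U : set (plane R)) (nabla : vfield R -> vfield R -> vfield R).
Hypotheses (oU : open U) (cn : affine_connection U nabla) (U0 : U 0).
Implicit Types (X Y Z : vfield R).
Local Notation K := (killing_germ U nabla).
Local Notation G := (germ_alg (0 : plane R)).
Local Notation C := (christoffel_at nabla 0).
Local Notation vec := (ga_ring G * ga_ring G)%type.
Local Notation "r *v X" := (vscale (G := G) (ga_cst G r) X) (at level 40).
Local Notation KP := (fun X => killing_germP oU cn X U0).

#[local] Opaque partial derive.

Lemma chart_jacobian (D Y : vec) (x y : ga_ring G) :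
  der D x = 1 -> der Y x = 0 -> der D y = 0 -> der Y y = 1 ->
  partial ix0 (germ_rep x) 0 * partial ix1 (germ_rep y) 0 -
  partial ix1 (germ_rep x) 0 * partial ix0 (germ_rep y) 0 != 0.
Proof.
have dv i (z : germ (0 : plane R)) : germ_ev (germ_diff i z) = partial i (germ_rep z) 0.
  by rewrite /germ_diff germ_ev_of//; exact: smooth_near_partial (germ_rep_smooth z).
move=> Dx Yx Dy Yy; have := dual_frame_det Dx Yx Dy Yy.
by rewrite -!dv.
Qed.

(** The [j]-th component of [phi \o psi = id] is differentiated in direction [i]. *)
Lemma chart_fields (V V1 V2 : set (plane R)) (f : 'I_2 -> plane R -> R) (phi psi : vfield R) (i j : 'I_2) :
  open V -> open V1 -> open V2 -> V1 0 -> V1 `<=` V -> (forall j, smooth V (f j)) ->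
  (forall q, phi q = \row_j f j q) -> smooth V1 phi -> smooth V2 psi ->
  (forall q, V1 q -> V2 (phi q) /\ psi (phi q) = q) ->
  (forall q, V2 q -> V1 (psi q) /\ phi (psi q) = q) ->
  vsmooth_near 0 (coord_field phi psi i) /\
  der (G := G) (vgerm 0 (coord_field phi psi i)) (germ_of 0 (f j)) = (i == j)%:R.
Proof.
move=> oV oV1 oV2 V10 V1V Cf phiE Cphi Cpsi phiK psiK.
have sc : vsmooth_near 0 (coord_field phi psi i).
  exists V1; split=> //; apply/(smooth_coordP _ oV1) => k m.
  apply: (Ck_comp (g := component k (partial i psi)) (X := phi) oV2 oV1).
  - have C' : smooth V2 (partial i psi) by move=> n; exact: Ck_partial (Cpsi n.+1).
    exact: (smooth_coordP _ oV2).1 C' k m.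
  - exact: Cphi.
  - by move=> q /phiK[].
split=> //; have sf : f j \in smooth_near 0.
  by apply/smooth_nearP; exists V; split=> //; exact: V1V.
rewrite -(germ_der_coord sc sf).
have e : \forall q \near (0 : plane R), der_coord (coord_field phi psi i) (f j) q = (i == j)%:R.
  apply: filterS (open_near oV1 V10) => q V1q; have [V2q pq] := phiK _ V1q.
  have dpsi : derivable psi (phi q) 'e_i := Ck_derivable (Cpsi 1%N) V2q.
  have Vq : V (psi (phi q)) by rewrite pq; exact: V1V.
  have cr := chain_rule oV (Cf j 1%N) Vq dpsi.
  have near_id : \forall r \near phi q, (f j \o psi) r = r 0 j.
    apply: filterS (open_near oV2 V2q) => r V2r; have [_ pr] := psiK _ V2r.
    by rewrite -[in RHS]pr phiE mxE.
  have := nbhs_singleton (near_partial i near_id); rewrite partial_coord => <-.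
  have -> : partial i (f j \o psi) (phi q) = 'D_('e_i) (f j \o psi) (phi q) by [].
  rewrite (@derive_val _ _ _ _ _ _ _ cr) pq.
  by rewrite /der_coord !fctE /component /coord_field.
have sr : (fun=> (i == j)%:R : R) \in smooth_near (0 : plane R) by exact: smooth_near_cst.
rewrite ((germ_of_eq (smooth_der_coord sc sf) sr).2 e).
by case: (i == j); [exact: germ_of1|exact: germ_of0].
Qed.

(** Representatives of [x] and [y] are the components of the chart. Its coordinate fields
    differentiate [x] and [y] as [D] and [Y] do, so by [dual_frame] their germs are [D] and [Y]. *)
Lemma model_chart (D Y : vec) (x y : ga_ring G) al be : coord_model C D Y x y al be ->
  exists (V V' : set (plane R)) (phi psi : vfield R), local_coordinates V V' phi psi /\
    K = germ_span (model_generators phi psi al be).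
Proof.
move=> M; have [kx kY kh] := coord_model_kil M.
have [[bDY w0] [Dx Yx Dy Yy] [x0 y0] kP] := M.
have [V [oV V0 Cx Cy]] := smooth_near2 (germ_rep_smooth x) (germ_rep_smooth y).
pose f (j : 'I_2) := if j == ix0 then germ_rep x else germ_rep y.
have Cf j : smooth V (f j) by rewrite /f; case: ifP.
have f0 : f ix0 = germ_rep x by rewrite /f eqxx.
have f1 : f ix1 = germ_rep y by rewrite /f ix1_neq0.
have det := chart_jacobian Dx Yx Dy Yy; rewrite -f0 -f1 in det.
have [V1 [V2 [psi [[oV1 V10 V1V] oV2 _ phiK [psiK Cpsi]]]]] :=
  inverse_function_theorem oV (fun k j => Cf j k) V0 det.
pose phi : vfield R := fun q => \row_j f j q.
have phiE q : phi q = \row_j f j q by [].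
have Cphi : smooth V1 phi.
  apply/(smooth_coordP _ oV1) => j k; rewrite (_ : component j phi = f j).
    exact: Ck_sub (Cf j k).
  by apply/funext => q; rewrite /component phiE mxE.
have CF i j := chart_fields i j oV oV1 oV2 V10 V1V Cf phiE Cphi Cpsi phiK psiK.
have [s0 c00] := CF ix0 ix0; have [_ c01] := CF ix0 ix1.
have [s1 c10] := CF ix1 ix0; have [_ c11] := CF ix1 ix1.
rewrite f0 germ_ofK eqxx in c00; rewrite f1 germ_ofK ix0_neq1 in c01.
rewrite f0 germ_ofK ix1_neq0 in c10; rewrite f1 germ_ofK eqxx in c11.
have eD : vgerm 0 (coord_field phi psi ix0) = D.
  apply: etrans (@dual_frame _ G D Y x y _ w0 Dx Yx Dy Yy) _.
  by rewrite c00 c01 mulr0n mulr1n vscale1 vscale0 addr0.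
have eY : vgerm 0 (coord_field phi psi ix1) = Y.
  apply: etrans (@dual_frame _ G D Y x y _ w0 Dx Yx Dy Yy) _.
  by rewrite c10 c11 mulr0n mulr1n vscale1 vscale0 add0r.
exists V1, V2, phi, psi; split.
  split; [by split|exact: oV2|by split| |].
    by split=> [_ [q V1q <-]|_ [q V2q <-]]; [have [] := phiK _ V1q|have [] := psiK _ V2q].
  by split=> q; rewrite inE => Vq; [have [] := phiK _ Vq|have [] := psiK _ Vq].
pose xf : plane R -> R := fun p => phi p 0 0; pose yf : plane R -> R := fun p => phi p 0 1.
have xfE : xf = germ_rep x by apply/funext => q; rewrite /xf -ix0E phiE mxE f0.
have yfE : yf = germ_rep y by apply/funext => q; rewrite /yf -ix1E phiE mxE f1.
have sxf : germ_rep x \in smooth_near 0 by exact: germ_rep_smooth.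
have gx : vgerm 0 (fscale xf (coord_field phi psi ix0)) = vscale (G := G) x D.
  by rewrite xfE (vgerm_fscale sxf s0) germ_ofK eD.
have sh h : ode_solution al be h -> h \o germ_rep y \in smooth_near 0.
  by move=> hs; apply: (smooth_near_ode hs); exact: germ_rep_smooth.
have gh h : ode_solution al be h ->
    vgerm 0 (fscale (h \o yf) (coord_field phi psi ix0)) = vscale (G := G) (ga_comp h y) D.
  by move=> hs; rewrite yfE (vgerm_fscale (sh _ hs) s0) eD.
have genE : model_generators phi psi al be = [set X | [\/ X = fscale xf (coord_field phi psi ix0),
    X = coord_field phi psi ix1 |
    exists2 h, ode_solution al be h & X = fscale (h \o yf) (coord_field phi psi ix0)]].
  by rewrite /model_generators -ix0E -ix1E.
rewrite genE; apply: (killing_span oU cn U0) => [X [->|->|[h hs ->]]|v].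
- apply/KP; split; last by rewrite gx; exact: kx.
  by rewrite xfE; exact: (vsmooth_fscale sxf s0).
- by apply/KP; split; [exact: s1|rewrite eY; exact: kY].
- apply/KP; split; last by rewrite (gh _ hs); exact: (kh _ hs).
  by rewrite yfE; exact: (vsmooth_fscale (sh _ hs) s0).
move=> /kP[a [b [h [hs ->]]]].
pose F (i : 'I_3) : vfield R := nth 0 [:: fscale xf (coord_field phi psi ix0);
  coord_field phi psi ix1; fscale (h \o yf) (coord_field phi psi ix0)] i.
exists 3%N, (fun i => [:: a; b; 1]`_i), F; split.
  apply: ordinal3_cases; [exact: Or31|exact: Or32|by apply: Or33; exists h].
rewrite !big_ord_recl big_ord0 addr0 addrA.
change (a *v vscale (G := G) x D + b *v Y + vscale (G := G) (ga_comp h y) D =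
  a *v vgerm 0 (fscale xf (coord_field phi psi ix0)) + b *v vgerm 0 (coord_field phi psi ix1) +
  1 *v vgerm 0 (fscale (h \o yf) (coord_field phi psi ix0))).
by rewrite gx eY (gh _ hs) vcst1.
Qed.

End Chart.

Theorem theorem3 (R : realType) (U : set 'rV[R]_2)
    (nabla : vfield R -> vfield R -> vfield R)
    (hU : open U) (hU0 : U 0)
    (hconn : affine_connection U nabla)
    (hkilling : exists X1 X2 : vfield R,
       [/\ killing_germ U nabla X1, killing_germ U nabla X2
         & free [:: X1 0; X2 0]])
    (hnontrivial : ~ exists V : set 'rV[R]_2,
       [/\ open V, V 0, V `<=` U, torsion_free V nabla & flat V nabla]) :
  exists2 n : nat,
    germ_dim (killing_germ U nabla) n /\ (n <= 4)%N
  & [\/ n = 2%N,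
        germ_lie_iso (killing_germ U nabla) (o3 R),
        germ_lie_iso (killing_germ U nabla) (sl2 R)
      | exists (V V' : set 'rV[R]_2) (phi psi : vfield R) (alpha beta : R),
          local_coordinates V V' phi psi /\
          killing_germ U nabla = germ_span (model_generators phi psi alpha beta)].
Proof.
have tC := kil_frame_of hU hconn hU0 hkilling.
have nf : nonflat (christoffel_at nabla 0).
  by move=> fl; apply: hnontrivial; exact: flat_spread.
have [[X [Y [kX kY w0 span]]]|[e1 [e2 [e3 [al [be [ga B]]]]]]|[D [Y [x [y [al [be M]]]]]]] :=
  classification tC nf.
- exists 2%N; last exact: Or41.
  by split=> //; exact: (germ_dim2 hU hconn hU0 kX kY w0 span).
- exists 3%N.
    split=> //; have [[k1 k2 k3] _ _ indep span] := B.
    exact: (germ_dim3 hU hconn hU0 k1 k2 k3 indep span).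
  have [f1 [f2 [f3 [B'|B']]]] := simple_basis_normal B.
    by apply: Or42; exact: (killing_o3 hU hconn hU0 B').
  by apply: Or43; exact: (killing_sl2 hU hconn hU0 B').
exists 4%N.
  split=> //; have [f1 [f2 [f3 [f4 [[k1 k2 k3 k4] indep span]]]]] := coord_model_basis M.
  exact: (germ_dim4 hU hconn hU0 k1 k2 k3 k4 indep span).
apply: Or44; have [V [V' [phi [psi MP]]]] := model_chart hU hconn hU0 M.
by exists V, V', phi, psi, al, be.
Qed.
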